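(* There is a universal constant $c>0$ such that the following holds for every $n\ge 1$. Let $\mu$ be the standard Gaussian measure on $\mathbb{R}$ and consider $\mu^{\otimes n}$ on $\mathbb{R}^n$. For any convex set $A\in\mathcal{J}_n$ with $\mu^{\otimes n}(A)=t$, $$\mathbb{E}_{M\sim\pi}\Bigl[\sum_{i=1}^n I_i^{\mathcal G}(M(A))\Bigr]\ge c\,t(1-t)\sqrt{-\log\bigl(t(1-t)\bigr)}\times\sqrt n,$$ where $\mathbb{E}_{M\sim\pi}$ denotes expectation when $M$ is drawn according to the Haar probability measure $\pi$ on the orthogonal group $O(n,\mathbb{R})$. In particular, there exists an orthogonal transformation $g$ of $\mathbb{R}^n$ such that $$\sum_{i=1}^n I_i^{\mathcal G}(g(A))\ge c\,t(1-t)\sqrt{-\log\bigl(t(1-t)\bigr)}\times\sqrt n.$$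
   Context: For $x\in\mathbb{R}^n$, $r>0$, $B(x,r)$ and $\bar B(x,r)$ are the open and closed Euclidean balls. For $\varepsilon>0$ and $A\subseteq\mathbb{R}^n$ let $A_\varepsilon=\{x\in A:\bar B(x,\varepsilon)\cap A^c=\varnothing\}$ and $A^\varepsilon=\{x\in\mathbb{R}^n:B(x,\varepsilon)\cap A\neq\varnothing\}$. $\mathcal{J}_n$ is the collection of all measurable sets $B\subseteq\mathbb{R}^n$ for which there exists $\delta>0$ such that $(B_\varepsilon)^{2\varepsilon}\supseteq B$ for all $0<\varepsilon<\delta$. Geometric influence: for a probability measure $\nu$ on $\mathbb{R}$ and a measurable $S\subseteq\mathbb{R}$, the lower Minkowski content is $\nu^+(S)=\liminf_{r\downarrow 0}\frac{\nu(S+[-r,r])-\nu(S)}{r}$ (Minkowski sum). For $A\subseteq\mathbb{R}^n$, $x\in\mathbb{R}^n$ and $1\le i\le n$, let $A_i^x=\{y\in\mathbb{R}:(x_1,\dots,x_{i-1},y,x_{i+1},\dots,x_n)\in A\}$. The geometric influence of the $i$th coordinate on $A$ with respect to $\nu^{\otimes n}$ is $I_i^{\mathcal G}(A)=\mathbb{E}_{x\sim\nu^{\otimes n}}[\nu^+(A_i^x)]$. Here $\nu=\mu$. When $t\in\{0,1\}$ the right-hand sides are read as $0$. *)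

(* Defs.v *)
From HB Require Import structures.
From mathcomp Require Import all_boot all_order all_algebra.
From mathcomp Require Import all_classical all_reals all_analysis.

Set Implicit Arguments.
Unset Strict Implicit.
Unset Printing Implicit Defensive.

Import Order.TTheory GRing.Theory Num.Theory.
Import numFieldNormedType.Exports.

Local Open Scope classical_set_scope.
Local Open Scope ring_scope.

Fact matrix_display : measure_display.
Proof. exact: default_measure_display. Qed.

(* Matrices carry the product sigma-algebra (the one generated by the entries);
   over the reals it is the Borel sigma-algebra. *)
Section matrix_measurable.
Context {R : realType} {m n : nat}.

Definition entry_preimages : set (set 'M[R]_(m, n)) :=
  [set B | exists i j (U : set R),
     measurable U /\ B = [set M : 'M[R]_(m, n) | U (M i j)]].

Definition matrix_measurable : set (set 'M[R]_(m, n)) := <<s entry_preimages >>.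

Let matrix_measurable0 : matrix_measurable set0.
Proof. exact: sigma_algebra0. Qed.

Let matrix_measurableC B : matrix_measurable B -> matrix_measurable (~` B).
Proof. exact: sigma_algebraC. Qed.

Let matrix_measurable_bigcup (F : _^nat) :
  (forall i, matrix_measurable (F i)) -> matrix_measurable (\bigcup_i F i).
Proof. exact: sigma_algebra_bigcup. Qed.

HB.instance Definition _ := @isMeasurable.Build matrix_display
  'M[R]_(m, n) matrix_measurable
  matrix_measurable0 matrix_measurableC matrix_measurable_bigcup.

Lemma measurable_entry (i : 'I_m) (j : 'I_n) :
  measurable_fun setT (fun M : 'M[R]_(m, n) => M i j).
Proof.
move=> _ U mU; rewrite setTI; apply: sub_sigma_algebra.
by exists i, j, U.
Qed.

Lemma measurable_fun_mx d (T : measurableType d) (f : T -> 'M[R]_(m, n)) :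
  (forall i j, measurable_fun setT (fun t => f t i j)) -> measurable_fun setT f.
Proof.
move=> mf; apply: (@measurability _ _ _ _ _ _ entry_preimages) => //.
move=> _ [_ [i [j [U [mU ->]]]] <-].
exact: mf.
Qed.

End matrix_measurable.

Section product_power.
Context {R : realType}.

Definition cV_cons n (p : measurableTypeR R * 'cV[R]_n) : 'cV[R]_n.+1 :=
  \col_i (if unlift ord0 i is Some j then p.2 j 0 else p.1).

Lemma measurable_cV_cons n : measurable_fun setT (@cV_cons n).
Proof.
apply: measurable_fun_mx => i j.
rewrite /cV_cons; under eq_fun do rewrite mxE.
case: (unliftP ord0 i) => [k _|_]; last exact: measurable_fst.
apply: (measurableT_comp (measurable_entry k 0)).
exact: measurable_snd.
Qed.

HB.instance Definition _ n :=
  isMeasurableFun.Build _ _ _ _ (@cV_cons n) (@measurable_cV_cons n).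

Fixpoint product_power (nu : probability (measurableTypeR R) R) (n : nat) :
    probability 'cV[R]_n R :=
  match n with
  | 0 => \d_(0 : 'cV[R]_0)
  | n'.+1 => distribution (nu \x product_power nu n')%E (@cV_cons n')
  end.

Lemma measurable_box n (B : 'I_n -> set R) :
  (forall i, measurable (B i)) ->
  measurable [set x : 'cV[R]_n | forall i, B i (x i 0)].
Proof.
move=> mB.
have -> : [set x : 'cV[R]_n | forall i, B i (x i 0)] =
    \big[setI/setT]_(i < n) [set x : 'cV[R]_n | B i (x i 0)].
  by rewrite -bigcap_seq; apply/seteqP; split=> x h i; [move=> _|];
    [exact: h|apply: (h i); rewrite /= mem_index_enum].
apply: bigsetI_measurable => i _.
have := measurable_entry i (0 : 'I_1).
by move=> /(_ R measurableT (B i) (mB i)); rewrite setTI.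
Qed.

Lemma product_power_box (nu : probability (measurableTypeR R) R) n (B : 'I_n -> set R) :
  (forall i, measurable (B i)) ->
  product_power nu n [set x | forall i, B i (x i 0)] = (\prod_i nu (B i))%E.
Proof.
elim: n B => [|n IH] B mB /=.
  by rewrite big_ord0 diracE mem_set// => -[].
rewrite /distribution /pushforward big_ord_recl -IH//.
have mBl : measurable [set v : 'cV[R]_n | forall i, B (lift ord0 i) (v i 0)].
  exact: (measurable_box (B := fun i => B (lift ord0 i))).
rewrite -(product_measure1E nu (product_power nu n) (mB ord0) mBl).
congr (_ _); apply/seteqP; split => -[x v] /=.
  move=> h; split => [|i].
    by have := h ord0; rewrite mxE unlift_none.
  by have := h (lift ord0 i); rewrite mxE liftK.
move=> [h0 h] i; rewrite mxE.
by case: (unliftP ord0 i) => [j|] ->.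
Qed.

End product_power.

Section euclidean.
Context {R : realType} {n : nat}.
Implicit Types (x : 'cV[R]_n) (A : set 'cV[R]_n) (r e : R).

(* The library norm on matrices is the sup norm. *)
Definition euclidean_norm x : R := Num.sqrt (\sum_(i < n) x i 0 ^+ 2).

Definition euclidean_ball x r : set 'cV[R]_n :=
  [set y | euclidean_norm (y - x) < r].

Definition euclidean_cball x r : set 'cV[R]_n :=
  [set y | euclidean_norm (y - x) <= r].

Definition erosion A e : set 'cV[R]_n :=
  [set x | A x /\ euclidean_cball x e `&` ~` A = set0].

Definition dilation A e : set 'cV[R]_n :=
  [set x | euclidean_ball x e `&` A !=set0].

Definition calJ A : Prop :=
  measurable A /\
  exists2 delta : R, 0 < delta &
    forall e, 0 < e -> e < delta -> A `<=` dilation (erosion A e) (2 * e).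

End euclidean.

Section influence.
Context {R : realType}.
Local Open Scope ereal_scope.

Definition lower_minkowski_content (nu : probability (measurableTypeR R) R) (S : set R) : \bar R :=
  limf_einf (fun r : R =>
      (nu [set (s + u)%R | s in S & u in `[(- r)%R, r]] - nu S) * (r^-1)%:E)
    (0%R : R)^'+.

Definition fiber n (A : set 'cV[R]_n) (i : 'I_n) (x : 'cV[R]_n) : set R :=
  [set y | A (\col_j (if j == i then y else x j 0%R))].

Definition geometric_influence (nu : probability (measurableTypeR R) R) n (i : 'I_n)
    (A : set 'cV[R]_n) : \bar R :=
  \int[product_power nu n]_x lower_minkowski_content nu (fiber A i x).

End influence.

Definition std_gaussian {R : realType} : probability (measurableTypeR R) R :=
  normal_prob (0 : R) 1.

Section orthogonal.
Context {R : realType} {n : nat}.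

Record orthogonal_group := Orthogonal {
  orthogonal_mx :> 'M[R]_n;
  _ : orthogonal_mx *m orthogonal_mx^T == 1%:M }.

HB.instance Definition _ := [isSub for orthogonal_mx].
HB.instance Definition _ := [Choice of orthogonal_group by <:].

Fact orthogonal1_subproof : (1%:M : 'M[R]_n) *m (1%:M)^T == 1%:M.
Proof. by rewrite trmx1 mulmx1. Qed.

Definition orthogonal1 := Orthogonal orthogonal1_subproof.

Fact orthogonal_mul_subproof (g h : orthogonal_group) :
  (g *m h) *m (g *m h)^T == 1%:M :> 'M[R]_n.
Proof.
case: g h => [g /eqP gP] [h /eqP hP] /=.
by rewrite trmx_mul mulmxA -(mulmxA g) hP mulmx1 gP.
Qed.

Definition orthogonal_mul g h := Orthogonal (orthogonal_mul_subproof g h).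

HB.instance Definition _ := isPointed.Build orthogonal_group orthogonal1.

(* The trace of the Borel sigma-algebra of matrices, i.e. the Borel
   sigma-algebra of O(n). *)
Definition orthogonal_measurable : set (set orthogonal_group) :=
  preimage_set_system setT orthogonal_mx measurable.

Let orthogonal_sigma_algebra : sigma_algebra setT orthogonal_measurable.
Proof.
apply: sigma_algebra_preimage.
exact: sigma_algebra_measurable.
Qed.

Let orthogonal_measurable0 : orthogonal_measurable set0.
Proof. by case: orthogonal_sigma_algebra. Qed.

Let orthogonal_measurableC B :
  orthogonal_measurable B -> orthogonal_measurable (~` B).
Proof. by case: orthogonal_sigma_algebra => _ + _ => /[apply]; rewrite setTD. Qed.

Let orthogonal_measurable_bigcup (F : _^nat) :
  (forall i, orthogonal_measurable (F i)) ->
  orthogonal_measurable (\bigcup_i F i).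
Proof. by case: orthogonal_sigma_algebra => _ _; apply. Qed.

HB.instance Definition _ := @isMeasurable.Build matrix_display
  orthogonal_group orthogonal_measurable
  orthogonal_measurable0 orthogonal_measurableC orthogonal_measurable_bigcup.

(* On a compact group left invariance determines the Haar probability measure. *)
Definition is_haar (pi : probability orthogonal_group R) : Prop :=
  forall (g : orthogonal_group) (B : set orthogonal_group), measurable B ->
    pi (orthogonal_mul g @` B) = pi B.

Definition orthogonal_image (g : orthogonal_group) (A : set 'cV[R]_n) :
    set 'cV[R]_n :=
  [set g *m x | x in A].

End orthogonal.
Arguments orthogonal_group : clear implicits.

(* Main.v *)
(* For a Gaussian pair (X, Y) put X_a = X cos a + Y sin a and
   noise(a) = P(exactly one of X, X_a lies in A).

   Lower bound.  A fixed large amount of noise satisfies the small-set estimate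
   P(X in A, X_a in A) <= t^(5/4): in dimension one it follows from the Mehler
   kernel, and it tensorizes.  Cauchy-Schwarz gives c(r)^2 <= t c(r^2) for
   c(r) = P(X in A, X_a in A), r = cos a, so that c(r^(1/2^k)) <= t^(1 + 2^-k/4);
   hence noise(a) >= C a t sqrt(- ln t) for a suitable angle a.

   Upper bound.  Since noise(k a) <= k noise(a), only infinitesimal angles matter.
   By rotation invariance X and X_2a may be replaced by (cos a) U -/+ (sin a) V,
   whose difference 2 (sin a) V is independent of U.  On a line an interval is
   crossed by a shift of size d with probability at most d times its Minkowski
   content plus O(d^2), and the direction of V is that of a Haar-random basis
   vector, so sqrt n * noise(a) is at most a constant times a times the average
   total influence.  No surface measure is needed. *)
From HB Require Import structures.
Require Import Defs.
From mathcomp Require Import all_boot all_order all_algebra.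
From mathcomp Require Import all_classical all_reals all_analysis.
From mathcomp Require Import measurable_realfun ring lra.
Set Implicit Arguments.
Unset Strict Implicit.
Unset Printing Implicit Defensive.
Import Order.TTheory GRing.Theory Num.Theory.
Import numFieldNormedType.Exports.
Local Open Scope classical_set_scope.
Local Open Scope ring_scope.

(** * Rotation invariance of the Gaussian measure *)

(** Two points shape the proof. The Minkowski content of a fiber is not known to be measurable in
    the base point, nor the total influence in the rotation, so integrals of influences are only
    lower integrals, suprema over simple functions below. These are monotone but not additive;
    influences therefore enter only on the large side of affine bounds on measurable quantities, and
    their integrals are never split or interchanged.

    Correlation 1/4 is a convenient value well below 1/sqrt 3, the critical one for the noise
    operator to contract L^2 into L^4. The room left lets a pointwise Cauchy-Schwarz bound on the
    kernel replace sharp hypercontractivity. The exponent 5/4 is 3/4 + 1/2: Hoelder with exponents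
    4/3 and 4, then this contraction.

    The factor sqrt n comes from comparing all n directions with one Gaussian displacement of length
    about sqrt n: n times the noise of a small angle a is at most of order a sqrt n times the
    average total influence. The quadratic errors grow with n, but vanish when a fixed angle is cut
    into ever more steps. *)

Section density.
Import HBNNSimple.
Local Open Scope ereal_scope.
Context d (T : measurableType d) (R : realType).
Variables (mu nu : {measure set T -> \bar R}) (phi : T -> R).
Hypothesis mphi : measurable_fun setT phi.
Hypothesis phi0 : forall x, (0 <= phi x)%R.
Hypothesis nuE : forall A, measurable A -> nu A = \int[mu]_(x in A) (phi x)%:E.

(** Both sides are limits along the same increasing simple functions; linearity then reduces them to
    indicators, where the claim is [nuE]. *)
Lemma integral_density (f : T -> \bar R) :
  measurable_fun setT f -> (forall x, 0 <= f x) ->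
  \int[nu]_x f x = \int[mu]_x (f x * (phi x)%:E).
Proof.
move=> mf f0; pose h := nnsfun_approx measurableT mf.
have mphiE : measurable_fun setT (EFin \o phi) by exact/measurable_EFinP.
have limh x : (h n x)%:E @[n --> \oo] --> f x by exact: cvg_nnsfun_approx.
have ndh x (a b : nat) : (a <= b)%N -> (h a x)%:E <= (h b x)%:E.
  by move=> ab; rewrite lee_fin; exact/lefP/nd_nnsfun_approx.
have -> : \int[nu]_x f x = limn (fun n => \int[nu]_x (h n x)%:E).
  rewrite -monotone_convergence//.
  - by apply: eq_integral => x _; apply/esym/cvg_lim.
  - by move=> n; exact/measurable_EFinP.
  - by move=> n x _; rewrite lee_fin.
  - by move=> x _ a b; exact: ndh.
have -> : \int[mu]_x (f x * (phi x)%:E) =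
    limn (fun n => \int[mu]_x ((h n x)%:E * (phi x)%:E)).
  rewrite -monotone_convergence//.
  - by apply: eq_integral => x _; apply/esym/cvg_lim => //; exact: cvgeZr.
  - by move=> n; apply: emeasurable_funM => //; exact/measurable_EFinP.
  - by move=> n x _; rewrite mule_ge0 ?lee_fin.
  - by move=> x _ a b ab; rewrite lee_wpmul2r ?lee_fin//; exact: ndh.
congr (limn _); apply/funext => n.
rewrite integralT_nnsfun sintegralE.
transitivity (\int[mu]_x \sum_(y \in range (h n))
    ((y * \1_(h n @^-1` [set y]) x)%:E * (phi x)%:E)); last first.
  apply: eq_integral => x _; rewrite -ge0_mule_fsuml; last first.
    by move=> y; exact: nnfun_muleindic_ge0.
  by rewrite fsumEFin// -fimfunE.
rewrite ge0_integral_fsum//; last 2 first.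
- move=> y; apply: emeasurable_funM => //; apply/measurable_EFinP.
  exact: measurable_funM.
- by move=> y x _; rewrite mule_ge0 ?lee_fin//; exact: nnfun_muleindic_ge0.
apply: eq_fsbigr => r; rewrite inE => -[t _ <-].
under eq_integral do rewrite EFinM -muleA.
rewrite ge0_integralZl//; last 3 first.
- by apply: emeasurable_funM => //; exact/measurable_EFinP.
- by move=> x _; rewrite mule_ge0 ?lee_fin.
- by rewrite lee_fin.
rewrite nuE// [in LHS]integral_mkcond; congr (_ * _).
by apply: eq_integral => x _; rewrite epatch_indic muleC.
Qed.

End density.
Section lower_integral.
Local Open Scope ereal_scope.
Context d (T : measurableType d) (R : realType).
Variable mu : {measure set T -> \bar R}.

(** The integral of a nonnegative function is a supremum over the simple functions below it, hence
    monotone for arbitrary functions. This is what later allows integrals of influences. *)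
Lemma le_lower_integral (f g : T -> \bar R) :
  (forall x, 0 <= f x) -> (forall x, f x <= g x) ->
  \int[mu]_x f x <= \int[mu]_x g x.
Proof.
move=> f0 fg; have g0 x : 0 <= g x := le_trans (f0 x) (fg x).
rewrite !ge0_integralTE//; apply: le_ereal_sup => _ [h /= hf <-].
by exists h => //= x; exact: le_trans (hf x) (fg x).
Qed.
End lower_integral.

Lemma integral_preserving d (T : measurableType d) (R : realType)
    (mu : {measure set T -> \bar R}) (phi : T -> T) (f : T -> \bar R) :
  measurable_fun setT phi ->
  (forall A, measurable A -> mu (phi @^-1` A) = mu A) ->
  measurable_fun setT f -> (forall x, (0 <= f x)%E) ->
  (\int[mu]_x f (phi x) = \int[mu]_x f x)%E.
Proof.
move=> mphi muphi mf f0; pose phi' : {mfun _ >-> _} :=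
  HB.pack phi (isMeasurableFun.Build _ _ _ _ _ mphi).
rewrite -[LHS](ge0_integral_pushforward mphi mu measurableT mf)//.
rewrite -/(pushforward mu phi') (eq_measure_integral mu)// => A mA _.
exact: muphi.
Qed.

Section lebesgue_shift.
Context (R : realType).
Local Notation lambda := (@lebesgue_measure R).
Local Open Scope ereal_scope.

Lemma lebesgue_measure_shift (a : R) (A : set R) : measurable A ->
  lambda [set x | A (x + a)%R] = lambda A.
Proof.
move=> mA.
have ma : measurable_fun setT (fun x : measurableTypeR R => x + a : measurableTypeR R)%R.
  exact: measurable_funD.
pose f : {mfun _ >-> _} := HB.pack (fun x : measurableTypeR R => x + a : measurableTypeR R)%R
  (isMeasurableFun.Build _ _ _ _ _ ma).
apply/esym; apply: (@lebesgue_measure_unique _ (pushforward lambda f)) => //= _ [[u v]] _ <-.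
rewrite /pushforward/= lebesgue_measure_itv/=.
have -> : f @^-1` `]u, v] = [set` `](u - a)%R, (v - a)%R]] :> set R.
  by apply/seteqP; split => x /=; rewrite !in_itv/= ltrBlDr lerBrDr.
rewrite lebesgue_measure_itv/= !lte_fin ltrD2r; case: ifP => // _.
by rewrite -!EFinB; congr EFin; ring.
Qed.

Lemma integral_lebesgue_shift (f : R -> \bar R) (a : R) :
  measurable_fun setT f -> (forall x, 0 <= f x) ->
  \int[lambda]_x f (x + a)%R = \int[lambda]_x f x.
Proof.
move=> mf f0; apply: (@integral_preserving _ (measurableTypeR R) R lambda
  (fun x => x + a)%R f) => //.
  exact: measurable_funD.
exact: lebesgue_measure_shift.
Qed.

Local Notation "\iint_ ( x , y ) F" :=
  (\int[lambda]_x \int[lambda]_y F) (at level 36, x, y at level 0, F at level 36).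

Definition rot2 (c s : R) (p : measurableTypeR R * measurableTypeR R) :
    measurableTypeR R * measurableTypeR R :=
  (c * p.1 + s * p.2, - s * p.1 + c * p.2)%R.

Lemma measurable_rot2 c s : measurable_fun setT (rot2 c s).
Proof.
apply: measurable_fun_pair => //=;
  by apply: measurable_funD => //; apply: measurable_funM.
Qed.

Lemma iint_shear2 (F : measurableTypeR R * measurableTypeR R -> \bar R) (a : R) :
  measurable_fun setT F -> (forall p, 0 <= F p) ->
  \iint_(x, y) F (x, y + a * x)%R = \iint_(x, y) F (x, y).
Proof.
move=> mF F0; apply: eq_integral => x _.
apply: (integral_lebesgue_shift (f := fun y => F (x, y))) => //.
exact: (measurableT_comp mF).
Qed.

Lemma iint_shear1 (F : measurableTypeR R * measurableTypeR R -> \bar R) (a : R) :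
  measurable_fun setT F -> (forall p, 0 <= F p) ->
  \iint_(x, y) F (x + a * y, y)%R = \iint_(x, y) F (x, y).
Proof.
move=> mF F0.
have mF' : measurable_fun setT (fun p : measurableTypeR R * measurableTypeR R =>
    F (p.1 + a * p.2, p.2)%R).
  apply: (measurableT_comp mF); apply: measurable_fun_pair => //=.
  by apply: measurable_funD => //; apply: measurable_funM.
transitivity (\int[lambda]_y \int[lambda]_x F (x + a * y, y)%R).
  by apply: (fubini_tonelli _ mF') => p; exact: F0.
transitivity (\int[lambda]_y \int[lambda]_x F (x, y)); last first.
  by apply/esym; exact: (fubini_tonelli _ mF).
apply: eq_integral => y _ /=.
apply: (integral_lebesgue_shift (f := fun x => F (x, y))) => //.
exact: (measurableT_comp mF).
Qed.

(* A rotation of angle other than pi is a product of three shears, which preserve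
   the Lebesgue measure. *)
Lemma iint_rot2 (F : measurableTypeR R * measurableTypeR R -> \bar R) (c s : R) :
  (c ^+ 2 + s ^+ 2 = 1)%R -> c != (-1)%R ->
  measurable_fun setT F -> (forall p, 0 <= F p) ->
  \iint_(x, y) F (rot2 c s (x, y)) = \iint_(x, y) F (x, y).
Proof.
(* [t] is the tangent of half the angle; the three shears have coefficients [t], [- s], [t]. *)
move=> cs1 cN1 mF F0; pose t := (s / (1 + c))%R.
have c1 : (1 + c != 0)%R by rewrite addrC -[1%R]opprK subr_eq0.
have t1c : (t * (1 + c) = s)%R by rewrite /t mulfVK.
have ts : (t * s = 1 - c)%R.
  apply: (mulfI c1); rewrite mulrA (mulrC _ t) t1c.
  have -> : (s * s = 1 - c ^+ 2)%R by rewrite -cs1; ring.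
  by ring.
pose F1 (p : measurableTypeR R * measurableTypeR R) := F (p.1 + t * p.2, p.2)%R.
pose F2 (p : measurableTypeR R * measurableTypeR R) := F1 (p.1, p.2 + (- s) * p.1)%R.
have mF1 : measurable_fun setT F1.
  apply: (measurableT_comp mF); apply: measurable_fun_pair => //=.
  by apply: measurable_funD => //; apply: measurable_funM.
have mF2 : measurable_fun setT F2.
  apply: (measurableT_comp mF1); apply: measurable_fun_pair => //=.
  by apply: measurable_funD => //; apply: measurable_funM.
transitivity (\iint_(x, y) F2 (x + t * y, y)%R); last first.
  rewrite (iint_shear1 t mF2); last by move=> p; exact: F0.
  rewrite (iint_shear2 (- s) mF1); last by move=> p; exact: F0.
  exact: iint_shear1.
apply: eq_integral => x _; apply: eq_integral => y _; rewrite /F2 /F1/= /rot2/=.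
have -> : (c = 1 - t * s)%R by rewrite ts; ring.
congr (F (_, _)); last by ring.
have -> : (s * y = (t * (1 + c)) * y)%R by rewrite t1c.
have -> : (c = 1 - t * s)%R by rewrite ts; ring.
by ring.
Qed.

End lebesgue_shift.

Section gauss_rotation.
Context (R : realType).
Local Notation lambda := (@lebesgue_measure R).
Local Notation mR := (measurableTypeR R).
Local Notation gauss := (@std_gaussian R).
Local Open Scope ereal_scope.

Lemma integral_gauss (f : mR -> \bar R) :
  measurable_fun setT f -> (forall x, 0 <= f x) ->
  \int[gauss]_x f x = \int[lambda]_x (f x * (normal_pdf 0 1 x)%:E).
Proof.
move=> mf f0; apply: (@integral_density _ mR) => //.
- exact: measurable_normal_pdf.
- by move=> x; exact: normal_pdf_ge0.
Qed.

Lemma normal_pdf_rot2 (c s x y : R) : (c ^+ 2 + s ^+ 2 = 1)%R ->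
  (normal_pdf 0 1 (rot2 c s (x, y)).1 * normal_pdf 0 1 (rot2 c s (x, y)).2 =
   normal_pdf 0 1 x * normal_pdf 0 1 y)%R.
Proof.
move=> cs1; rewrite /normal_pdf oner_eq0 /normal_fun.
rewrite mulrACA [RHS]mulrACA -!expRD; congr (_ * expR _)%R.
rewrite /rot2/= !subr0 -!mulrDl; congr (_ / _)%R.
transitivity (- ((c ^+ 2 + s ^+ 2) * (x ^+ 2 + y ^+ 2)))%R; first by ring.
by rewrite cs1 mul1r opprD.
Qed.

Lemma integral2_gauss (F : mR * mR -> \bar R) :
  measurable_fun setT F -> (forall p, 0 <= F p) ->
  \int[gauss]_x \int[gauss]_y F (x, y) =
  \int[lambda]_x \int[lambda]_y
    (F (x, y) * (normal_pdf 0 1 x * normal_pdf 0 1 y)%:E).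
Proof.
move=> mF F0; rewrite integral_gauss; last 2 first.
- exact: (measurable_fun_fubini_tonelli_F F).
- by move=> x; exact: integral_ge0.
apply: eq_integral => x _; rewrite integral_gauss//; last exact: measurableT_comp.
rewrite -ge0_integralZr//; last 3 first.
- apply: emeasurable_funM; first exact: measurableT_comp.
  by apply/measurable_EFinP; exact: measurable_normal_pdf.
- by move=> y _; rewrite mule_ge0// lee_fin normal_pdf_ge0.
- by rewrite lee_fin normal_pdf_ge0.
by apply: eq_integral => y _; rewrite EFinM -muleA (muleC (normal_pdf 0 1 x)%:E).
Qed.

Lemma gauss_rot2 (F : mR * mR -> \bar R) (c s : R) :
  (c ^+ 2 + s ^+ 2 = 1)%R -> measurable_fun setT F -> (forall p, 0 <= F p) ->
  \int[gauss]_x \int[gauss]_y F (rot2 c s (x, y)) =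
  \int[gauss]_x \int[gauss]_y F (x, y).
Proof.
(* The decomposition into shears misses the half turn, which is the square of the quarter turn
   [rot2 0 1]. *)
wlog cN1 : F c s / c != (-1)%R.
  move=> wl cs1 mF F0; have [cN1|?] := eqVneq c (-1)%R; last exact: wl.
  have s0 : s = 0%R.
    by apply/eqP; rewrite -sqrf_eq0; apply/eqP; move: cs1; rewrite cN1; lra.
  have q : (0 ^+ 2 + 1 ^+ 2 = 1 :> R)%R by rewrite expr0n expr1n add0r.
  have c0 : 0%R != (-1)%R :> R by rewrite eq_sym oppr_eq0 oner_eq0.
  have mF' := measurableT_comp mF (measurable_rot2 0%R 1%R).
  transitivity (\int[gauss]_x \int[gauss]_y F (rot2 0%R 1%R (x, y))).
    2: exact: wl.
  have E := wl (F \o rot2 0%R 1%R) 0%R 1%R c0 q mF' (fun p => F0 _).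
  apply: (eq_trans _ E).
  apply: eq_integral => x _; apply: eq_integral => y _; congr F.
  by rewrite cN1 s0 /rot2/=; congr pair; ring.
move=> cs1 mF F0; have mF' := measurableT_comp mF (measurable_rot2 c s).
pose G (p : mR * mR) := F p * (normal_pdf 0 1 p.1 * normal_pdf 0 1 p.2)%:E.
transitivity (\int[lambda]_x \int[lambda]_y G (rot2 c s (x, y))).
  apply: (eq_trans (integral2_gauss mF' (fun p => F0 _))).
  apply: eq_integral => x _; apply: eq_integral => y _.
  by rewrite /G -(normal_pdf_rot2 x y cs1).
transitivity (\int[lambda]_x \int[lambda]_y G (x, y)); last first.
  exact/esym/(integral2_gauss mF F0).
apply: iint_rot2 => //.
- apply: emeasurable_funM => //; apply/measurable_EFinP/measurable_funM.
    exact: (measurableT_comp (measurable_normal_pdf 0 1)).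
  exact: (measurableT_comp (measurable_normal_pdf 0 1)).
- by move=> p; rewrite mule_ge0// lee_fin mulr_ge0// normal_pdf_ge0.
Qed.

End gauss_rotation.

(** * Measurability of matrix operations and integration coordinate by coordinate *)

Section measurable_mx.
Context {R : realType} d (T : measurableType d).

Lemma measurable_mxentry m n (f : T -> 'M[R]_(m, n)) i j :
  measurable_fun setT f -> measurable_fun setT (fun t => f t i j).
Proof. by move=> mf; apply: (measurableT_comp (measurable_entry i j)). Qed.

Lemma measurable_mulmx m n p (f : T -> 'M[R]_(m, n)) (h : T -> 'M[R]_(n, p)) :
  measurable_fun setT f -> measurable_fun setT h ->
  measurable_fun setT (fun t => f t *m h t).
Proof.
move=> mf mh; apply: measurable_fun_mx => i k.
under eq_fun do rewrite mxE.
by apply: measurable_sum => j; apply: measurable_funM; exact: measurable_mxentry.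
Qed.

Lemma measurable_addmx m n (f h : T -> 'M[R]_(m, n)) :
  measurable_fun setT f -> measurable_fun setT h ->
  measurable_fun setT (fun t => f t + h t).
Proof.
move=> mf mh; apply: measurable_fun_mx => i k.
under eq_fun do rewrite mxE.
by apply: measurable_funD; exact: measurable_mxentry.
Qed.

Lemma measurable_oppmx m n (f : T -> 'M[R]_(m, n)) :
  measurable_fun setT f -> measurable_fun setT (fun t => - f t).
Proof.
move=> mf; apply: measurable_fun_mx => i k.
under eq_fun do rewrite mxE.
by apply: measurableT_comp => //; exact: measurable_mxentry.
Qed.

Lemma measurable_scalemx m n (c : T -> R) (f : T -> 'M[R]_(m, n)) :
  measurable_fun setT c -> measurable_fun setT f ->
  measurable_fun setT (fun t => c t *: f t).
Proof.
move=> mc mf; apply: measurable_fun_mx => i k.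
under eq_fun do rewrite mxE.
by apply: measurable_funM => //; exact: measurable_mxentry.
Qed.

Lemma measurable_trmx m n (f : T -> 'M[R]_(m, n)) :
  measurable_fun setT f -> measurable_fun setT (fun t => (f t)^T).
Proof.
move=> mf; apply: measurable_fun_mx => i k.
under eq_fun do rewrite mxE.
exact: measurable_mxentry.
Qed.

Lemma measurable_consmx n (x : T -> measurableTypeR R) (v : T -> 'cV[R]_n) :
  measurable_fun setT x -> measurable_fun setT v ->
  measurable_fun setT (fun t => cV_cons (x t, v t)).
Proof.
move=> mx mv; apply: (measurableT_comp (@measurable_cV_cons R n)).
exact: measurable_fun_pair.
Qed.

End measurable_mx.

Lemma cV_consE {R : realType} n (x : R) (v : 'cV[R]_n) :
  cV_cons (x, v) = col_mx x%:M v :> 'cV_(1 + n).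
Proof.
apply/matrixP => i j; rewrite !mxE ord1 /=; case: unliftP => [k|] ->.
  case: splitP => [[l ll] /= e|l /= [e]]; first by move: ll; rewrite -e.
  by congr (v _ 0); exact: val_inj.
by case: splitP => [l _|l //]; rewrite ord1 !mxE.
Qed.

Lemma cV_cons_surj {R : realType} n (v : 'cV[R]_n.+1) :
  v = cV_cons (v 0 0, \col_i v (lift ord0 i) 0).
Proof.
by apply/matrixP => i j; rewrite !mxE ord1 /=; case: unliftP => [k|] -> //; rewrite mxE.
Qed.

Section power_integral.
Context (R : realType).
Local Notation mR := (measurableTypeR R).
Local Open Scope ereal_scope.

Lemma integral_power_cons (nu : probability mR R) n (f : 'cV[R]_n.+1 -> \bar R) :
  measurable_fun setT f -> (forall x, 0 <= f x) ->
  \int[product_power nu n.+1]_x f x =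
  \int[nu]_x \int[product_power nu n]_v f (cV_cons (x, v)).
Proof.
move=> mf f0; rewrite /= ge0_integral_pushforward//.
have mf' := measurableT_comp mf (@measurable_cV_cons R n).
by rewrite preimage_setT (fubini_tonelli1 _ mf') // => p; exact: f0.
Qed.

Lemma iint_power_cons (nu : probability mR R) n (F : 'cV[R]_n.+1 * 'cV[R]_n.+1 -> \bar R) :
  measurable_fun setT F -> (forall p, 0 <= F p) ->
  \int[product_power nu n.+1]_x \int[product_power nu n.+1]_y F (x, y) =
  \int[nu]_x \int[nu]_y \int[product_power nu n]_v \int[product_power nu n]_w
     F (cV_cons (x, v), cV_cons (y, w)).
Proof.
move=> mF F0; rewrite integral_power_cons; last 2 first.
- exact: (measurable_fun_fubini_tonelli_F F).
- by move=> x; exact: integral_ge0.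
apply: eq_integral => x _.
transitivity (\int[product_power nu n]_v \int[nu]_y \int[product_power nu n]_w
     F (cV_cons (x, v), cV_cons (y, w))).
  apply: eq_integral => v _; rewrite (@integral_power_cons _ n)//.
  exact: (measurableT_comp mF).
rewrite (fubini_tonelli (fun p : 'cV[R]_n * mR =>
  \int[product_power nu n]_w F (cV_cons (x, p.1), cV_cons (p.2, w))))//.
- apply: (measurable_fun_fubini_tonelli_F (fun q : ('cV[R]_n * mR) * 'cV[R]_n =>
    F (cV_cons (x, q.1.1), cV_cons (q.1.2, q.2)))) => //.
  apply: (measurableT_comp mF); apply: measurable_fun_pair.
    by apply: measurable_consmx => //; apply: measurableT_comp.
  by apply: measurable_consmx => //; apply: measurableT_comp.
- by move=> p; exact: integral_ge0.
Qed.

End power_integral.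

Section gauss_pair_rotation.
Context (R : realType).
Local Notation mR := (measurableTypeR R).
Local Notation gauss := (@std_gaussian R).
Local Notation g n := (product_power gauss n).
Local Open Scope ereal_scope.

(** The rotation acts on each pair of coordinates of [x] and [y] separately, so one pair at a time
    is split off and turned by the planar invariance. *)
Lemma gauss_pair_rot n (F : 'cV[R]_n * 'cV[R]_n -> \bar R) (c s : R) :
  (c ^+ 2 + s ^+ 2 = 1)%R -> measurable_fun setT F -> (forall p, 0 <= F p) ->
  \int[g n]_x \int[g n]_y F (c *: x + s *: y, - s *: x + c *: y)%R =
  \int[g n]_x \int[g n]_y F (x, y).
Proof.
move=> cs1; elim: n F => [|n IH] F mF F0.
  apply: eq_integral => x _; apply: eq_integral => y _.
  by congr (F (_, _)); rewrite flatmx0 [RHS]flatmx0.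
pose F' (p : 'cV[R]_n.+1 * 'cV[R]_n.+1) := F (c *: p.1 + s *: p.2, - s *: p.1 + c *: p.2)%R.
have mF' : measurable_fun setT F'.
  apply: (measurableT_comp mF); apply: measurable_fun_pair;
    by apply: measurable_addmx; apply: measurable_scalemx.
pose G (p : mR * mR) := \int[g n]_v \int[g n]_w F (cV_cons (p.1, v), cV_cons (p.2, w)).
have mG : measurable_fun setT G.
  apply: (measurable_fun_fubini_tonelli_F (fun q : (mR * mR) * 'cV[R]_n =>
    \int[g n]_w F (cV_cons (q.1.1, q.2), cV_cons (q.1.2, w)))).
    apply: (measurable_fun_fubini_tonelli_F (fun q : ((mR * mR) * 'cV[R]_n) * 'cV[R]_n =>
    F (cV_cons (q.1.1.1, q.1.2), cV_cons (q.1.1.2, q.2)))) => //.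
    apply: (measurableT_comp mF); apply: measurable_fun_pair;
    by apply: measurable_consmx => //; repeat apply: measurableT_comp => //.
  by move=> p; exact: integral_ge0.
have G0 p : 0 <= G p by apply: integral_ge0 => v _; exact: integral_ge0.
transitivity (\int[gauss]_x \int[gauss]_y G (x, y)); last first.
  exact/esym/(iint_power_cons gauss mF F0).
transitivity (\int[gauss]_x \int[gauss]_y G (rot2 c s (x, y))); last first.
  exact: gauss_rot2.
apply: (eq_trans (iint_power_cons gauss mF' (fun p => F0 _))).
apply: eq_integral => x _; apply: eq_integral => y _.
pose H (p : 'cV[R]_n * 'cV[R]_n) :=
  F (cV_cons ((rot2 c s (x, y)).1, p.1), cV_cons ((rot2 c s (x, y)).2, p.2)).
have mH : measurable_fun setT H.
  by apply: (measurableT_comp mF); apply: measurable_fun_pair; exact: measurable_consmx.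
apply: (eq_trans _ (IH H mH (fun p => F0 _))).
apply: eq_integral => v _; apply: eq_integral => w _; congr (F (_, _));
  by apply/matrixP => i j; rewrite !mxE/=; case: unliftP => [k|] _ //; rewrite !mxE.
Qed.

End gauss_pair_rotation.

(** * Householder reflections, block matrices and plane rotations *)

Section euclidean_algebra.
Context {R : realType} {n : nat}.
Implicit Types (v w : 'cV[R]_n).

Lemma sum_sqr_ge0 v : 0 <= \sum_(i < n) v i 0 ^+ 2.
Proof. by apply: sumr_ge0 => i _; exact: sqr_ge0. Qed.

Lemma euclidean_norm_ge0 v : 0 <= euclidean_norm v.
Proof. exact: sqrtr_ge0. Qed.

Lemma euclidean_norm_sqr v : euclidean_norm v ^+ 2 = \sum_(i < n) v i 0 ^+ 2.
Proof. by rewrite sqr_sqrtr// sum_sqr_ge0. Qed.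

Lemma trmx_mulmx_norm v : v^T *m v = (euclidean_norm v ^+ 2)%:M.
Proof.
rewrite [LHS]mx11_scalar euclidean_norm_sqr mxE; congr _%:M.
by apply: eq_bigr => i _; rewrite mxE expr2.
Qed.

Lemma euclidean_norm_eq0 v : (euclidean_norm v == 0) = (v == 0).
Proof.
apply/eqP/eqP => [v0|->]; last first.
  by rewrite /euclidean_norm big1 ?sqrtr0// => i _; rewrite mxE expr0n.
have /eqP : \sum_(i < n) v i 0 ^+ 2 = 0 by rewrite -euclidean_norm_sqr v0 expr0n.
rewrite psumr_eq0 => [/allP v0'|i _]; last exact: sqr_ge0.
apply/matrixP => i j; rewrite ord1 mxE; apply/eqP.
by rewrite -sqrf_eq0; apply: v0'; rewrite mem_index_enum.
Qed.

(** Reflection in the hyperplane orthogonal to [w], chosen to carry [v] to a nonnegative multiple of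
    a basis vector. When [w = 0] the convention 1/0 = 0 makes it the identity, which is then the
    right answer, also for [v = 0]. *)
Definition householder (i : 'I_n) v : 'M[R]_n :=
  let w := v - euclidean_norm v *: delta_mx i 0 in
  1%:M - (2 / euclidean_norm w ^+ 2) *: (w *m w^T).

Lemma householder_tr i v : (householder i v)^T = householder i v.
Proof. by rewrite /householder linearB/= trmx1 linearZ/= trmx_mul trmxK. Qed.

Lemma householder_orth i v : householder i v *m (householder i v)^T = 1%:M.
Proof.
rewrite householder_tr /householder; set w := v - _; set a := 2 / _.
rewrite mulmxBl mul1mx mulmxBr mulmx1 -scalemxAl -scalemxAr.
rewrite -mulmxA (mulmxA w^T) trmx_mulmx_norm mul_scalar_mx -scalemxAr.
set W := w *m w^T; set N := euclidean_norm w ^+ 2.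
rewrite !scalerA -scalerBl -addrA -opprD -scalerDl.
rewrite -[RHS]subr0; congr (_ - _).
have [w0|w0] := eqVneq (euclidean_norm w) 0.
  have -> : W = 0.
    by rewrite /W; move/eqP: w0; rewrite euclidean_norm_eq0 => /eqP ->; rewrite mul0mx.
  by rewrite scaler0.
have N0 : N != 0 by rewrite /N sqrf_eq0.
by rewrite (_ : _ + _ = 0) ?scale0r// /a -/N; field.
Qed.

(** As [v] and its target have the same norm, the squared norm of [w] is twice the scalar product of
    [w] and [v]; so exactly one copy of [w] is subtracted from [v]. *)
Lemma householderE i v : householder i v *m v = euclidean_norm v *: delta_mx i 0.
Proof.
rewrite /householder; set e := delta_mx i 0; set w := v - _; set a := 2 / _.
pose r := euclidean_norm v.
rewrite mulmxBl mul1mx -scalemxAl -mulmxA.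
have eT : e^T *m v = (v i 0)%:M.
  by rewrite /e trmx_delta -rowE [LHS]mx11_scalar !mxE.
have wv : w^T *m v = (r ^+ 2 - r * v i 0)%:M.
  rewrite /w linearB/= linearZ/= mulmxBl -scalemxAl trmx_mulmx_norm eT.
  by rewrite scale_scalar_mx -raddfB.
have ww : euclidean_norm w ^+ 2 = 2 * (r ^+ 2 - r * v i 0).
  have : w^T *m w = (2 * (r ^+ 2 - r * v i 0))%:M.
    rewrite {2}/w mulmxBr wv -scalemxAr.
    have -> : w^T *m e = (v i 0 - r)%:M.
      rewrite /w linearB/= linearZ/= mulmxBl -scalemxAl.
      have -> : e^T *m e = 1%:M by rewrite /e trmx_delta mul_delta_mx [LHS]mx11_scalar mxE !eqxx.
      have -> : v^T *m e = (v i 0)%:M by rewrite -[LHS]trmxK trmx_mul trmxK eT tr_scalar_mx.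
      by rewrite scale_scalar_mx mulr1 -raddfB.
    by rewrite scale_scalar_mx -raddfB/=; congr _%:M; rewrite -/r; ring.
  rewrite trmx_mulmx_norm => /matrixP/(_ 0 0); rewrite !mxE eqxx !mulr1n; exact.
rewrite wv mul_mx_scalar scalerA.
have [w0|w0] := eqVneq (euclidean_norm w) 0.
  move/eqP: (w0); rewrite euclidean_norm_eq0 => /eqP w0'.
  by rewrite w0' scaler0 subr0; apply/eqP; rewrite -subr_eq0 -/w w0'.
have -> : a * (r ^+ 2 - r * v i 0) = 1.
  rewrite /a ww; apply: (@mulfI _ 2); rewrite ?pnatr_eq0//.
  have N0 : 2 * (r ^+ 2 - r * v i 0) != 0 by rewrite -ww sqrf_eq0.
  by rewrite mulr1 mulrCA -[RHS]mulr1 mulrAC -mulrA divff.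
by rewrite scale1r /w opprB addrC subrK.
Qed.

End euclidean_algebra.

Section orthogonal_blocks.
Context {R : realType} {n : nat}.

Lemma orth_tr k (A : 'M[R]_k) : A *m A^T = 1%:M -> A^T *m A^T^T = 1%:M.
Proof. by move=> h; rewrite trmxK; exact: mulmx1C. Qed.

Lemma orth_mul k (A B : 'M[R]_k) :
  A *m A^T = 1%:M -> B *m B^T = 1%:M -> (A *m B) *m (A *m B)^T = 1%:M.
Proof. by move=> hA hB; rewrite trmx_mul mulmxA -(mulmxA A) hB mulmx1. Qed.

Definition diag1 (A : 'M[R]_n) : 'M[R]_n.+1 := block_mx (1%:M : 'M[R]_1) 0 0 A.

Lemma diag1_cons A x v : diag1 A *m cV_cons (x, v) = cV_cons (x, A *m v).
Proof.
by rewrite !cV_consE /diag1 (mul_block_col (1%:M : 'M[R]_1)) !mul0mx mul1mx addr0 add0r.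
Qed.

Lemma diag1_tr A : (diag1 A)^T = diag1 A^T.
Proof. by rewrite /diag1 (tr_block_mx (1%:M : 'M[R]_1)) !trmx0 trmx1. Qed.

Lemma diag1_mul A B : diag1 A *m diag1 B = diag1 (A *m B).
Proof.
by rewrite /diag1 (@mulmx_block _ 1 n 1 n 1 n) !mul0mx !mulmx0 mul1mx !addr0 add0r.
Qed.

Lemma diag1_1 : diag1 1%:M = 1%:M.
Proof. by rewrite /diag1 -scalar_mx_block. Qed.

Lemma diag1_inj : injective diag1.
Proof. by move=> A B /(@eq_block_mx _ 1 n 1 n) []. Qed.

Lemma diag1_orth A : A *m A^T = 1%:M -> diag1 A *m (diag1 A)^T = 1%:M.
Proof. by move=> h; rewrite diag1_tr diag1_mul h diag1_1. Qed.

(** The transpose is the inverse, so it fixes the first basis vector too: the first row is trivial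
    as well as the first column. *)
Lemma orth_fix_diag1 (C : 'M[R]_n.+1) : C *m C^T = 1%:M ->
  C *m delta_mx 0 0 = delta_mx 0 0 :> 'cV[R]_n.+1 ->
  exists2 A : 'M[R]_n, A *m A^T = 1%:M & C = diag1 A.
Proof.
move=> hC Ce.
have CTe : C^T *m delta_mx 0 0 = delta_mx 0 0 :> 'cV[R]_n.+1.
  by rewrite -[in LHS]Ce mulmxA (mulmx1C hC) mul1mx.
have l0 : lshift n (0 : 'I_1) = 0 :> 'I_(1 + n) by exact: val_inj.
have e : C = diag1 (drsubmx (C : 'M[R]_(1 + n))).
  apply: (eq_trans (esym (@submxK _ 1 n 1 n C))); rewrite /diag1.
  congr block_mx.
  - apply/matrixP => i j; rewrite !ord1 !mxE l0 eqxx.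
    by move/matrixP/(_ 0 0): Ce; rewrite -colE !mxE eqxx.
  - apply/matrixP => i j; rewrite !ord1 !mxE l0.
    by move/matrixP/(_ (rshift 1 j) 0): CTe; rewrite -colE !mxE.
  - apply/matrixP => i j; rewrite !ord1 !mxE l0.
    by move/matrixP/(_ (rshift 1 i) 0): Ce; rewrite -colE !mxE.
exists (drsubmx (C : 'M[R]_(1 + n))) => //.
by apply: diag1_inj; rewrite -diag1_mul -diag1_tr -e hC diag1_1.
Qed.

End orthogonal_blocks.

Definition givens {R : realType} n (c s : R) : 'M[R]_n.+2 :=
  block_mx (c%:M : 'M[R]_1) (row_mx (s%:M : 'M[R]_1) 0 : 'M[R]_(1, 1 + n))
    (col_mx ((- s)%:M : 'M[R]_1) 0) (block_mx (c%:M : 'M[R]_1) 0 0 1%:M).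

Lemma givens_cons {R : realType} n (c s x y : R) (w : 'cV[R]_n) :
  givens n c s *m cV_cons (x, cV_cons (y, w)) =
  cV_cons (c * x + s * y, cV_cons (- s * x + c * y, w)).
Proof.
rewrite !cV_consE /givens (mul_block_col (c%:M : 'M[R]_1)).
rewrite (@mul_row_col _ 1 1 n 1) (@mul_col_mx _ 1 n 1 1) (@mul_block_col _ 1 n 1 n 1).
rewrite !mul0mx mul1mx !addr0 add0r.
rewrite -!scalar_mxM. by rewrite (@add_col_mx _ 1 n 1) add0r -!raddfD.
Qed.

Lemma givens_tr {R : realType} n (c s : R) : (givens n c s)^T = givens n c (- s).
Proof.
rewrite /givens (@tr_block_mx _ 1 n.+1 1 n.+1) tr_scalar_mx opprK.
rewrite (@tr_row_mx _ 1 1 n) (@tr_col_mx _ 1 n 1) (@tr_block_mx _ 1 n 1 n).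
by rewrite !tr_scalar_mx !trmx0.
Qed.

Lemma givens_orth {R : realType} n (c s : R) : c ^+ 2 + s ^+ 2 = 1 ->
  givens n c s *m (givens n c s)^T = 1%:M.
Proof.
move=> cs1; rewrite givens_tr.
have fixed (v : 'cV[R]_n.+2) : givens n c s *m givens n c (- s) *m v = v.
  rewrite -mulmxA (cV_cons_surj v); set w := \col_i _; rewrite (cV_cons_surj w).
  rewrite !givens_cons; congr (cV_cons (_, cV_cons (_, _))).
    by rewrite -[RHS]mul1r -cs1; ring.
  by rewrite -[RHS]mul1r -cs1; ring.
apply/matrixP => i j; move/matrixP/(_ i 0): (fixed (delta_mx j 0)).
by rewrite -colE !mxE andbT.
Qed.

(** * Invariance of the Gaussian measure under orthogonal matrices *)

Section gauss_orthogonal.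
Context (R : realType).
Local Notation mR := (measurableTypeR R).
Local Notation gauss := (@std_gaussian R).
Local Notation g n := (product_power gauss n).
Local Open Scope ereal_scope.

Definition gauss_preserving n (A : 'M[R]_n) := forall f : 'cV[R]_n -> \bar R,
  measurable_fun setT f -> (forall x, 0 <= f x) ->
  \int[g n]_x f (A *m x) = \int[g n]_x f x.

Lemma measurable_mulmxl n (A : 'M[R]_n) :
  measurable_fun setT (fun x : 'cV[R]_n => A *m x).
Proof. by apply: measurable_mulmx. Qed.

Lemma gauss_preservingM n (A B : 'M[R]_n) :
  gauss_preserving A -> gauss_preserving B -> gauss_preserving (A *m B).
Proof.
move=> hA hB f mf f0; rewrite -(hA f mf f0).
rewrite -(hB (fun x => f (A *m x)))//.
  by apply: eq_integral => x _; rewrite mulmxA.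
exact: (measurableT_comp mf (measurable_mulmxl A)).
Qed.

Lemma gauss_preserving_diag1 n (A : 'M[R]_n) :
  gauss_preserving A -> gauss_preserving (diag1 A).
Proof.
move=> hA f mf f0; rewrite (integral_power_cons gauss mf f0).
have mf' := measurableT_comp mf (measurable_mulmxl (diag1 A)).
apply: (eq_trans (integral_power_cons gauss mf' (fun p => f0 _))).
apply: eq_integral => x _; rewrite -(hA (fun v => f (cV_cons (x, v))))//.
  by apply: eq_integral => v _; rewrite /= diag1_cons.
by apply: (measurableT_comp mf); exact: measurable_consmx.
Qed.

Lemma gauss_preserving_givens n (c s : R) :
  (c ^+ 2 + s ^+ 2 = 1)%R -> gauss_preserving (givens n c s).
Proof.
move=> cs1 f mf f0.
pose G (p : mR * mR) := \int[g n]_w f (cV_cons (p.1, cV_cons (p.2, w))).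
have mG : measurable_fun setT G.
  apply: (measurable_fun_fubini_tonelli_F (fun q : (mR * mR) * 'cV[R]_n =>
    f (cV_cons (q.1.1, cV_cons (q.1.2, q.2))))) => //.
  apply: (measurableT_comp mf); apply: measurable_consmx.
    by repeat apply: measurableT_comp => //.
  by apply: measurable_consmx => //; repeat apply: measurableT_comp => //.
have G0 p : 0 <= G p by exact: integral_ge0.
have expand (h : 'cV[R]_n.+2 -> \bar R) : measurable_fun setT h -> (forall x, 0 <= h x) ->
    \int[g n.+2]_x h x = \int[gauss]_x \int[gauss]_y \int[g n]_w
    h (cV_cons (x, cV_cons (y, w))).
  move=> mh h0; rewrite (integral_power_cons gauss mh h0).
  apply: eq_integral => x _.
  have mh' : measurable_fun setT (fun v : 'cV[R]_n.+1 => h (cV_cons (x, v))).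
    by apply: (measurableT_comp mh); exact: measurable_consmx.
  exact: (integral_power_cons gauss mh' (fun p => h0 _)).
transitivity (\int[gauss]_x \int[gauss]_y G (x, y)); last first.
  exact/esym/(expand f).
transitivity (\int[gauss]_x \int[gauss]_y G (rot2 c s (x, y))); last first.
  exact: gauss_rot2.
have mf' := measurableT_comp mf (measurable_mulmxl (givens n c s)).
apply: (eq_trans (expand _ mf' (fun p => f0 _))).
apply: eq_integral => x _; apply: eq_integral => y _.
by apply: eq_integral => w _; rewrite /= givens_cons.
Qed.

(** A half turn of the plane, seen on functions of the first coordinate alone, is the reflection of
    the line. *)
Lemma gauss_opp (f : mR -> \bar R) : measurable_fun setT f -> (forall x, 0 <= f x) ->
  \int[gauss]_x f (- x)%R = \int[gauss]_x f x.
Proof.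
move=> mf f0.
have cst_int (k : \bar R) : \int[gauss]_y (fun=> k) y = k.
  rewrite integral_cst// -[RHS]mule1; congr (_ * _); exact: (probability_setT gauss).
have N1 : ((-1) ^+ 2 + 0 ^+ 2 = 1 :> R)%R by rewrite sqrrN expr1n expr0n addr0.
have mF : measurable_fun setT (fun p : mR * mR => f p.1) by exact: (measurableT_comp mf).
have E := gauss_rot2 N1 mF (fun p => f0 _).
transitivity (\int[gauss]_x \int[gauss]_y f (rot2 (-1)%R 0%R (x, y)).1).
  apply: eq_integral => x _; rewrite -[LHS]cst_int.
  by apply: eq_integral => y _; rewrite /rot2/= mul0r addr0 mulN1r.
by apply: (eq_trans E); apply: eq_integral => x _; exact: (cst_int (f x)).
Qed.

Local Close Scope ereal_scope.

(* A Householder reflection of the last coordinates followed by a rotation of the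
   first two makes the first column of [A] the first basis vector. *)
Lemma gauss_orth n (A : 'M[R]_n) : A *m A^T = 1%:M -> gauss_preserving A.
Proof.
elim: n A => [|[_|n IH]] A hA.
- by move=> f mf f0; apply: eq_integral => x _; congr f; rewrite flatmx0 [RHS]flatmx0.
(* Dimension one has no plane to rotate in and is treated apart: the matrix is 1 or -1. *)
- have A1 : (A 0 0) ^+ 2 == 1%R.
    move/matrixP/(_ 0 0): hA; rewrite !mxE eqxx big_ord_recl big_ord0 addr0.
    by rewrite mxE => e; rewrite expr2; apply/eqP; exact: e.
  move=> f mf f0; rewrite (integral_power_cons gauss mf f0).
  have mf' := measurableT_comp mf (measurable_mulmxl A).
  apply: (eq_trans (integral_power_cons gauss mf' (fun p => f0 _))).
  pose h (x : mR) := (\int[g 0]_v f (cV_cons (x, v)))%E.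
  have mh : measurable_fun setT h.
    apply: (measurable_fun_fubini_tonelli_F (fun q : mR * 'cV[R]_0 => f (cV_cons q))) => //.
    exact: (measurableT_comp mf (@measurable_cV_cons R 0)).
  have h0 x : (0 <= h x)%E by exact: integral_ge0.
  transitivity (\int[gauss]_x h (A ord0 ord0 * x)%R)%E.
    apply: eq_integral => x _; apply: eq_integral => v _; congr f.
    apply/matrixP => i j; rewrite !ord1 !mxE unlift_none big_ord_recl big_ord0 addr0.
    by rewrite mxE unlift_none.
  move: A1; rewrite sqrf_eq1 => /orP[] /eqP ->.
    by under eq_integral do rewrite mul1r.
  under eq_integral do rewrite mulN1r.
  exact: gauss_opp.
- pose a := A 0 0; pose u := dlsubmx (A : 'M[R]_(1 + n.+1)).
  pose s := euclidean_norm u.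
  have Ae : A *m delta_mx 0 0 = cV_cons (a, u) :> 'cV[R]_n.+2.
    rewrite -colE cV_consE; apply/matrixP => i j; rewrite ord1 !mxE.
    case: splitP => k ik; rewrite !mxE ?ord1.
      by congr (A _ _); apply: val_inj; rewrite /= ik ord1.
    by congr (A _ _); apply: val_inj; rewrite /= ?ik.
  have as1 : (a ^+ 2 + s ^+ 2 = 1)%R.
    have : (cV_cons (a, u))^T *m cV_cons (a, u) = (1%:M : 'M[R]_1).
      rewrite -Ae trmx_mul mulmxA -(mulmxA _ A^T) (mulmx1C hA) mulmx1.
      by rewrite trmx_delta mul_delta_mx [LHS]mx11_scalar mxE !eqxx.
    rewrite cV_consE (tr_col_mx (a%:M : 'M[R]_1)) (mul_row_col ((a%:M : 'M[R]_1)^T)).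
    rewrite tr_scalar_mx -scalar_mxM trmx_mulmx_norm -raddfD => /matrixP/(_ 0 0).
    by rewrite !mxE eqxx !mulr1n expr2.
  pose H := householder 0 u.
  have hH : H *m H^T = 1%:M := householder_orth 0 u.
  have Ge : givens n a s *m (diag1 H *m A) *m delta_mx 0 0 = delta_mx 0 0 :> 'cV[R]_n.+2.
    rewrite -!mulmxA Ae diag1_cons householderE -/s.
    have -> : s *: (delta_mx 0 0 : 'cV[R]_n.+1) = cV_cons (s, 0%R).
      apply/matrixP => i j; rewrite ord1 !mxE; case: unliftP => [k|] ->.
        by rewrite mxE/= mulr0.
      by rewrite eqxx mulr1.
    rewrite givens_cons -!expr2 as1 mulNr (mulrC s) addNr.
    apply/matrixP => i j; rewrite ord1 !mxE; case: unliftP => [k|] -> //.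
    rewrite mxE; case: unliftP => [l|] _ //; by rewrite mxE.
  have gorth := givens_orth n as1.
  have [C hC eC] := orth_fix_diag1 (orth_mul gorth (orth_mul (diag1_orth hH) hA)) Ge.
  (* Solve for [A]: the blocks [H^T] and [C] have one dimension less, so the induction hypothesis
     applies to them, and the middle factor is a plane rotation. *)
  have -> : A = diag1 H^T *m (givens n a s)^T *m diag1 C.
    rewrite -eC !mulmxA -(mulmxA _ _ (givens n a s)) (mulmx1C gorth) mulmx1.
    by rewrite diag1_mul (mulmx1C hH) diag1_1 mul1mx.
  apply: gauss_preservingM; last by apply: gauss_preserving_diag1; exact: IH.
  apply: gauss_preservingM.
    by apply: gauss_preserving_diag1; apply: IH; exact: orth_tr.
  by rewrite givens_tr; apply: gauss_preserving_givens; rewrite sqrrN.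
Qed.

End gauss_orthogonal.

(** * Small-set estimate for one fixed noise *)

Section lebesgue_scale.
Context (R : realType).
Local Notation mR := (measurableTypeR R).
Local Notation lambda := (@lebesgue_measure R).
Local Open Scope ereal_scope.

Lemma lebesgue_measure_scale (s : R) (A : set mR) : (0 < s)%R -> measurable A ->
  s%:E * lambda [set x | A (s * x)%R] = lambda A.
Proof.
move=> s0 mA.
have ms : measurable_fun setT (fun x : mR => s * x : mR)%R by exact: measurable_funM.
pose f : {mfun _ >-> _} := HB.pack (fun x : mR => s * x : mR)%R
  (isMeasurableFun.Build _ _ _ _ _ ms).
apply/esym; apply: (@lebesgue_measure_unique _
  (mscale (NngNum (ltW s0)) (pushforward lambda f))) => //= _ [[u v]] _ <-.
rewrite /mscale/= /pushforward/= lebesgue_measure_itv/=.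
have -> : f @^-1` `]u, v] = [set` `](u / s)%R, (v / s)%R]] :> set R.
  by apply/seteqP; split => x /=; rewrite !in_itv/= ltr_pdivrMr// ler_pdivlMr// mulrC.
rewrite lebesgue_measure_itv/= !lte_fin ltr_pM2r ?invr_gt0//; case: ifP => _; last by rewrite mule0.
by rewrite -!EFinB -EFinM; congr EFin; field; rewrite gt_eqF.
Qed.

Lemma integral_lebesgue_scale (f : mR -> \bar R) (s : R) : (0 < s)%R ->
  measurable_fun setT f -> (forall x, 0 <= f x) ->
  \int[lambda]_x f x = s%:E * \int[lambda]_x f (s * x)%R.
Proof.
move=> s0 mf f0.
have ms : measurable_fun setT (fun x : mR => s * x : mR)%R by exact: measurable_funM.
pose g : {mfun _ >-> _} := HB.pack (fun x : mR => s * x : mR)%R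
  (isMeasurableFun.Build _ _ _ _ _ ms).
rewrite -(ge0_integral_pushforward ms lambda measurableT mf)//.
rewrite -/(pushforward lambda g) -(ge0_integral_mscale _ _ (NngNum (ltW s0)))//.
apply: eq_measure_integral => A mA _; apply/esym.
exact: lebesgue_measure_scale.
Qed.

Lemma integral_lebesgue_affine (f : mR -> \bar R) (s a : R) : (0 < s)%R ->
  measurable_fun setT f -> (forall x, 0 <= f x) ->
  \int[lambda]_x f x = s%:E * \int[lambda]_x f (a + s * x)%R.
Proof.
move=> s0 mf f0.
have ma : measurable_fun setT (fun x : mR => f (x + a)%R).
  by apply: (measurableT_comp mf); exact: measurable_funD.
rewrite -(integral_lebesgue_shift a mf f0).
rewrite (integral_lebesgue_scale s0 ma)//.
by congr (_ * _); apply: eq_integral => x _; rewrite addrC.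
Qed.

End lebesgue_scale.

(** * Expectations with real values *)

Section expectation.
Context d (T : measurableType d) (R : realType) (P : probability T R).
Implicit Types (f g : T -> R) (r s : R).

(** Bundling integrability with a finite value keeps linear arithmetic on expectations in [R], away
    from undefined sums of infinities. *)
Definition has_mean f r :=
  P.-integrable setT (EFin \o f) /\ (\int[P]_x (f x)%:E = r%:E)%E.

Lemma has_mean_cst r : has_mean (fun=> r) r.
Proof.
split; first exact: finite_measure_integrable_cst.
rewrite integral_cst// -[RHS]mule1; congr (_ * _)%E; exact: probability_setT.
Qed.

Lemma has_meanD f g r s : has_mean f r -> has_mean g s ->
  has_mean (fun x => f x + g x) (r + s).
Proof.
move=> [fi fr] [gi gs]; split; first exact: (integrableD measurableT fi gi).
by rewrite EFinD -fr -gs -integralD.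
Qed.

Lemma has_meanZ k f r : has_mean f r -> has_mean (fun x => k * f x) (k * r).
Proof.
move=> [fi fr]; split; first exact: (integrableZl measurableT k fi).
by rewrite EFinM -fr -integralZl.
Qed.

Lemma has_meanB f g r s : has_mean f r -> has_mean g s ->
  has_mean (fun x => f x - g x) (r - s).
Proof.
move=> hf hg; have := has_meanD hf (has_meanZ (-1) hg).
rewrite mulN1r; congr has_mean; apply/funext => x; by rewrite mulN1r.
Qed.

Lemma has_mean_le f g r s : has_mean f r -> has_mean g s ->
  (forall x, f x <= g x) -> r <= s.
Proof.
move=> [fi fr] [gi gs] fg; rewrite -lee_fin -fr -gs.
by apply: le_integral => // x _; rewrite /= lee_fin.
Qed.

Lemma has_mean_ge0 f r : measurable_fun setT f -> (forall x, 0 <= f x) ->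
  (\int[P]_x (f x)%:E = r%:E)%E -> has_mean f r.
Proof.
move=> mf f0 fr; split=> //; apply/integrableP; split; first exact/measurable_EFinP.
by under eq_integral do rewrite /= ger0_norm//; rewrite fr ltry.
Qed.

Lemma has_mean_bounded f M : measurable_fun setT f -> (forall x, 0 <= f x <= M) ->
  exists r, has_mean f r.
Proof.
move=> mf fM; have f0 x : 0 <= f x by have /andP[] := fM x.
exists (fine (\int[P]_x (f x)%:E)%E); apply: has_mean_ge0 => //.
rewrite fineK// ge0_fin_numE; last by apply: integral_ge0 => x _; rewrite lee_fin.
apply: (@le_lt_trans _ _ (\int[P]_x (cst M x)%:E)%E); last first.
  by have [_ ->] := has_mean_cst M; rewrite ltry.
by apply: le_lower_integral => x; rewrite lee_fin//; have /andP[] := fM x.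
Qed.

(** The mean of [(f - k g)^2] is nonnegative for every [k]; the best choice is [k = H / G]. *)
Lemma has_mean_CauchySchwarz f g F G H : has_mean (fun x => f x ^+ 2) F ->
  has_mean (fun x => g x ^+ 2) G -> has_mean (fun x => f x * g x) H ->
  H ^+ 2 <= F * G.
Proof.
move=> hF hG hH.
have key k : k * H *+ 2 <= F + k ^+ 2 * G.
  have := has_mean_le (has_meanZ (k *+ 2) hH) (has_meanD hF (has_meanZ (k ^+ 2) hG)).
  rewrite mulrnAl; apply=> x; rewrite -subr_ge0.
  rewrite (_ : _ - _ = (f x - k * g x) ^+ 2) ?sqr_ge0//; ring.
have G0 : 0 <= G by apply: (has_mean_le (has_mean_cst 0) hG) => x; exact: sqr_ge0.
have [G1|G1] := eqVneq G 0.
  rewrite G1 mulr0; have [->|H0] := eqVneq H 0; first by rewrite expr0n.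
  (* With [G = 0] the bound reads [2 k H <= F] for all [k], which this [k] refutes unless
     [H = 0]. *)
  have := key ((F + 1) / H); have -> : (F + 1) / H * H = F + 1 by rewrite divfK.
  by have := key 0; rewrite G1; lra.
have Gp : 0 < G by rewrite lt_def G1.
have := key (H / G).
have -> : H / G * H *+ 2 = H ^+ 2 / G *+ 2 by congr (_ *+ 2); ring.
have -> : (H / G) ^+ 2 * G = H ^+ 2 / G by field; rewrite gt_eqF.
by rewrite mulr2n lerD2r ler_pdivrMr.
Qed.

End expectation.

(** * The Mehler kernel of correlation 1/4 *)

Section hypercontractive_line.
Context (R : realType).
Local Notation mR := (measurableTypeR R).
Local Notation lambda := (@lebesgue_measure R).
Local Notation gauss := (@std_gaussian R).
Implicit Types (x y : R) (g : mR -> R).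

Lemma normal_peakE (s : R) : 0 < s -> normal_peak s = normal_peak 1 / s.
Proof.
move=> s0; rewrite /normal_peak expr1n mul1r -mulrnAr sqrtrM ?sqr_ge0//.
by rewrite sqrtr_sqr gtr0_norm// invfM mulrC.
Qed.

Lemma normal_pdf_expE (m s x : R) : 0 < s ->
  normal_pdf m s x = normal_peak 1 / s * expR (- (x - m) ^+ 2 / (s ^+ 2 *+ 2)).
Proof. by move=> s0; rewrite normal_pdfE ?gt_eqF// /normal_fun normal_peakE. Qed.

Lemma normal_pdf01E x : normal_pdf 0 1 x = normal_peak 1 * expR (- (x ^+ 2 / 2)).
Proof. by rewrite normal_pdf_expE ?ltr01// divr1 subr0 expr1n mulNr. Qed.

Lemma normal_pdf_gt0 x : 0 < normal_pdf 0 1 x :> R.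
Proof. by rewrite normal_pdf01E mulr_gt0 ?expR_gt0// normal_peak_gt0 ?oner_neq0. Qed.

Lemma measurable_sqr : measurable_fun setT (fun x : mR => x ^+ 2 : R).
Proof. exact: measurable_funX. Qed.

(** Tilting the standard density by [exp (b x^2)] gives [s] times the centred normal density of
    deviation [s], which has total mass one. *)
Lemma has_mean_expR_sqr (b s : R) : 0 < s -> s ^+ 2 * (1 - b *+ 2) = 1 ->
  has_mean gauss (fun x => expR (b * x ^+ 2)) s.
Proof.
move=> s0 sb; have mf : measurable_fun setT (fun x : mR => expR (b * x ^+ 2)).
  by apply: measurableT_comp => //; apply: measurable_funM => //; exact: measurable_sqr.
apply: has_mean_ge0 => //.
rewrite integral_gauss; last 2 first.
- exact/measurable_EFinP.
- by move=> x; rewrite lee_fin expR_ge0.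
transitivity (\int[lambda]_x (s%:E * (normal_pdf 0 s x)%:E))%E.
  apply: eq_integral => x _; rewrite -!EFinM; congr EFin.
  rewrite normal_pdf01E normal_pdf_expE// mulrCA -expRD [RHS]mulrA.
  have -> : s * (normal_peak 1 / s) = normal_peak 1 by rewrite mulrC divfK// gt_eqF.
  congr (_ * expR _); rewrite subr0.
  have s2 : s ^+ 2 != 0 by rewrite sqrf_eq0 gt_eqF.
  have -> : b = (1 - (s ^+ 2)^-1) / 2.
    have e : 1 - b *+ 2 = (s ^+ 2)^-1 by apply: (mulfI s2); rewrite sb divff.
    by rewrite -e; field.
  by field; rewrite gt_eqF.
rewrite integralZl//; last exact: integrable_normal_pdf.
by rewrite integral_normal_pdf mule1.
Qed.

(* All constants below belong to the noise of correlation [1/4]. *)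
Definition rho0 : R := 1 / 4.
Definition sigma0 : R := Num.sqrt 15 / 4.

Lemma sigma0_gt0 : 0 < sigma0.
Proof. by rewrite divr_gt0// sqrtr_gt0. Qed.

Lemma sigma0_sqr : sigma0 ^+ 2 = 15 / 16.
Proof. by rewrite expr_div_n sqr_sqrtr//; field. Qed.

Lemma rho0_sigma0 : rho0 ^+ 2 + sigma0 ^+ 2 = 1.
Proof. by rewrite sigma0_sqr /rho0; field. Qed.

(** Density, relative to the Gaussian measure itself, of the law of [rho0 * x + sigma0 * Y] for a
    standard Gaussian [Y]. *)
Definition mehler x y : R := normal_pdf (rho0 * x) sigma0 y / normal_pdf 0 1 y.

Lemma mehler_ge0 x y : 0 <= mehler x y.
Proof. by rewrite divr_ge0 ?normal_pdf_ge0. Qed.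

Lemma measurable_mehler x : measurable_fun setT (mehler x : mR -> R).
Proof.
apply: measurable_funM; first exact: measurable_normal_pdf.
apply: (measurable_comp (F := ~` [set 0 : R])).
- exact: measurableC.
- by move=> _ [y _ <-] /= y0; move: (normal_pdf_gt0 y); rewrite y0 ltxx.
- apply: open_continuous_measurable_fun; first by rewrite openC; exact: closed_eq.
  by move=> y /set_mem /= y0; apply: inv_continuous; exact/eqP.
- exact: measurable_normal_pdf.
Qed.

Lemma integral_mehler g x : measurable_fun setT g -> (forall y, 0 <= g y) ->
  (\int[gauss]_y (g (rho0 * x + sigma0 * y))%:E =
   \int[gauss]_y (mehler x y * g y)%:E)%E.
Proof.
move=> mg g0; rewrite integral_gauss; last 2 first.
- apply/measurable_EFinP; apply: (measurableT_comp mg).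
  by apply: measurable_funD => //; exact: measurable_funM.
- by move=> y; rewrite lee_fin.
rewrite integral_gauss; last 2 first.
- by apply/measurable_EFinP; apply: measurable_funM => //; exact: measurable_mehler.
- by move=> y; rewrite lee_fin mulr_ge0// mehler_ge0.
pose h (y : mR) := (normal_pdf (rho0 * x) sigma0 y * g y)%:E.
transitivity (\int[lambda]_y h y)%E; last first.
  apply: eq_integral => y _; rewrite /h -EFinM /mehler; congr EFin.
  by field; rewrite gt_eqF// normal_pdf_gt0.
have mh : measurable_fun setT h.
  apply/measurable_EFinP; apply: (@measurable_funM _ mR) => //.
  exact: measurable_normal_pdf.
have h0 y : (0 <= h y)%E by rewrite lee_fin mulr_ge0// normal_pdf_ge0.
rewrite (integral_lebesgue_affine (rho0 * x) sigma0_gt0 mh h0) /h.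
rewrite -ge0_integralZl//; last 3 first.
- apply/measurable_EFinP; apply: measurable_funM.
    apply: (measurableT_comp (measurable_normal_pdf _ _)).
    by apply: measurable_funD => //; exact: measurable_funM.
  apply: (measurableT_comp mg).
  by apply: measurable_funD => //; exact: measurable_funM.
- by move=> y _; rewrite lee_fin mulr_ge0// normal_pdf_ge0.
- by rewrite lee_fin ltW// sigma0_gt0.
apply: eq_integral => y _; rewrite -!EFinM; congr EFin.
have s0 := sigma0_gt0.
rewrite normal_pdf01E normal_pdf_expE// [RHS]mulrA mulrC; congr (_ * _).
rewrite mulrA; congr (_ * expR _); first by rewrite mulrC divfK// gt_eqF.
by field; rewrite gt_eqF.
Qed.

(** This is [(1 - rho0^4)^(-1/2)], that is 16 / sqrt 255. *)
Definition mehlerK : R := 16 / 15 * Num.sqrt (15 / 17).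

(** Completing the square: the squared kernel times the Gaussian density is a multiple of the normal
    density of mean [2 rho0 x / (1 + rho0^2) = 8 x / 17] and variance
    [(1 - rho0^2) / (1 + rho0^2) = 15 / 17]. The exponent 1/17 is [rho0^2 / (1 + rho0^2)]. *)
Lemma has_mean_mehler_sqr x :
  has_mean gauss (fun y => mehler x y ^+ 2) (mehlerK * expR (17^-1 * x ^+ 2)).
Proof.
have mm : measurable_fun setT (fun y : mR => mehler x y ^+ 2).
  by apply: measurable_funX; exact: measurable_mehler.
apply: has_mean_ge0 => //; first by move=> y; exact: sqr_ge0.
rewrite integral_gauss; last 2 first.
- exact/measurable_EFinP.
- by move=> y; rewrite lee_fin sqr_ge0.
pose t : R := Num.sqrt (15 / 17).
have t0 : 0 < t by rewrite sqrtr_gt0 divr_gt0.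
have t2 : t ^+ 2 = 15 / 17 by rewrite sqr_sqrtr// divr_ge0.
have K2 : mehlerK = t / sigma0 ^+ 2 by rewrite sigma0_sqr /mehlerK -/t; field.
transitivity (\int[lambda]_y ((mehlerK * expR (17^-1 * x ^+ 2))%:E *
    (normal_pdf (8 / 17 * x) t y)%:E))%E; last first.
  rewrite integralZl//; last exact: integrable_normal_pdf.
  by rewrite integral_normal_pdf mule1.
apply: eq_integral => y _; rewrite -!EFinM; congr EFin.
have s0 := sigma0_gt0; have p0 := normal_pdf_gt0 y.
transitivity (normal_pdf (rho0 * x) sigma0 y ^+ 2 / normal_pdf 0 1 y).
  by rewrite /mehler; field; rewrite gt_eqF.
have p1 : normal_pdf 0 1 y != 0 by rewrite gt_eqF.
apply: (mulIf p1); rewrite divfK// normal_pdf01E !normal_pdf_expE// exprMn K2.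
set p := normal_peak 1.
transitivity ((p / sigma0) ^+ 2 *
  (expR (17^-1 * x ^+ 2) * expR (- (y - 8 / 17 * x) ^+ 2 / (t ^+ 2 *+ 2)) *
   expR (- (y ^+ 2 / 2)))); last first.
  by field; rewrite !gt_eqF.
congr (_ * _); rewrite -expRM_natl -!expRD; congr expR.
by rewrite t2 sigma0_sqr /rho0; field.
Qed.

End hypercontractive_line.

(** * The two-function inequality in dimension one *)

Section two_function_line.
Context (R : realType).
Local Notation mR := (measurableTypeR R).
Local Notation gauss := (@std_gaussian R).
Local Notation rho0 := (@rho0 R).
Local Notation sigma0 := (@sigma0 R).
Implicit Types (x y : R).

(** The Ornstein-Uhlenbeck operator of correlation [rho0], with real values. *)
Definition noise_avg (g : mR -> R) (x : mR) : R :=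
  fine (\int[gauss]_y (g (rho0 * x + sigma0 * y))%:E)%E.

Section fixed_function.
Variable g : mR -> R.
Hypothesis mg : measurable_fun setT g.
Hypothesis g01 : forall x, 0 <= g x <= 1.

Let g0 x : 0 <= g x. Proof. by have /andP[] := g01 x. Qed.

Let mg_affine x : measurable_fun setT (fun y : mR => g (rho0 * x + sigma0 * y)).
Proof. by apply: (measurableT_comp mg); apply: measurable_funD => //; exact: measurable_funM. Qed.

Lemma has_mean_noise_avg x :
  has_mean gauss (fun y => g (rho0 * x + sigma0 * y)) (noise_avg g x).
Proof.
have [r hr] := has_mean_bounded gauss (mg_affine x) (fun y => g01 _).
by have [_ e] := hr; rewrite /noise_avg e.
Qed.

Lemma noise_avgE x :
  (\int[gauss]_y (g (rho0 * x + sigma0 * y))%:E = (noise_avg g x)%:E)%E.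
Proof. by have [] := has_mean_noise_avg x. Qed.

Lemma has_mean_mehler x : has_mean gauss (fun y => mehler x y * g y) (noise_avg g x).
Proof.
apply: has_mean_ge0.
- by apply: measurable_funM => //; exact: measurable_mehler.
- by move=> y; rewrite mulr_ge0// mehler_ge0.
- by rewrite -integral_mehler// noise_avgE.
Qed.

Lemma noise_avg_bounds x : 0 <= noise_avg g x <= 1.
Proof.
have h := has_mean_noise_avg x; apply/andP; split.
  exact: (has_mean_le (has_mean_cst gauss 0) h).
by apply: (has_mean_le h (has_mean_cst gauss 1)) => y; have /andP[] := g01 (rho0 * x + sigma0 * y).
Qed.

Lemma measurable_noise_avg : measurable_fun setT (noise_avg g).
Proof.
apply: measurableT_comp => //.
apply: (measurable_fun_fubini_tonelli_F
  (fun p : mR * mR => (g (rho0 * p.1 + sigma0 * p.2))%:E)).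
  apply/measurable_EFinP; apply: (measurableT_comp mg).
  by apply: measurable_funD; apply: measurable_funM.
by move=> p; rewrite lee_fin.
Qed.

Variables (a W : R).
Hypothesis ha : has_mean gauss g a.
Hypothesis hW : has_mean gauss (fun x => g x ^+ 2) W.

Lemma has_mean_noise_avg_mean : has_mean gauss (noise_avg g) a.
Proof.
apply: has_mean_ge0; first exact: measurable_noise_avg.
  by move=> x; have /andP[] := noise_avg_bounds x.
pose F (p : mR * mR) := (g p.1)%:E.
have mF : measurable_fun setT F by apply/measurable_EFinP; exact: (measurableT_comp mg).
transitivity (\int[gauss]_x \int[gauss]_y F (rot2 rho0 sigma0 (x, y)))%E.
  by apply: eq_integral => x _; rewrite -noise_avgE.
rewrite (gauss_rot2 (rho0_sigma0 R) mF); last by move=> p; rewrite lee_fin.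
have [_ <-] := ha; apply: eq_integral => x _.
by have [_] := has_mean_cst gauss (g x).
Qed.

Let b2_ge0 : 0 <= W - a ^+ 2.
Proof.
have h := has_mean_CauchySchwarz (f := g) (g := fun=> 1) (F := W) (G := 1 ^+ 2) hW
  (has_mean_cst gauss _).
have ha1 : has_mean gauss (fun x => g x * 1) a.
  by rewrite (_ : (fun _ => _) = g)//; apply/funext => x; rewrite mulr1.
by have := h a ha1; rewrite expr1n mulr1 subr_ge0.
Qed.

(** The kernel has mean one in [y], so the deviation is the mean of [(mehler x - 1) (g - a)].
    Cauchy-Schwarz separates the variance of the kernel from that of [g]. *)
Lemma noise_avg_deviation x : (noise_avg g x - a) ^+ 2 <=
  (mehlerK R * expR (17^-1 * x ^+ 2) - 1) * (W - a ^+ 2).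
Proof.
have h1 : has_mean gauss (mehler x) 1.
  apply: has_mean_ge0; first exact: measurable_mehler.
    exact: mehler_ge0.
  have := @integral_mehler _ (cst 1) x (measurable_cst _) (fun=> ler01).
  have [_ ->] := has_mean_cst gauss 1; move=> ->.
  by apply: eq_integral => y _; rewrite mulr1.
apply: (has_mean_CauchySchwarz (P := gauss)
  (f := fun y => mehler x y - 1) (g := fun y => g y - a)).
- have := has_meanD (has_meanB (has_mean_mehler_sqr x) (has_meanZ 2 h1)) (has_mean_cst gauss 1).
  rewrite (_ : _ - _ + _ = mehlerK R * expR (17^-1 * x ^+ 2) - 1); last by ring.
  by congr has_mean; apply/funext => y; ring.
- have := has_meanD (has_meanB hW (has_meanZ (2 * a) ha)) (has_mean_cst gauss (a ^+ 2)).
  rewrite (_ : _ - _ + _ = W - a ^+ 2); last by ring.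
  by congr has_mean; apply/funext => y; ring.
- have := has_meanD (has_meanB (has_meanB (has_mean_mehler x) (has_meanZ a h1)) ha)
    (has_mean_cst gauss a).
  rewrite (_ : _ - _ - _ + _ = noise_avg g x - a); last by ring.
  by congr has_mean; apply/funext => y; ring.
Qed.

(* Expanding [(a + u) ^ 4] with [u = noise_avg g - a] of mean zero and
   [4 a u ^ 3 <= 2 a ^ 2 u ^ 2 + 2 u ^ 4], the fourth moment is at most
   [(a ^ 2 + b ^ 2) ^ 2], where [b ^ 2] is the variance of [g]. *)
Lemma noise_avg_fourth U : has_mean gauss (fun x => noise_avg g x ^+ 4) U -> U <= W ^+ 2.
Proof.
move=> hU; set b2 := W - a ^+ 2.
pose e (k : R) x := expR (k * x ^+ 2).
(* [s1] and [s2] are the Gaussian means of [exp (x^2 / 17)] and of its square; they give the first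
   two moments of the factor in [noise_avg_deviation]. *)
have [s1 s10 s12] : exists2 s : R, 0 < s & s ^+ 2 * (1 - 17^-1 *+ 2) = 1.
  exists (Num.sqrt (17 / 15)); first by rewrite sqrtr_gt0 divr_gt0.
  by rewrite sqr_sqrtr ?divr_ge0//; field.
have [s2 s20 s22] : exists2 s : R, 0 < s & s ^+ 2 * (1 - (2 / 17) *+ 2) = 1.
  exists (Num.sqrt (17 / 13)); first by rewrite sqrtr_gt0 divr_gt0.
  by rewrite sqr_sqrtr ?divr_ge0//; field.
have h1 := has_mean_expR_sqr s10 s12.
have h2 := has_mean_expR_sqr s20 s22.
pose K := mehlerK R.
have K0 : 0 <= K by rewrite /K /mehlerK mulr_ge0// ?divr_ge0// sqrtr_ge0.
have K2 : K ^+ 2 = 256 / 255.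
  by rewrite /K /mehlerK exprMn sqr_sqrtr ?divr_ge0//; field.
have Ks1 : K * s1 = 16 / 15.
  have s1E : s1 ^+ 2 = 17 / 15 by move: s12; lra.
  have /eqP : (K * s1) ^+ 2 = (16 / 15) ^+ 2 by rewrite exprMn K2 s1E; field.
  by rewrite eqrXn2 ?divr_ge0 ?mulr_ge0// ?ltW// => /eqP.
have s2le : s2 <= 115 / 100.
  rewrite -(@ler_pXn2r _ 2)// ?nnegrE ?divr_ge0 ?ltW//.
  have : s2 ^+ 2 = 17 / 13 by move: s22; lra.
  by move=> ->; lra.
have hk : has_mean gauss (fun x => K * e 17^-1 x - 1) (16 / 15 - 1).
  rewrite -Ks1; exact: (has_meanB (has_meanZ K h1) (has_mean_cst gauss 1)).
have hk2 : has_mean gauss (fun x => (K * e 17^-1 x - 1) ^+ 2)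
    (K ^+ 2 * s2 - 2 * (16 / 15) + 1).
  have := has_meanD (has_meanB (has_meanZ (K ^+ 2) h2)
    (has_meanZ 2 (has_meanZ K h1))) (has_mean_cst gauss 1).
  rewrite Ks1; congr has_mean; apply/funext => x.
  have -> : expR (2 / 17 * x ^+ 2) = e 17^-1 x ^+ 2.
    by rewrite /e -expRM_natl; congr expR; field.
  by rewrite /e; ring.
have := has_mean_le hU (has_meanD (has_meanD (has_mean_cst gauss (a ^+ 4))
  (has_meanZ (4 * a ^+ 3) (has_meanB has_mean_noise_avg_mean (has_mean_cst gauss a))))
  (has_meanD (has_meanZ (8 * a ^+ 2 * b2) hk) (has_meanZ (3 * b2 ^+ 2) hk2))).
have b20 := b2_ge0; rewrite -/b2 in b20.
have pt x : noise_avg g x ^+ 4 <= a ^+ 4 + 4 * a ^+ 3 * (noise_avg g x - a) +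
  (8 * a ^+ 2 * b2 * (K * e 17^-1 x - 1) + 3 * b2 ^+ 2 * (K * e 17^-1 x - 1) ^+ 2).
  set u := noise_avg g x - a.
  have -> : noise_avg g x = a + u by rewrite /u; ring.
  have du := noise_avg_deviation x; rewrite -/u -/K -/(e 17^-1 x) -/b2 in du.
  have u4 : u ^+ 4 <= (K * e 17^-1 x - 1) ^+ 2 * b2 ^+ 2.
    by rewrite -exprMn (exprM u 2 2) lerXn2r ?nnegrE ?sqr_ge0// (le_trans (sqr_ge0 _) du).
  have a2u : a ^+ 2 * u ^+ 2 <= a ^+ 2 * ((K * e 17^-1 x - 1) * b2).
    by rewrite ler_wpM2l ?sqr_ge0.
  have : 0 <= (a * u - u ^+ 2) ^+ 2 by exact: sqr_ge0.
  have -> : (a + u) ^+ 4 = a ^+ 4 + 4 * a ^+ 3 * u + 6 * (a ^+ 2 * u ^+ 2) +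
    4 * (a * u * u ^+ 2) + u ^+ 4 by ring.
  have -> : (a * u - u ^+ 2) ^+ 2 = a ^+ 2 * u ^+ 2 - 2 * (a * u * u ^+ 2) + u ^+ 4 by ring.
  lra.
move=> /(_ pt) le_U; apply: (le_trans le_U).
have -> : W = a ^+ 2 + b2 by rewrite /b2; ring.
(* The integrated bound has coefficient 8/15 on [a^2 b2], where 2 is allowed, and three times this
   number on [b2^2], where 1 is allowed. *)
have k2le : K ^+ 2 * s2 - 2 * (16 / 15) + 1 <= 1 / 3 by rewrite K2; lra.
have : 3 * b2 ^+ 2 * (K ^+ 2 * s2 - 2 * (16 / 15) + 1) <= 3 * b2 ^+ 2 * (1 / 3).
  by rewrite ler_wpM2l// mulr_ge0// sqr_ge0.
have : 0 <= a ^+ 2 * b2 by rewrite mulr_ge0// sqr_ge0.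
have -> : (a ^+ 2 + b2) ^+ 2 = a ^+ 4 + 2 * (a ^+ 2 * b2) + b2 ^+ 2 by ring.
lra.
Qed.

End fixed_function.

Lemma young34 (s t : R) : 0 <= s -> 0 <= t -> 4 * (s ^+ 3 * t) <= 3 * s ^+ 4 + t ^+ 4.
Proof.
move=> s0 t0; rewrite -subr_ge0.
have -> : 3 * s ^+ 4 + t ^+ 4 - 4 * (s ^+ 3 * t) =
  (s - t) ^+ 2 * (3 * s ^+ 2 + 2 * (s * t) + t ^+ 2) by ring.
by rewrite mulr_ge0 ?sqr_ge0// !addr_ge0// ?mulr_ge0// ?sqr_ge0.
Qed.

(** Young's inequality at every scale gives Hoelder's: [k = w / s] balances the two terms. If [s] or
    [w] vanishes, a suitable [k] rules out [p > 0]. *)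
Lemma young34_optimize (p s w : R) : 0 <= p -> 0 <= s -> 0 <= w ->
  (forall k, 0 < k -> 4 * k ^+ 3 * p <= 3 * k ^+ 4 * s ^+ 4 + w ^+ 4) ->
  p <= s ^+ 3 * w.
Proof.
move=> p0 s0 w0 h.
have [s1|s1] := eqVneq s 0.
  rewrite s1 expr0n mul0r; rewrite leNgt; apply/negP => z0.
  have k0 : 0 < 1 + w ^+ 4 / p by rewrite ltr_wpDr// divr_ge0 ?exprn_ge0// ltW.
  have := h _ k0; rewrite s1 expr0n mulr0 add0r; apply/negP; rewrite -ltNge.
  set k := 1 + _ in k0 *.
  have k1 : 1 <= k by rewrite lerDl divr_ge0 ?exprn_ge0// ltW.
  have kz : w ^+ 4 < k * p by rewrite mulrDl mul1r divfK ?gt_eqF// ltrDr.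
  have : k * p <= k ^+ 3 * p by apply: ler_wpM2r => //; rewrite ler_eXnr.
  have : 0 <= k ^+ 3 * p by rewrite mulr_ge0// exprn_ge0// ltW.
  lra.
have [w1|w1] := eqVneq w 0.
  rewrite w1 mulr0; rewrite leNgt; apply/negP => p1.
  pose k := p / s ^+ 4.
  have s4 : 0 < s ^+ 4 by rewrite exprn_gt0// lt_def s1.
  have k0 : 0 < k by rewrite divr_gt0.
  have := h _ k0; rewrite w1 expr0n/= addr0.
  have -> : 3 * k ^+ 4 * s ^+ 4 = 3 * (k ^+ 3 * p).
    by rewrite /k; field.
  have : 0 < k ^+ 3 * p by rewrite mulr_gt0// exprn_gt0.
  lra.
have sp : 0 < s by rewrite lt_def s1.
have wp : 0 < w by rewrite lt_def w1.
have := h (w / s) (divr_gt0 wp sp).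
have -> : 3 * (w / s) ^+ 4 * s ^+ 4 + w ^+ 4 = 4 * (w / s) ^+ 3 * (s ^+ 3 * w).
  by field.
by rewrite ler_pM2l// mulr_gt0// exprn_gt0// divr_gt0.
Qed.

(** Hoelder with exponents 4/3 and 4, then the fourth-moment bound on [noise_avg g]. Giving the
    norms as [s] and [w] avoids roots of integrals. The cube of [f] is there for tensorization,
    where [f] is the fourth root of a slice measure. *)
Lemma two_function_line (f g : mR -> R) (s w : R) :
  measurable_fun setT f -> measurable_fun setT g ->
  (forall x, 0 <= f x <= 1) -> (forall x, 0 <= g x <= 1) ->
  0 <= s -> 0 <= w ->
  has_mean gauss (fun x => f x ^+ 4) (s ^+ 4) ->
  has_mean gauss (fun x => g x ^+ 2) (w ^+ 2) ->
  (\int[gauss]_x \int[gauss]_y (f x ^+ 3 * g (rho0 * x + sigma0 * y))%:E <=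
   (s ^+ 3 * w)%:E)%E.
Proof.
move=> mf mg f01 g01 s0 w0 hf hg.
have [a ha] := has_mean_bounded gauss mg g01.
have mT := measurable_noise_avg mg g01.
have T01 := noise_avg_bounds mg g01.
have [U hU] : exists U, has_mean gauss (fun x => noise_avg g x ^+ 4) U.
  apply: (@has_mean_bounded _ _ _ gauss _ 1); first exact: measurable_funX.
  by move=> x; have /andP[h1 h2] := T01 x; rewrite exprn_ge0// exprn_ile1.
have UW := noise_avg_fourth mg g01 ha hg hU.
have [p hp] : exists p, has_mean gauss (fun x => f x ^+ 3 * noise_avg g x) p.
  apply: (@has_mean_bounded _ _ _ gauss _ 1).
    by apply: measurable_funM => //; exact: measurable_funX.
  move=> x; have /andP[h1 h2] := T01 x; have /andP[h3 h4] := f01 x.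
  by rewrite mulr_ge0 ?exprn_ge0// mulr_ile1// ?exprn_ge0// exprn_ile1.
have -> : (\int[gauss]_x \int[gauss]_y (f x ^+ 3 * g (rho0 * x + sigma0 * y))%:E = p%:E)%E.
  have [_ <-] := hp; apply: eq_integral => x _.
  by have [_ ->] := has_meanZ (f x ^+ 3) (has_mean_noise_avg mg g01 x).
rewrite lee_fin; apply: young34_optimize => //.
  apply: (has_mean_le (has_mean_cst gauss 0) hp) => x.
  have /andP[h1 h2] := T01 x; have /andP[h3 h4] := f01 x.
  by rewrite mulr_ge0 ?exprn_ge0.
move=> k k0.
have le1 := has_mean_le (has_meanZ (4 * k ^+ 3) hp) (has_meanD (has_meanZ (3 * k ^+ 4) hf) hU).
rewrite -exprM in UW.
have pt x : 4 * k ^+ 3 * (f x ^+ 3 * noise_avg g x) <=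
    3 * k ^+ 4 * f x ^+ 4 + noise_avg g x ^+ 4.
  have /andP[h1 h2] := T01 x; have /andP[h3 h4] := f01 x.
  have := young34 (mulr_ge0 (ltW k0) h3) h1.
  by rewrite !exprMn !mulrA.
by apply: (le_trans (le1 pt)); rewrite lerD2l.
Qed.

End two_function_line.

Lemma integral_indicT d (T : measurableType d) (R : realType)
    (mu : {measure set T -> \bar R}) (A : set T) : measurable A ->
  (\int[mu]_x (\1_A x)%:E = mu A)%E.
Proof. by move=> mA; rewrite integral_indic// setIT. Qed.

(** * Tensorization of the two-function inequality *)

Section small_set.
Context (R : realType).
Local Notation mR := (measurableTypeR R).
Local Notation gauss := (@std_gaussian R).
Local Notation g n := (product_power gauss n).

Definition corr n (c s : R) (A B : set 'cV[R]_n) : \bar R :=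
  (\int[g n]_x \int[g n]_y (\1_A x * \1_B (c *: x + s *: y))%:E)%E.

Definition slice n (A : set 'cV[R]_n.+1) (x : mR) : set 'cV[R]_n :=
  [set v | A (cV_cons (x, v))].

Lemma measurable_slice n (A : set 'cV[R]_n.+1) x : measurable A -> measurable (slice A x).
Proof.
move=> mA; have : measurable_fun setT (fun v : 'cV[R]_n => cV_cons (x, v)).
  exact: measurable_consmx.
by move=> /(_ measurableT _ mA); rewrite setTI.
Qed.

Lemma measurable_fun_slice n (A : set 'cV[R]_n.+1) : measurable A ->
  measurable_fun setT (fun x => g n (slice A x)).
Proof.
move=> mA.
rewrite (_ : (fun _ => _) = (fun x => \int[g n]_v (\1_A (cV_cons (x, v)))%:E)%E); last first.
  by apply/funext => x; rewrite -(integral_indicT _ (measurable_slice x mA)).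
apply: (measurable_fun_fubini_tonelli_F (fun p : mR * 'cV[R]_n => (\1_A (cV_cons p))%:E)).
  apply/measurable_EFinP.
  exact: (measurableT_comp (measurable_indic mA) (@measurable_cV_cons R n)).
by move=> p; rewrite lee_fin.
Qed.

Lemma power_cons_measure n (A : set 'cV[R]_n.+1) : measurable A ->
  g n.+1 A = (\int[gauss]_x g n (slice A x))%E.
Proof.
move=> mA; rewrite -(integral_indicT _ mA).
rewrite (integral_power_cons gauss (f := fun x => (\1_A x)%:E)); last 2 first.
- by apply/measurable_EFinP; exact: measurable_indic.
- by move=> x; rewrite lee_fin.
by apply: eq_integral => x _; rewrite -(integral_indicT _ (measurable_slice x mA)).
Qed.

Lemma fine_powerK n (A : set 'cV[R]_n) : measurable A -> (fine (g n A))%:E = g n A.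
Proof. by move=> mA; rewrite fineK// fin_num_measure. Qed.

Lemma fine_power_bounds n (A : set 'cV[R]_n) : measurable A -> 0 <= fine (g n A) <= 1.
Proof.
by move=> mA; rewrite -2!lee_fin fine_powerK// measure_ge0 probability_le1.
Qed.

Definition root4 (x : R) := Num.sqrt (Num.sqrt x).

Lemma root4_ge0 x : 0 <= root4 x. Proof. exact: sqrtr_ge0. Qed.

Lemma root4K x : 0 <= x -> root4 x ^+ 4 = x.
Proof. by move=> x0; rewrite /root4 (exprM _ 2 2) !sqr_sqrtr// sqrtr_ge0. Qed.

Lemma measurable_sqrtr : measurable_fun setT (fun x : mR => Num.sqrt x : R).
Proof. by apply: continuous_measurable_fun; exact: sqrt_continuous. Qed.

Lemma sqrtr_bounds (x : R) : 0 <= x <= 1 -> 0 <= Num.sqrt x <= 1.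
Proof. by move=> /andP[x0 x1]; rewrite sqrtr_ge0 -[leRHS]sqrtr1 ler_wsqrtr. Qed.

(* Slicing along the first coordinate turns the inductive hypothesis into the
   two-function inequality on the line. *)
Lemma small_set n (A B : set 'cV[R]_n) : measurable A -> measurable B ->
  (corr (rho0 R) (sigma0 R) A B <=
   (root4 (fine (g n A)) ^+ 3 * Num.sqrt (fine (g n B)))%:E)%E.
Proof.
elim: n A B => [|n IH] A B mA mB.
  have gE (D : set 'cV[R]_0) : fine (g 0 D) = \1_D 0.
    by have -> : g 0 D = (\1_D 0)%:E by rewrite indicE; exact: diracE.
  rewrite !gE /corr (_ : (\int[g 0]_x _)%E = (\1_A 0 * \1_B 0)%:E); last first.
    have [_ <-] := has_mean_cst (g 0) (\1_A 0 * \1_B 0).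
    apply: eq_integral => x _.
    have [_ <-] := has_mean_cst (g 0) (\1_A 0 * \1_B 0).
    by apply: eq_integral => y _; rewrite (flatmx0 x) flatmx0.
  rewrite lee_fin !indicE /root4.
  case: (0 \in A); case: (0 \in B);
    rewrite ?mulr1n ?mulr0n ?mulr0 ?mul0r ?sqrtr1 ?sqrtr0 ?expr1n ?mulr1 ?mulr0 //.
(* [F^4] and [G^2] are the slice measures, whose means are the measures of [A] and [B]: these are
   the norms asked for by [two_function_line]. *)
pose F x := root4 (fine (g n (slice A x))).
pose G x := Num.sqrt (fine (g n (slice B x))).
have mslice (D : set 'cV[R]_n.+1) : measurable D ->
    measurable_fun setT (fun x => fine (g n (slice D x)) : R).
  by move=> mD; apply: measurableT_comp => //; exact: measurable_fun_slice.
have mean_slice (D : set 'cV[R]_n.+1) : measurable D ->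
    has_mean gauss (fun x => fine (g n (slice D x))) (fine (g n.+1 D)).
  move=> mD; apply: has_mean_ge0; first exact: mslice.
    by move=> x; have /andP[] := fine_power_bounds (measurable_slice x mD).
  rewrite fine_powerK// power_cons_measure//; apply: eq_integral => x _.
  by rewrite fine_powerK//; exact: measurable_slice.
have mF : measurable_fun setT F.
  by apply: (measurableT_comp measurable_sqrtr);
    apply: (measurableT_comp measurable_sqrtr); exact: mslice.
have mG : measurable_fun setT G by apply: (measurableT_comp measurable_sqrtr); exact: mslice.
have F01 x : 0 <= F x <= 1.
  by do 2 apply: sqrtr_bounds; apply: fine_power_bounds; exact: measurable_slice.
have G01 x : 0 <= G x <= 1.
  by apply: sqrtr_bounds; apply: fine_power_bounds; exact: measurable_slice.
apply: le_trans (@two_function_line _ F G (root4 (fine (g n.+1 A)))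
  (Num.sqrt (fine (g n.+1 B))) mF mG F01 G01 (root4_ge0 _) (sqrtr_ge0 _) _ _); last 2 first.
- rewrite root4K; last by have /andP[] := fine_power_bounds mA.
  rewrite (_ : (fun x => _) = (fun x => fine (g n (slice A x)))); first exact: mean_slice.
  apply/funext => x; rewrite root4K//.
  by have /andP[] := fine_power_bounds (measurable_slice x mA).
- rewrite sqr_sqrtr; last by have /andP[] := fine_power_bounds mB.
  rewrite (_ : (fun x => _) = (fun x => fine (g n (slice B x)))); first exact: mean_slice.
  apply/funext => x; rewrite sqr_sqrtr//.
  by have /andP[] := fine_power_bounds (measurable_slice x mB).
pose H (p : 'cV[R]_n.+1 * 'cV[R]_n.+1) : \bar R :=
  (\1_A p.1 * \1_B (rho0 R *: p.1 + sigma0 R *: p.2))%:E.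
have mH : measurable_fun setT H.
  apply/measurable_EFinP; apply: measurable_funM.
    exact: (measurableT_comp (measurable_indic mA)).
  apply: (measurableT_comp (measurable_indic mB)).
  by apply: measurable_addmx; apply: measurable_scalemx.
have H0 p : (0 <= H p)%E by rewrite lee_fin mulr_ge0.
rewrite /corr (iint_power_cons gauss mH H0).
apply: le_lower_integral => x.
  by apply: integral_ge0 => y _; apply: integral_ge0 => v _; exact: integral_ge0.
apply: le_lower_integral => y.
  by apply: integral_ge0 => v _; exact: integral_ge0.
apply: le_trans (IH _ _ (measurable_slice x mA)
  (measurable_slice (rho0 R * x + sigma0 R * y) mB)).
rewrite /corr le_eqVlt; apply/orP; left; apply/eqP.
apply: eq_integral => v _; apply: eq_integral => w _.
rewrite /H/=.
have -> : rho0 R *: cV_cons (x, v) + sigma0 R *: cV_cons (y, w) =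
    cV_cons (rho0 R * x + sigma0 R * y, rho0 R *: v + sigma0 R *: w).
  by apply/matrixP => i j; rewrite !mxE/=; case: unliftP => [k|] _ //; rewrite !mxE.
by [].
Qed.

End small_set.

(** * Noise at small angles *)

Section correlation_doubling.
Context (R : realType) (n : nat).
Local Notation gauss := (@std_gaussian R).
Local Notation g n := (product_power gauss n).
Variable A : set 'cV[R]_n.
Hypothesis mA : measurable A.

Let mind d (T : measurableType d) (f : T -> 'cV[R]_n) : measurable_fun setT f ->
  measurable_fun setT (fun t => \1_A (f t) : R).
Proof. by move=> mf; exact: (measurableT_comp (measurable_indic mA) mf). Qed.

Let ind01 (x : 'cV[R]_n) : 0 <= (\1_A x : R) <= 1.
Proof. by rewrite indicE; case: (x \in A); rewrite ?ler01 ?lexx. Qed.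

Let ind0 (x : 'cV[R]_n) : 0 <= (\1_A x : R).
Proof. by have /andP[] := ind01 x. Qed.

Let mlin d (T : measurableType d) (a b : R) (f h : T -> 'cV[R]_n) :
  measurable_fun setT f -> measurable_fun setT h ->
  measurable_fun setT (fun t => a *: f t + b *: h t).
Proof. by move=> mf mh; apply: measurable_addmx; apply: measurable_scalemx. Qed.

Lemma fine_corr c s : (fine (corr c s A A))%:E = corr c s A A.
Proof.
rewrite fineK// ge0_fin_numE; last first.
  by apply: integral_ge0 => x _; apply: integral_ge0 => y _; rewrite lee_fin mulr_ge0.
apply: (@le_lt_trans _ _ 1%E); last exact: ltry.
have [_ <-] := has_mean_cst (g n) 1; apply: le_lower_integral => x.
  by apply: integral_ge0 => y _; rewrite lee_fin mulr_ge0.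
have [_ <-] := has_mean_cst (g n) 1; apply: le_lower_integral => y.
  by rewrite lee_fin mulr_ge0.
have /andP[a0 a1] := ind01 x; have /andP[b0 b1] := ind01 (c *: x + s *: y).
by rewrite lee_fin mulr_ile1.
Qed.

Definition corr_avg (c s : R) (x : 'cV[R]_n) : R :=
  fine (\int[g n]_y (\1_A (c *: x + s *: y))%:E)%E.

Lemma has_mean_corr_avg c s x :
  has_mean (g n) (fun y => \1_A (c *: x + s *: y)) (corr_avg c s x).
Proof.
have [r hr] := has_mean_bounded (g n)
  (mind (mlin c s (measurable_cst x) (@measurable_id _ _ _))) (fun=> ind01 _).
by have [_ e] := hr; rewrite /corr_avg e.
Qed.

Lemma measurable_corr_avg c s : measurable_fun setT (corr_avg c s).
Proof.
apply: measurableT_comp => //.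
apply: (measurable_fun_fubini_tonelli_F
  (fun p : 'cV[R]_n * 'cV[R]_n => (\1_A (c *: p.1 + s *: p.2))%:E)).
  by apply/measurable_EFinP; apply: mind; exact: mlin.
by move=> p; rewrite lee_fin.
Qed.

Lemma corr_avg_ge0 c s x : 0 <= corr_avg c s x.
Proof. exact: (has_mean_le (has_mean_cst _ 0) (has_mean_corr_avg c s x)). Qed.

Lemma has_mean_ind : has_mean (g n) (fun x => \1_A x) (fine (g n A)).
Proof.
apply: has_mean_ge0 => //; first exact: measurable_indic.
by rewrite fine_powerK// -(integral_indicT _ mA).
Qed.

Lemma has_mean_corr c s :
  has_mean (g n) (fun x => \1_A x * corr_avg c s x) (fine (corr c s A A)).
Proof.
apply: has_mean_ge0.
- apply: measurable_funM; first exact: measurable_indic.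
  exact: measurable_corr_avg.
- by move=> x; rewrite mulr_ge0// corr_avg_ge0.
rewrite fine_corr; apply: eq_integral => x _.
by have [_ <-] := has_meanZ (\1_A x) (has_mean_corr_avg c s x).
Qed.

(* The noise operator of correlation [c] is self-adjoint and its square is the
   one of correlation [c ^ 2]. *)
Lemma corr_sqr (c s s' : R) : c ^+ 2 + s ^+ 2 = 1 -> c ^+ 4 + s' ^+ 2 = 1 -> 0 < s' ->
  fine (corr c s A A) ^+ 2 <= fine (g n A) * fine (corr (c ^+ 2) s' A A).
Proof.
move=> cs1 cs2 s'0.
pose T := corr_avg c s; have hT := has_mean_corr_avg c s; have mT := measurable_corr_avg c s.
apply: (has_mean_CauchySchwarz (P := g n) (f := \1_A) (g := T)).
- rewrite (_ : (fun _ => _) = \1_A); first exact: has_mean_ind.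
  by apply/funext => x; rewrite indicE; case: (x \in A); rewrite ?expr1n ?expr0n.
- apply: has_mean_ge0; first exact: measurable_funX.
    by move=> x; exact: sqr_ge0.
  rewrite fine_corr.
  (* The square of the average is written with two independent noises [y] and [z] attached to the
     same [x]. *)
  pose F3 (q : ('cV[R]_n * 'cV[R]_n) * 'cV[R]_n) : \bar R :=
    (\1_A (c *: q.1.1 + s *: q.2) * \1_A (c *: q.1.1 + s *: q.1.2))%:E.
  have mF3 : measurable_fun setT F3.
    apply/measurable_EFinP; apply: measurable_funM; apply: mind; apply: mlin => //;
      by apply: measurableT_comp.
  transitivity (\int[g n]_x \int[g n]_z \int[g n]_y F3 ((x, z), y))%E.
    apply: eq_integral => x _; rewrite expr2.
    have [_ <-] := has_meanZ (T x) (hT x); apply: eq_integral => z _.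
    rewrite mulrC; have [_ <-] := has_meanZ (\1_A (c *: x + s *: z)) (hT x).
    by apply: eq_integral => y _; rewrite /F3/= mulrC.
  transitivity (\int[g n]_z \int[g n]_x \int[g n]_y F3 ((x, z), y))%E.
    apply: (fubini_tonelli (fun p => \int[g n]_y F3 (p, y))%E).
      by apply: (measurable_fun_fubini_tonelli_F F3) => // q; rewrite lee_fin mulr_ge0.
    by move=> p; apply: integral_ge0 => y _; rewrite lee_fin mulr_ge0.
  (* For fixed [z], rotate [(x, y)] so that the first noisy point becomes the new [x]; the second
     one then has correlation [c^2] with it. *)
  pose F4 (q : ('cV[R]_n * 'cV[R]_n) * 'cV[R]_n) : \bar R :=
    (\1_A q.1.1 * \1_A (c ^+ 2 *: q.1.1 + (s *: q.1.2 + (- (c * s)) *: q.2)))%:E.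
  have mF4 : measurable_fun setT F4.
    apply/measurable_EFinP; apply: measurable_funM; apply: mind.
      by apply: measurableT_comp.
    apply: measurable_addmx; last by apply: mlin => //; apply: measurableT_comp.
    by apply: measurable_scalemx => //; apply: measurableT_comp.
  have F40 q : (0 <= F4 q)%E by rewrite lee_fin mulr_ge0.
  transitivity (\int[g n]_z \int[g n]_x \int[g n]_y F4 ((x, z), y))%E.
    apply: eq_integral => z _.
    have mF4z : measurable_fun setT (fun p : 'cV[R]_n * 'cV[R]_n => F4 ((p.1, z), p.2)).
      apply: (measurableT_comp mF4); apply: measurable_fun_pair => //.
      exact: measurable_fun_pair.
    apply: (eq_trans _ (gauss_pair_rot cs1 mF4z (fun p => F40 _))).
    apply: eq_integral => x _; apply: eq_integral => y _.
    rewrite /F3 /F4/=; congr (_ * \1_A _)%:E.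
    apply/matrixP => i j; rewrite !mxE.
    transitivity ((c * (c ^+ 2 + s ^+ 2)) * x i j + s * z i j); last by ring.
    by rewrite cs1 mulr1.
  transitivity (\int[g n]_x \int[g n]_z \int[g n]_y F4 ((x, z), y))%E.
    apply/esym; apply: (fubini_tonelli (fun p => \int[g n]_y F4 (p, y))%E).
      exact: (measurable_fun_fubini_tonelli_F F4).
    by move=> p; exact: integral_ge0.
  apply: eq_integral => x _.
  (* The remaining noise [s z - c s y] has variance [s^2 (1 + c^2) = 1 - c^4 = s'^2]: a rotation of
     [(z, y)] makes it [s'] times one Gaussian vector, and the other is integrated out. *)
  pose F5 (p : 'cV[R]_n * 'cV[R]_n) : \bar R :=
    (\1_A x * \1_A (c ^+ 2 *: x + s' *: p.1))%:E.
  have mF5 : measurable_fun setT F5.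
    apply/measurable_EFinP; apply: measurable_funM => //; apply: mind.
    by apply: mlin.
  have CS1 : (s / s') ^+ 2 + (- (c * s) / s') ^+ 2 = 1.
    have -> : (s / s') ^+ 2 + (- (c * s) / s') ^+ 2 = (1 - c ^+ 2) * (1 + c ^+ 2) / s' ^+ 2.
      have -> : 1 - c ^+ 2 = s ^+ 2 by rewrite -cs1; ring.
      by field; rewrite gt_eqF.
    have -> : (1 - c ^+ 2) * (1 + c ^+ 2) = s' ^+ 2.
      have -> : s' ^+ 2 = 1 - c ^+ 4 by rewrite -cs2; ring.
      by ring.
    by rewrite divff// sqrf_eq0 gt_eqF.
  have F50 p : (0 <= F5 p)%E by rewrite lee_fin mulr_ge0.
  transitivity (\int[g n]_z \int[g n]_y F5 (z, y))%E.
    apply: (eq_trans _ (gauss_pair_rot CS1 mF5 F50)).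
    apply: eq_integral => z _; apply: eq_integral => y _.
    rewrite /F4 /F5/=; congr (_ * \1_A _)%:E.
    rewrite scalerDr !scalerA; congr (_ + (_ *: _ + _ *: _)); field; by rewrite gt_eqF.
  apply: eq_integral => z _; rewrite /F5/=.
  by have [_ ->] := has_mean_cst (g n) (\1_A x * \1_A (c ^+ 2 *: x + s' *: z)).
- exact: has_mean_corr.
Qed.

Definition noise (c s : R) : \bar R :=
  (\int[g n]_x \int[g n]_y `|\1_A x - \1_A (c *: x + s *: y)|%:E)%E.

Lemma measurable_noise (c s : R) : measurable_fun setT
  (fun p : 'cV[R]_n * 'cV[R]_n => `|\1_A p.1 - \1_A (c *: p.1 + s *: p.2)|%:E : \bar R).
Proof.
apply/measurable_EFinP; apply: measurableT_comp => //; apply: measurable_funB.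
  exact: mind.
by apply: mind; exact: mlin.
Qed.

Lemma has_mean_corr_avg_mean c s : c ^+ 2 + s ^+ 2 = 1 ->
  has_mean (g n) (corr_avg c s) (fine (g n A)).
Proof.
move=> cs1; apply: has_mean_ge0; first exact: measurable_corr_avg.
  exact: corr_avg_ge0.
pose F (p : 'cV[R]_n * 'cV[R]_n) : \bar R := (\1_A p.1)%:E.
have mF : measurable_fun setT F by apply/measurable_EFinP; exact: mind.
transitivity (\int[g n]_x \int[g n]_y F (c *: x + s *: y, - s *: x + c *: y)%R)%E.
  apply: eq_integral => x _.
  by have [_ <-] := has_mean_corr_avg c s x; exact: eq_integral.
apply: (eq_trans (gauss_pair_rot cs1 mF _)); first by move=> p; rewrite lee_fin.
have [_ <-] := has_mean_ind; apply: eq_integral => x _.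
by have [_ <-] := has_mean_cst (g n) (\1_A x).
Qed.

(** The difference of two indicators is in absolute value their sum minus twice their product, and
    both points have the same Gaussian law. *)
Lemma noiseE c s : c ^+ 2 + s ^+ 2 = 1 ->
  noise c s = (2 * (fine (g n A) - fine (corr c s A A)))%:E.
Proof.
move=> cs1; set t := fine (g n A); set a := fine _.
have [_ e] := has_meanB (has_meanD has_mean_ind (has_mean_corr_avg_mean cs1))
  (has_meanZ 2 (has_mean_corr c s)).
have -> : 2 * (t - a) = t + t - 2 * a by ring.
rewrite -e; apply: eq_integral => x _.
have [_ <-] := has_meanB (has_meanD (has_mean_cst (g n) (\1_A x)) (has_mean_corr_avg c s x))
  (has_meanZ 2 (has_meanZ (\1_A x) (has_mean_corr_avg c s x))).
apply: eq_integral => y _; congr EFin; rewrite !indicE.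
case: (x \in A); case: (_ \in A);
  rewrite /= ?mulr1n ?mulr0n ?subrr ?subr0 ?sub0r ?normrN ?normr1 ?normr0; ring.
Qed.

(** Triangle inequality through the point at angle [a]: the pair rotated by [a] is again Gaussian,
    and turning it by [b] leads to angle [a + b]. *)
Lemma noise_add (a b : R) : (noise (cos (a + b)) (sin (a + b)) <=
  noise (cos a) (sin a) + noise (cos b) (sin b))%E.
Proof.
pose F (p : 'cV[R]_n * 'cV[R]_n) : \bar R :=
  `|\1_A p.1 - \1_A (cos b *: p.1 + sin b *: p.2)|%:E.
have mF : measurable_fun setT F by exact: measurable_noise.
have F0 p : (0 <= F p)%E by rewrite lee_fin.
rewrite {3}/noise -(gauss_pair_rot (cos2Dsin2 a) mF F0).
have mG := measurable_noise (cos a) (sin a).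
have G0 (p : 'cV[R]_n * 'cV[R]_n) :
  (0 <= `|\1_A p.1 - \1_A (cos a *: p.1 + sin a *: p.2)|%:E :> \bar R)%E by rewrite lee_fin.
have mH : measurable_fun setT (fun p : 'cV[R]_n * 'cV[R]_n =>
    F (cos a *: p.1 + sin a *: p.2, - sin a *: p.1 + cos a *: p.2)).
  by apply: (measurableT_comp mF); apply: measurable_fun_pair; exact: mlin.
have sec (K : 'cV[R]_n * 'cV[R]_n -> \bar R) x : measurable_fun setT K ->
    measurable_fun setT (fun y => K (x, y)).
  by move=> mK; exact: (measurableT_comp mK).
rewrite /noise -ge0_integralD//; last 4 first.
- by move=> x _; apply: integral_ge0 => y _; rewrite lee_fin.
- exact: (measurable_fun_fubini_tonelli_F _ mG G0).
- by move=> x _; apply: integral_ge0 => y _; exact: F0.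
- exact: (measurable_fun_fubini_tonelli_F _ mH (fun p => F0 _)).
apply: le_lower_integral => x; first by apply: integral_ge0 => y _; rewrite lee_fin.
rewrite -ge0_integralD//.
all: try exact: (sec _ x mG).
all: try exact: (sec _ x mH).
all: try by move=> y _; exact: F0.
apply: le_lower_integral => y; first by rewrite lee_fin.
rewrite /F/= -EFinD lee_fin.
have -> : cos b *: (cos a *: x + sin a *: y) + sin b *: (- sin a *: x + cos a *: y) =
    cos (a + b) *: x + sin (a + b) *: y.
  by apply/matrixP => i j; rewrite !mxE cosD sinD; ring.
exact: ler_distD.
Qed.

Lemma noise_mul (a : R) k : (noise (cos (k%:R * a)) (sin (k%:R * a)) <=
  k%:R%:E * noise (cos a) (sin a))%E.
Proof.
elim: k => [|k IH].
  rewrite mul0e mul0r cos0 sin0 noiseE; last by rewrite expr1n expr0n addr0.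
  rewrite lee_fin.
  (* At angle zero the averaging operator is the identity, so the noise vanishes. *)
  have : has_mean (g n) (fun x => \1_A x * corr_avg 1 0 x) (fine (g n A)).
    have := has_mean_ind; congr has_mean; apply/funext => x.
    have [_ h1] := has_mean_corr_avg 1 0 x.
    have [_ h2] := has_mean_cst (g n) (\1_A x).
    have -> : corr_avg 1 0 x = \1_A x.
      apply: EFin_inj; rewrite -h1 -h2; apply: eq_integral => y _.
      by rewrite scale1r scale0r addr0.
    by rewrite indicE; case: (x \in A); rewrite ?mulr1 ?mulr0.
  move=> [_ h]; have [_ h'] := has_mean_corr 1 0.
  by rewrite (EFin_inj (etrans (esym h) h')) subrr mulr0.
rewrite -[k.+1]addn1 natrD mulrDl mul1r; apply: (le_trans (noise_add _ _)).
rewrite EFinD ge0_muleDl ?lee_fin// mul1e.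
by apply: leeD.
Qed.

(** Turning the pair back by [a] puts both points symmetrically about [cos a *: u]. The displacement
    [v] is outermost so that it can be frozen while [u] varies. *)
Lemma noise_half (a : R) : noise (cos (a *+ 2)) (sin (a *+ 2)) =
  (\int[g n]_v \int[g n]_u
    `|\1_A (cos a *: u - sin a *: v) - \1_A (cos a *: u + sin a *: v)|%:E)%E.
Proof.
have cs1 : cos a ^+ 2 + (- sin a) ^+ 2 = 1 by rewrite sqrrN cos2Dsin2.
have mF := measurable_noise (cos (a *+ 2)) (sin (a *+ 2)).
rewrite {1}/noise.
apply: (eq_trans (esym (gauss_pair_rot cs1 mF _))); first by move=> p; rewrite lee_fin.
transitivity (\int[g n]_u \int[g n]_v
    `|\1_A (cos a *: u - sin a *: v) - \1_A (cos a *: u + sin a *: v)|%:E)%E.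
  apply: eq_integral => u _; apply: eq_integral => v _ /=; congr (`|_ - _|)%:E.
    by rewrite scaleNr.
  congr (\1_A _); apply/matrixP => i j; rewrite !mxE mulr2n cosD sinD.
  transitivity ((cos a * (cos a ^+ 2 + sin a ^+ 2)) * u i j +
    (sin a * (cos a ^+ 2 + sin a ^+ 2)) * v i j); first by ring.
  by rewrite cos2Dsin2 !mulr1.
apply: (fubini_tonelli (fun p : 'cV[R]_n * 'cV[R]_n => `|\1_A (cos a *: p.1 - sin a *: p.2) -
  \1_A (cos a *: p.1 + sin a *: p.2)|%:E)); last by move=> p; rewrite lee_fin.
apply/measurable_EFinP; apply: measurableT_comp => //; apply: measurable_funB; apply: mind.
  under eq_fun do rewrite -scaleNr.
  exact: mlin.
exact: mlin.
Qed.

End correlation_doubling.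

(** * Replacing a contracted Gaussian vector by a standard one *)

Section contraction.
Context (R : realType).
Local Notation mR := (measurableTypeR R).
Local Notation lambda := (@lebesgue_measure R).
Local Notation gauss := (@std_gaussian R).
Local Notation g n := (product_power gauss n).

Lemma normal_pdf_contract (c x : R) : 0 < c -> c <= 1 ->
  normal_pdf 0 1 x <= normal_pdf 0 1 (c * x).
Proof.
move=> c0 c1; rewrite !normal_pdf01E ler_wpM2l ?normal_peak_ge0// ler_expR lerN2.
rewrite ler_wpM2r// exprMn ler_piMl ?sqr_ge0//.
by rewrite exprn_ile1// ltW.
Qed.

Lemma gauss_contract1 (f : mR -> \bar R) (c : R) : 0 < c -> c <= 1 ->
  measurable_fun setT f -> (forall x, 0 <= f x)%E ->
  (c%:E * \int[gauss]_x f (c * x)%R <= \int[gauss]_x f x)%E.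
Proof.
move=> c0 c1 mf f0.
have mfc : measurable_fun setT (fun x : mR => f (c * x)).
  by apply: (measurableT_comp mf); exact: measurable_funM.
pose F x := (f x * (normal_pdf 0 1 x)%:E)%E.
have mF : measurable_fun setT F.
  by apply: emeasurable_funM => //; apply/measurable_EFinP; exact: measurable_normal_pdf.
have F0 x : (0 <= F x)%E by rewrite mule_ge0// lee_fin normal_pdf_ge0.
have -> : (\int[gauss]_x f x = c%:E * \int[lambda]_x F (c * x)%R)%E.
  by rewrite (integral_gauss mf f0) -(integral_lebesgue_scale c0 mF F0).
rewrite (integral_gauss mfc (fun x => f0 _)).
apply: lee_wpmul2l; first by rewrite lee_fin ltW.
apply: le_lower_integral => x; first by rewrite mule_ge0// lee_fin normal_pdf_ge0.
by rewrite /F lee_wpmul2l// lee_fin normal_pdf_contract.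
Qed.

(** For [c <= 1] the density of [c *: X] is at most [c^-n] times the standard one. It is used with
    [c = cos a], where the loss is at most a factor 2 for [a] of order 1/n. *)
Lemma gauss_contract n (f : 'cV[R]_n -> \bar R) (c : R) : 0 < c -> c <= 1 ->
  measurable_fun setT f -> (forall x, 0 <= f x)%E ->
  ((c ^+ n)%:E * \int[g n]_x f (c *: x)%R <= \int[g n]_x f x)%E.
Proof.
move=> c0 c1; elim: n f => [|n IH] f mf f0.
  rewrite expr0 mul1e le_eqVlt; apply/orP; left; apply/eqP.
  by apply: eq_integral => x _; rewrite (flatmx0 x) scaler0.
have mfc : measurable_fun setT (fun x : 'cV[R]_n.+1 => f (c *: x)).
  by apply: (measurableT_comp mf); exact: measurable_scalemx.
rewrite (integral_power_cons gauss mfc (fun x => f0 _)) (integral_power_cons gauss mf f0).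
pose F (x : mR) := (\int[g n]_v f (cV_cons (x, v)))%E.
have mf2 : measurable_fun setT (fun p : mR * 'cV[R]_n => f (cV_cons p)).
  exact: (measurableT_comp mf (@measurable_cV_cons R n)).
have mF : measurable_fun setT F by exact: (measurable_fun_fubini_tonelli_F _ mf2).
have F0 x : (0 <= F x)%E by exact: integral_ge0.
apply: le_trans (gauss_contract1 c0 c1 mF F0).
rewrite exprS EFinM -muleA; apply: lee_wpmul2l; first by rewrite lee_fin ltW.
have cn0 : 0 <= c ^+ n by rewrite exprn_ge0// ltW.
have mfc2 : measurable_fun setT (fun p : mR * 'cV[R]_n => f (c *: cV_cons p)).
  exact: (measurableT_comp mfc (@measurable_cV_cons R n)).
rewrite -ge0_integralZl//; last 2 first.
- exact: (measurable_fun_fubini_tonelli_F _ mfc2).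
- by move=> x _; exact: integral_ge0.
apply: le_lower_integral => x.
  by rewrite mule_ge0// ?lee_fin//; exact: integral_ge0.
have mfx : measurable_fun setT (fun v : 'cV[R]_n => f (cV_cons (c * x, v))).
  by apply: (measurableT_comp mf); exact: measurable_consmx.
apply: le_trans (IH _ mfx (fun v => f0 _)).
apply: lee_wpmul2l; first by rewrite lee_fin.
rewrite le_eqVlt; apply/orP; left; apply/eqP; apply: eq_integral => v _; congr f.
by apply/matrixP => i j; rewrite !mxE/=; case: unliftP => [k|] _ //; rewrite !mxE.
Qed.

End contraction.

(** * Lower bound on the noise at a small angle *)

Section noise_lower_bound.
Context (R : realType) (n : nat).
Local Notation gauss := (@std_gaussian R).
Local Notation g n := (product_power gauss n).
Variable A : set 'cV[R]_n.
Hypothesis mA : measurable A.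
Local Notation t := (fine (g n A)).
Hypothesis t0 : 0 < t.

Definition rho (k : nat) : R := expR (- ln 4 / 2 ^+ k).

Lemma rho0E : rho 0 = rho0 R.
Proof. by rewrite /rho expr0 divr1 expRN lnK ?posrE// /rho0 div1r. Qed.

Lemma rhoS k : rho k.+1 ^+ 2 = rho k.
Proof. by rewrite /rho -expRM_natl; congr expR; rewrite exprS; field. Qed.

Lemma rho_gt0 k : 0 < rho k. Proof. exact: expR_gt0. Qed.

Lemma ln4_gt0 : 0 < ln 4 :> R. Proof. by rewrite ln_gt0// ltr1n. Qed.

Lemma rho_lt1 k : rho k < 1.
Proof. by rewrite expR_lt1 mulNr oppr_lt0 divr_gt0// ?ln4_gt0// exprn_gt0. Qed.

Lemma rho_ge k : 4^-1 <= rho k.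
Proof.
have -> : 4^-1 = rho 0 by rewrite rho0E /rho0 div1r.
rewrite ler_expR !mulNr lerN2 expr0 divr1 ler_pdivrMr ?exprn_gt0//.
by apply: ler_peMr; [exact/ltW/ln4_gt0|rewrite exprn_ege1// ler1n].
Qed.

Lemma rho_onem k : 1 - rho k <= 3 / 2 ^+ k.
Proof.
have h : 1 - ln 4 / 2 ^+ k <= rho k by rewrite -mulNr; exact: expR_ge1Dx.
have : ln 4 / 2 ^+ k <= 3 / 2 ^+ k :> R.
  rewrite ler_wpM2r ?invr_ge0 ?exprn_ge0//.
  rewrite -ler_expR lnK ?posrE//; have := expR_ge1Dx (3 : R); lra.
lra.
Qed.

(* By [rhoS], [rho k = (1 / 4) ^ (1 / 2 ^ k)]. *)
Definition theta k : R := acos (rho k).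

Lemma rho_itv k : -1 <= rho k <= 1.
Proof. by rewrite ltW ?ltW ?rho_lt1// (lt_trans _ (rho_gt0 k))// ltrN10. Qed.

Lemma cos_theta k : cos (theta k) = rho k.
Proof. by rewrite acosK// in_itv/= rho_itv. Qed.

Lemma sin_theta k : sin (theta k) = Num.sqrt (1 - rho k ^+ 2).
Proof. by rewrite sin_acos// rho_itv. Qed.

Lemma theta_gt0 k : 0 < theta k.
Proof. by rewrite acos_gt0// rho_lt1 andbT; have /andP[] := rho_itv k. Qed.

(** By the mean value theorem the sine of the angle is at least [rho k >= 1/4] times the angle,
    while its square [1 - rho k ^ 2] is at most [2 (1 - rho k)]. *)
Lemma theta_le k : theta k <= 4 * Num.sqrt (6 / 2 ^+ k).
Proof.
have th0 := theta_gt0 k.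
have [z] := @MVT R sin cos 0 (theta k) th0 (fun x _ => is_derive_sin x)
  (continuous_subspaceT (@continuous_sin R)).
rewrite in_itv/= => /andP[z0 zth]; rewrite sin0 !subr0 => sE.
have thpi : theta k <= pi by rewrite acos_lepi ?rho_itv.
have cz : rho k <= cos z.
  rewrite -cos_theta ltW// ltr_cos// in_itv/= ?(ltW z0) ?(ltW th0)//.
  by rewrite (le_trans (ltW zth)).
have h1 : rho k * theta k <= sin (theta k) by rewrite sE ler_wpM2r// ltW.
have h2 : sin (theta k) <= Num.sqrt (6 / 2 ^+ k).
  rewrite sin_theta ler_wsqrtr//.
  have := rho_onem k; have := rho_lt1 k; have := rho_gt0 k => r0 r1 r2.
  have -> : 6 / 2 ^+ k = 2 * (3 / 2 ^+ k) :> R by field; rewrite expf_neq0.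
  have -> : 1 - rho k ^+ 2 = (1 + rho k) * (1 - rho k) by ring.
  nra.
have h3 : 4^-1 * theta k <= rho k * theta k by rewrite ler_wpM2r ?rho_ge// ltW.
move: (le_trans h3 (le_trans h1 h2)); set S := Num.sqrt _; lra.
Qed.

(** Each use of [corr_sqr] halves the excess of the exponent of [t] over 1, which starts at 1/4. *)
Lemma corr_dyadic k : fine (corr (rho k) (Num.sqrt (1 - rho k ^+ 2)) A A) <=
  t * expR (ln t / 4 / 2 ^+ k).
Proof.
elim: k => [|k IH].
  have s0E : Num.sqrt (1 - rho 0 ^+ 2) = sigma0 R.
    rewrite rho0E (_ : 1 - _ = sigma0 R ^+ 2); last by rewrite sigma0_sqr /rho0; field.
    by rewrite sqrtr_sqr gtr0_norm// sigma0_gt0.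
  rewrite s0E rho0E -lee_fin fine_corr//; apply: (le_trans (small_set mA mA)).
  rewrite lee_fin expr0 divr1.
  have rE : root4 t = expR (ln t / 4).
    have /eqP : root4 t ^+ 4 = expR (ln t / 4) ^+ 4.
      rewrite root4K ?ltW// -expRM_natl -[LHS]lnK ?posrE//; congr expR; by field.
    by rewrite eqrXn2 ?root4_ge0 ?expR_ge0// => /eqP.
  have sE : Num.sqrt t = root4 t ^+ 2 by rewrite sqr_sqrtr// sqrtr_ge0.
  rewrite -rE sE -{3}(root4K (ltW t0)) le_eqVlt; apply/orP; left; apply/eqP; ring.
have r1 j : 0 < 1 - rho j ^+ 2.
  by rewrite subr_gt0 exprn_ilt1// ?ltW ?rho_gt0// rho_lt1.
rewrite -(@ler_pXn2r _ 2)// ?nnegrE; last 2 first.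
- rewrite -lee_fin fine_corr//; apply: integral_ge0 => x _.
  by apply: integral_ge0 => y _; rewrite lee_fin mulr_ge0.
- by rewrite mulr_ge0 ?expR_ge0// ltW.
have e1 : rho k.+1 ^+ 2 + Num.sqrt (1 - rho k.+1 ^+ 2) ^+ 2 = 1.
  by rewrite sqr_sqrtr ?ltW//; ring.
have e2 : rho k.+1 ^+ 4 + Num.sqrt (1 - rho k ^+ 2) ^+ 2 = 1.
  by rewrite sqr_sqrtr ?ltW// -(rhoS k); ring.
have e3 : 0 < Num.sqrt (1 - rho k ^+ 2) by rewrite sqrtr_gt0.
have := corr_sqr mA e1 e2 e3; rewrite (rhoS k) => /le_trans; apply.
rewrite exprMn [in leRHS]expr2 -mulrA ler_wpM2l ?(ltW t0)//.
apply: (le_trans IH); rewrite ler_wpM2l ?(ltW t0)// -expRM_natl ler_expR exprS.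
by rewrite le_eqVlt; apply/orP; left; apply/eqP; field; rewrite expf_neq0.
Qed.

(** Take [k] with [2^k] between [L] and [2 L]. Then the correlation is at most
    [t exp (-1/8) <= 8 t / 9], so the noise is at least [2 t / 9], while [theta k * sqrt L] is at
    most 10; and 45 is 10 divided by 2/9. *)
Lemma noise_lower : t <= 2^-1 -> exists2 th : R, 0 < th &
  ((45^-1 * th * t * Num.sqrt (- ln t))%:E <= noise A (cos th) (sin th))%E.
Proof.
move=> t12; set L := - ln t.
have L12 : 2^-1 <= L.
  have : ln t <= t - 1 by rewrite -ler_expR lnK ?posrE//; have := expR_ge1Dx (t - 1); lra.
  by rewrite /L; lra.
have exk : exists k, L <= 2 ^+ k.
  have L0 : 0 <= L by lra.
  exists (Num.bound L); apply: ltW; apply: (lt_trans (archi_boundP L0)).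
  by rewrite -natrX ltr_nat ltn_expl.
case: (ex_minnP exk) => k Lk kmin.
(* Minimality of [k] gives this for positive [k]; for [k = 0] it is [L >= 1/2], which comes from
   [t <= 1/2]. *)
have L2k : 2 ^+ k <= 2 * L.
  case: k kmin {Lk} => [_|k kmin]; first by rewrite expr0; lra.
  rewrite exprS ler_pM2l// leNgt; apply/negP => /ltW /kmin.
  by rewrite ltnn.
have p2 : 0 < 2 ^+ k :> R by rewrite exprn_gt0.
exists (theta k); first exact: theta_gt0.
rewrite noiseE//; last exact: cos2Dsin2.
rewrite lee_fin cos_theta sin_theta.
have ak := corr_dyadic k.
have e9 : expR (ln t / 4 / 2 ^+ k) <= 8 / 9.
  rewrite (_ : _ / _ / _ = - (L / 4 / 2 ^+ k)); last by rewrite /L; ring.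
  rewrite expRN -[8 / 9]invrK lef_pV2 ?posrE ?expR_gt0 ?invr_gt0 ?divr_gt0//.
  apply: le_trans (expR_ge1Dx _).
  have : 8^-1 <= L / 4 / 2 ^+ k by rewrite ler_pdivlMr//; lra.
  lra.
have a89 : fine (corr (rho k) (Num.sqrt (1 - rho k ^+ 2)) A A) <= t * (8 / 9).
  by apply: (le_trans ak); rewrite ler_wpM2l// ltW.
have thL : theta k * Num.sqrt L <= 10.
  apply: (@le_trans _ _ (4 * Num.sqrt (6 / 2 ^+ k) * Num.sqrt L)).
    by rewrite ler_wpM2r ?sqrtr_ge0// theta_le.
  rewrite -mulrA -sqrtrM ?divr_ge0// ?exprn_ge0//.
  have : Num.sqrt (6 / 2 ^+ k * L) <= Num.sqrt ((5 / 2) ^+ 2).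
    rewrite ler_wsqrtr// mulrAC ler_pdivrMr//.
    have -> : (5 / 2) ^+ 2 = 25 / 4 :> R by field.
    lra.
  rewrite sqrtr_sqr ger0_norm ?divr_ge0//; lra.
have : t * (theta k * Num.sqrt L) <= t * 10 by rewrite ler_wpM2l// (ltW t0).
have -> : 45^-1 * theta k * t * Num.sqrt L = 45^-1 * (t * (theta k * Num.sqrt L)) by ring.
lra.
Qed.

End noise_lower_bound.

(** * Minkowski content of intervals *)

Section interval_edges.
Context (R : realType).
Local Notation mR := (measurableTypeR R).
Local Notation lambda := (@lebesgue_measure R).
Local Notation gauss := (@std_gaussian R).
Local Notation phi := (normal_pdf (0 : R) 1).

Lemma normal_peak1_bounds : 0 < (normal_peak 1 : R) <= 1.
Proof.
rewrite normal_peak_gt0 ?oner_neq0//= /normal_peak expr1n mul1r invf_le1.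
  by rewrite -[leLHS]sqrtr1 ler_wsqrtr//; have := pi_ge2 R; rewrite mulr2n; lra.
by rewrite sqrtr_gt0 mulrn_wgt0// pi_gt0.
Qed.

(** A crude constant suffices. Beyond distance 1 the peak bound is enough; within it, use
    [exp u >= 1 + u] and the boundedness of [|x| exp (- x^2 / 2)]. *)
Lemma normal_pdf_lipschitz (x y : R) : phi x <= phi y + 2 * `|y - x|.
Proof.
set d := `|y - x|; have d0 : 0 <= d by exact: normr_ge0.
have /andP[p0 p1] := normal_peak1_bounds.
have [d1|d1] := leP 1 d.
  have : phi x <= normal_peak 1 by rewrite normal_pdf_ub ?oner_neq0.
  by have := normal_pdf_gt0 y; lra.
rewrite !normal_pdf01E; set p := normal_peak 1 in p0 p1 *.
set ex := expR (- (x ^+ 2 / 2)); set ey := expR (- (y ^+ 2 / 2)).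
have ex0 : 0 < ex by exact: expR_gt0.
have xe : `|x| * ex <= 1.
  rewrite /ex expRN ler_pdivrMr ?expR_gt0// mul1r.
  apply: le_trans (expR_ge1Dx _).
  have : 0 <= (`|x| - 1) ^+ 2 by exact: sqr_ge0.
  rewrite -(real_normK (num_real x)); nra.
have ex1 : ex <= 1 by rewrite -expR0 ler_expR oppr_le0 divr_ge0// sqr_ge0.
have key : ex * (1 - (y ^+ 2 - x ^+ 2) / 2) <= ey.
  have -> : ey = ex * expR (- ((y ^+ 2 - x ^+ 2) / 2)).
    by rewrite /ex /ey -expRD; congr expR; field.
  by rewrite ler_wpM2l ?(ltW ex0)//; exact: expR_ge1Dx.
have yx : y ^+ 2 - x ^+ 2 <= 2 * (`|x| * d) + d.
  have h1 : (y - x) * x <= `|x| * d by rewrite -normrM mulrC; exact: ler_norm.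
  have h2 : (y - x) ^+ 2 <= d by rewrite -(real_normK (num_real (y - x))) -/d; nra.
  have -> : y ^+ 2 - x ^+ 2 = 2 * ((y - x) * x) + (y - x) ^+ 2 by ring.
  lra.
have exd : ex * (y ^+ 2 - x ^+ 2) <= 3 * d.
  apply: (@le_trans _ _ (ex * (2 * (`|x| * d) + d))); first by rewrite ler_wpM2l ?(ltW ex0).
  have -> : ex * (2 * (`|x| * d) + d) = 2 * ((`|x| * ex) * d) + ex * d by ring.
  have : `|x| * ex * d <= 1 * d by rewrite ler_wpM2r.
  have : ex * d <= 1 * d by rewrite ler_wpM2r.
  lra.
have exey : ex <= ey + 2 * d by lra.
have : p * ex <= p * (ey + 2 * d) by rewrite ler_wpM2l ?(ltW p0).
have : p * d <= 1 * d by rewrite ler_wpM2r.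
rewrite mulrDr; lra.
Qed.

Lemma gauss_itv_le (a b K : R) : a <= b -> (forall x, a <= x <= b -> phi x <= K) ->
  (gauss [set` `[a, b]] <= ((b - a) * K)%:E)%E.
Proof.
move=> ab hK; apply: (@le_trans _ _ (\int[lambda]_(x in `[a, b]) (K%:E))%E).
  apply: ge0_le_integral => //.
  - by move=> x _; rewrite lee_fin normal_pdf_ge0.
  - by apply/measurable_EFinP; apply: measurable_funTS; exact: measurable_normal_pdf.
rewrite integral_cst//= lebesgue_measure_itv/= lte_fin.
case: ltP => [_|ba]; first by rewrite -EFinB -EFinM mulrC.
have -> : a = b by apply/eqP; rewrite eq_le ab.
by rewrite mule0 subrr mul0r.
Qed.

Lemma gauss_itv_ge (a b K : R) : a <= b -> (forall x, a < x < b -> K <= phi x) ->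
  (((b - a) * K)%:E <= gauss [set` `]a, b[])%E.
Proof.
move=> ab hK; have [K0|K0] := leP K 0.
  apply: (@le_trans _ _ 0%E); last exact: measure_ge0.
  by rewrite lee_fin mulr_ge0_le0// subr_ge0.
apply: (@le_trans _ _ (\int[lambda]_(x in `]a, b[) (K%:E))%E).
  rewrite integral_cst//= lebesgue_measure_itv/= lte_fin.
  case: ltP => [_|ba]; first by rewrite -EFinB -EFinM mulrC.
  have -> : a = b by apply/eqP; rewrite eq_le ab.
  by rewrite mule0 subrr mul0r.
apply: ge0_le_integral => //.
- by move=> x _; rewrite lee_fin ltW.
- by apply/measurable_EFinP; apply: measurable_funTS; exact: measurable_normal_pdf.
Qed.

Definition enlarge (S : set R) (r : R) : set R :=
  [set s + u | s in S & u in `[- r, r]].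

(** A lower limit is a supremum over neighbourhoods, so one suffices for each [e]: when
    [r < e / (C + 1)] the quadratic error costs at most [e] after division by [r]. *)
Lemma minkowski_content_ge (S : set R) (p C : R) : measurable (S : set mR) -> 0 <= C ->
  (forall r, 0 < r -> (gauss S + (r * p - C * r ^+ 2)%:E <= gauss (enlarge S r))%E) ->
  (p%:E <= lower_minkowski_content gauss S)%E.
Proof.
move=> mS C0 h; apply/lee_addgt0Pr => e e0.
rewrite /lower_minkowski_content limf_einfE.
rewrite -leeBlDr// -EFinB.
apply: ereal_sup_ge; eexists; first exists [set r : R | 0 < r < e / (C + 1)] => //.
  have C1 : 0 < e / (C + 1) by rewrite divr_gt0// ltr_wpDl.
  near=> r => /=; apply/andP; split; first by near: r; exact: nbhs_right_gt.
  by near: r; exact: nbhs_right_lt.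
apply: le_ereal_inf_tmp => _ [r /= /andP[r0 re] <-].
have finS : gauss S \is a fin_num by exact: fin_num_measure.
have -> : (p - e)%:E = ((r * (p - e))%:E * r^-1%:E)%E.
  by rewrite -EFinM mulrAC divff ?gt_eqF// mul1r.
apply: lee_wpmul2r; first by rewrite lee_fin invr_ge0 ltW.
rewrite leeBrDl//; apply: le_trans (h r r0).
rewrite leeD2l// lee_fin.
have : C * r <= e.
  move: re; rewrite ltr_pdivlMr ?ltr_wpDl// => /ltW; nra.
nra.
Unshelve. all: by end_near. Qed.

(** It makes the enlargement measurable, so that monotonicity of the Gaussian measure applies to
    it. *)
Lemma enlarge_interval (J : set R) (r : R) : is_interval J -> 0 <= r ->
  is_interval (enlarge J r).
Proof.
move=> iJ r0.
move=> _ _ [s Js [u uI <-]] [s' Js' [u' uI' <-]] z.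
move: uI uI'; rewrite /= !in_itv/= => /andP[u1 u2] /andP[u1' u2'] /andP[z1 z2].
have [zs|zs] := leP z (Num.min s s').
  exists (Num.min s s').
    by rewrite minEle; case: ifP.
  exists (z - Num.min s s'); last by rewrite addrC subrK.
  rewrite /= in_itv/=; move: zs; rewrite le_min => /andP[zs zs'].
  by rewrite minEle; case: ifP; lra.
have [zs2|zs2] := leP (Num.max s s') z.
  exists (Num.max s s').
    by rewrite maxEle; case: ifP.
  exists (z - Num.max s s'); last by rewrite addrC subrK.
  rewrite /= in_itv/=; move: zs2; rewrite ge_max => /andP[zs2 zs2'].
  by rewrite maxEle; case: ifP; lra.
exists z; last by exists 0; rewrite ?addr0// /= in_itv/=; lra.
move: zs zs2; rewrite gt_min lt_max => zs zs2.
case/orP: zs => zs; case/orP: zs2 => zs2.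
- by have := lt_trans zs zs2; rewrite ltxx.
- by apply: (iJ _ _ Js Js'); rewrite !ltW.
- by apply: (iJ _ _ Js' Js); rewrite !ltW.
- by have := lt_trans zs zs2; rewrite ltxx.
Qed.

Lemma sub_enlarge (J : set R) (r : R) : 0 <= r -> J `<=` enlarge J r.
Proof.
by move=> r0 x Jx; exists x => //; exists 0; rewrite ?addr0// /= in_itv/= oppr_le0 r0.
Qed.

Lemma minkowski_content_ge0 (J : set R) : is_interval J ->
  (0 <= lower_minkowski_content gauss J)%E.
Proof.
move=> iJ; apply: (@minkowski_content_ge _ 0 0) => // [|r r0].
  exact: is_interval_measurable.
rewrite mulr0 mul0r subr0 adde0; apply: le_measure; rewrite ?inE.
- exact: is_interval_measurable.
- by apply: is_interval_measurable; apply: enlarge_interval => //; exact: ltW.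
- by apply: sub_enlarge; exact: ltW.
Qed.

(** [p] is the Gaussian density at the right end of [J], or 0 if [J] is unbounded to the right. The
    same number bounds crossings of this end from above and the gain of an enlargement from below,
    so the content itself is never computed. The quadratic errors come from the Lipschitz bound. *)
Lemma right_edge (J : set R) : is_interval J -> J !=set0 ->
  exists p, [/\ 0 <= p,
    forall d, 0 < d -> exists I : set mR, [/\ measurable I,
      forall z, J (z - d) -> ~ J (z + d) -> I z &
      (gauss I <= (2 * d * p + 4 * d ^+ 2)%:E)%E] &
    forall r, 0 < r -> exists U : set mR, [/\ measurable U,
      forall u j, U u -> J j -> j < u,
      U `<=` enlarge J r &
      ((r * p - 2 * r ^+ 2)%:E <= gauss U)%E]].
Proof.
move=> iJ J0; have [ubJ|nubJ] := pselect (has_ubound J).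
  have supJ : has_sup J by [].
  have Jb j : J j -> j <= sup J by move=> Jj; exact: ub_le_sup.
  pose b := sup J; exists (phi b); split; first exact: normal_pdf_ge0.
    move=> d d0; exists [set` `[b - d, b + d]]; split => //.
      move=> z Jz nJz /=; rewrite in_itv/=; apply/andP; split; last first.
        by rewrite -lerBlDr; exact: Jb.
      rewrite lerBlDr leNgt; apply/negP => zb.
      have [j Jj zj] := sup_gt J0 zb; apply: nJz; apply: (iJ _ _ Jz Jj).
      by rewrite (ltW zj) andbT; lra.
    rewrite (_ : 2 * d * _ + _ = (b + d - (b - d)) * (phi b + 2 * d)); last by ring.
    apply: gauss_itv_le => [|x /andP[x1 x2]]; first by lra.
    apply: (le_trans (normal_pdf_lipschitz x b)); rewrite lerD2l ler_wpM2l//.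
    by rewrite ler_norml; lra.
  move=> r r0; exists [set` `]b, b + r[]; split => //.
  - by move=> u j /=; rewrite in_itv/= => /andP[bu _] /Jb; rewrite -/b => jb; exact: le_lt_trans bu.
  - move=> u /=; rewrite in_itv/= => /andP[bu ubr].
    have ub : u - r < b by rewrite ltrBlDr.
    have [j Jj uj] := sup_gt J0 ub; exists j => //; exists (u - j); last by rewrite addrC subrK.
    by rewrite /= in_itv/=; have := Jb _ Jj; rewrite -/b => jb; lra.
  - rewrite (_ : r * _ - _ = (b + r - b) * (phi b - 2 * r)); last by ring.
    apply: gauss_itv_ge => [|x /andP[x1 x2]]; first by lra.
    have := normal_pdf_lipschitz b x.
    have : `|x - b| <= r by rewrite ler_norml; lra.
    lra.
exists 0; split => //.
  move=> d d0; exists set0; split => //.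
    move=> z Jz nJz; apply: nubJ; exists (z + d) => j Jj; rewrite leNgt; apply/negP => zj.
    by apply: nJz; apply: (iJ _ _ Jz Jj); rewrite (ltW zj) andbT; lra.
  by rewrite measure0 lee_fin mulr0 add0r mulr_ge0// sqr_ge0.
move=> r r0; exists set0; split => //.
by rewrite measure0 lee_fin mulr0 sub0r oppr_le0 mulr_ge0// sqr_ge0.
Qed.

Lemma gauss_reflect (S : set mR) : measurable S -> gauss [set x | S (- x)] = gauss S.
Proof.
move=> mS.
have mS' : measurable ([set x | S (- x)] : set mR).
  have : measurable_fun setT (fun x : mR => - x : mR) by exact: oppr_measurable.
  by move=> /(_ measurableT _ mS); rewrite setTI.
rewrite -(integral_indicT _ mS') -(integral_indicT _ mS).
rewrite -(gauss_opp (f := fun x => (\1_S x)%:E)).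
- by [].
- by apply/measurable_EFinP; exact: measurable_indic.
- by move=> x; rewrite lee_fin.
Qed.

(** A reflection reduces the left end to [right_edge]. With densities [p] and [q] at the ends,
    crossings cost about [2 d (p + q)], and [p + q] is at most the content because the two outer
    strips are disjoint from [J] and from each other. *)
Lemma interval_crossing_le (J : set mR) (d : R) : is_interval (J : set R) -> 0 < d ->
  (\int[gauss]_z `|\1_J (z - d)%R - \1_J (z + d)%R|%:E <=
   (2 * d)%:E * lower_minkowski_content gauss J + (8 * d ^+ 2)%:E)%E.
Proof.
move=> iJ d0; have mJ : measurable J by exact: is_interval_measurable.
have [J0|J0] := pselect (J !=set0); last first.
  have -> : J = set0 by apply/seteqP; split=> // x Jx; apply: J0; exists x.
  have c0 : (0 <= lower_minkowski_content gauss (set0 : set R))%E.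
    by apply: minkowski_content_ge0 => x y [].
  under eq_integral do rewrite !indic0 subrr normr0.
  by rewrite integral0 adde_ge0// ?mule_ge0// lee_fin mulr_ge0// ?sqr_ge0// ltW.
have [p [p0 hI hU]] := right_edge iJ J0.
pose J' := [set x : R | J (- x)].
have iJ' : is_interval J'.
  move=> x y Jx Jy z /andP[xz zy]; apply: (iJ _ _ Jy Jx).
  by rewrite !lerN2 xz zy.
have J'0 : J' !=set0 by case: J0 => x Jx; exists (- x); rewrite /J'/= opprK.
have [q [q0 hI' hU']] := right_edge iJ' J'0.
have [I [mI sI gI]] := hI d d0; have [I' [mI' sI' gI']] := hI' d d0.
pose K := [set x : mR | I' (- x)].
have mopp : measurable_fun setT (fun x : mR => - x : mR) by exact: oppr_measurable.
have mK : measurable K by have := mopp measurableT _ mI'; rewrite setTI.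
have pq : ((p + q)%:E <= lower_minkowski_content gauss J)%E.
  apply: (@minkowski_content_ge _ _ 4) => // r r0.
  have [U [mU JU sU gU]] := hU r r0; have [U' [mU' JU' sU' gU']] := hU' r r0.
  pose V := [set x : mR | U' (- x)].
  have mV : measurable V by have := mopp measurableT _ mU'; rewrite setTI.
  have JV v j : V v -> J j -> v < j.
    by move=> Vv Jj; rewrite -ltrN2; apply: (JU' _ _ Vv); rewrite /J'/= opprK.
  have sV : V `<=` enlarge J r.
    move=> v /sU' [s Js [u]]; rewrite /= in_itv/= => /andP[u1 u2] e.
    exists (- s) => //; exists (- u); first by rewrite /= in_itv/= lerN2 lerNl u1 u2.
    by rewrite -opprD e opprK.
  have sJ : J `<=` enlarge J r by apply: sub_enlarge; exact: ltW.
  have iE : is_interval (enlarge J r) by apply: enlarge_interval => //; exact: ltW.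
  have mE : measurable (enlarge J r : set mR) by exact: is_interval_measurable.
  have dJU : J `&` U = set0.
    by apply/seteqP; split => // x [Jx Ux]; have := JU _ _ Ux Jx; rewrite ltxx.
  (* The strips are separated by any point of [J]; this is why the empty set was treated apart. *)
  have dJV : (J `|` U) `&` V = set0.
    case: (J0) => j Jj.
    apply/seteqP; split => // x [[Jx|Ux] Vx]; first by have := JV _ _ Vx Jx; rewrite ltxx.
    by have := lt_trans (JV _ _ Vx Jj) (JU _ _ Ux Jj); rewrite ltxx.
  apply: (@le_trans _ _ (gauss ((J `|` U) `|` V))); last first.
    apply: le_measure; rewrite ?inE//.
      by apply: measurableU => //; exact: measurableU.
    by move=> x [[Jx|Ux]|Vx]; [exact: sJ|exact: sU|exact: sV].
  have e1 : gauss (J `|` U `|` V) = (gauss (J `|` U) + gauss V)%E.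
    by apply: measureU => //; exact: measurableU.
  have e2 : gauss (J `|` U) = (gauss J + gauss U)%E by exact: measureU.
  have gV : gauss V = gauss U' by exact: gauss_reflect.
  have tri (a b c e : \bar R) : (e <= b + c -> a + e <= a + b + c)%E.
    by move=> h; rewrite -addeA; exact: leeD2l.
  rewrite e1 e2 gV; apply: tri.
  apply: le_trans (leeD gU gU').
  by rewrite -EFinD lee_fin le_eqVlt; apply/orP; left; apply/eqP; ring.
apply: (@le_trans _ _ ((2 * d * (p + q))%:E + (8 * d ^+ 2)%:E)%E); last first.
  by rewrite leeD2r// EFinM lee_wpmul2l// lee_fin mulr_ge0// ltW.
apply: (@le_trans _ _ (\int[gauss]_z ((\1_I z)%:E + (\1_K z)%:E))%E).
  apply: le_lower_integral => z; first by rewrite lee_fin.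
  rewrite -EFinD lee_fin !indicE.
  have b0 (b : bool) : 0 <= b%:R :> R by case: b.
  have [J1|J1] := boolP (z - d \in J); have [J2|J2] := boolP (z + d \in J);
    rewrite ?subrr ?normr0 ?subr0 ?sub0r ?normrN ?normr1 ?addr_ge0//.
    suff -> : z \in I by rewrite lerDl.
    by rewrite inE; apply: sI; [rewrite inE in J1|move/mem_set; apply/negP].
  suff -> : z \in K by rewrite lerDr.
  rewrite inE; apply: sI'; rewrite /J'/= ?opprD ?opprK; first by rewrite inE in J2.
  by move/mem_set; apply/negP.
rewrite ge0_integralD//; last 2 first.
- by apply/measurable_EFinP; exact: measurable_indic.
- by apply/measurable_EFinP; exact: measurable_indic.
have gK : (gauss K <= (2 * d * q + 4 * d ^+ 2)%:E)%E.
  by apply: le_trans gI'; rewrite le_eqVlt; apply/orP; left; apply/eqP; exact: gauss_reflect.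
rewrite !integral_indicT//; apply: (le_trans (leeD gI gK)).
by rewrite -!EFinD lee_fin le_eqVlt; apply/orP; left; apply/eqP; ring.
Qed.

End interval_edges.

(** * Averaging over rotations *)

Section lower_affine.
Context d (T : measurableType d) (R : realType) (P : probability T R).
Local Open Scope ereal_scope.

(* No measurability of [c] is required: its integral is a lower integral. *)
Lemma le_lower_affine (h c : T -> \bar R) (a b : R) : (0 < a)%R -> (0 <= b)%R ->
  measurable_fun setT h -> (forall x, 0 <= h x) -> (forall x, 0 <= c x) ->
  (forall x, h x <= a%:E * c x + b%:E) ->
  \int[P]_x h x <= a%:E * \int[P]_x c x + b%:E.
Proof.
move=> a0 b0 mh h0 c0 hc.
(* The affine inequality solved for [c]: the least nonnegative function that satisfies it. It lies
   below [c] and inherits measurability from [h]. *)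
pose m x := a^-1%:E * maxe 0 (h x - b%:E).
have mm : measurable_fun setT (fun x => maxe 0 (h x - b%:E)).
  by apply: measurable_maxe => //; apply: emeasurable_funB.
have max0 x : 0 <= maxe 0 (h x - b%:E) by rewrite le_max lexx.
have ai : (0 <= a^-1)%R by rewrite invr_ge0 ltW.
have m0 x : 0 <= m x by rewrite mule_ge0// lee_fin.
have mc x : m x <= c x.
  rewrite /m -[leRHS]mul1e -(@mulVf _ a) ?gt_eqF// EFinM -muleA.
  apply: lee_wpmul2l; first by rewrite lee_fin.
  rewrite ge_max; apply/andP; split; first by rewrite mule_ge0// lee_fin ltW.
  by rewrite leeBlDr.
have hm x : h x <= a%:E * m x + b%:E.
  rewrite /m muleA -EFinM divff ?gt_eqF// mul1e -leeBlDr//.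
  by rewrite le_max lexx orbT.
apply: (@le_trans _ _ (\int[P]_x (a%:E * m x + b%:E))).
  exact: le_lower_integral.
have mm' : measurable_fun setT m by apply: emeasurable_funM.
rewrite ge0_integralD//; last 2 first.
- by move=> x _; rewrite mule_ge0// lee_fin ltW.
- by apply: emeasurable_funM.
rewrite ge0_integralZl//; last by rewrite lee_fin ltW.
have [_ ->] := has_mean_cst P b.
apply: leeD2r; apply: lee_wpmul2l; first by rewrite lee_fin ltW.
exact: le_lower_integral.
Qed.

End lower_affine.

(** * Influence along one direction *)

Section resampling.
Context (R : realType).
Local Notation mR := (measurableTypeR R).
Local Notation gauss := (@std_gaussian R).
Local Notation g n := (product_power gauss n).

Definition set_coord n (i : 'I_n) (y : R) (x : 'cV[R]_n) : 'cV[R]_n :=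
  \col_j (if j == i then y else x j 0).

Lemma measurable_set_coord n (i : 'I_n) d (T : measurableType d) (y : T -> mR)
    (x : T -> 'cV[R]_n) :
  measurable_fun setT y -> measurable_fun setT x ->
  measurable_fun setT (fun t => set_coord i (y t) (x t)).
Proof.
move=> my mx; apply: measurable_fun_mx => j k.
under eq_fun do rewrite mxE.
by case: (j == i) => //; exact: measurable_mxentry.
Qed.

(** Replacing one coordinate by an independent copy preserves a product measure. This creates an
    inner integral along the fiber, to be compared with the content in [geometric_influence]. *)
Lemma integral_resample n (i : 'I_n) (F : 'cV[R]_n -> \bar R) :
  measurable_fun setT F -> (forall x, (0 <= F x)%E) ->
  (\int[g n]_x \int[gauss]_y F (set_coord i y x) = \int[g n]_x F x)%E.
Proof.
elim: n i F => [[]//|n IH] i F mF F0.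
pose G (x : 'cV[R]_n.+1) := (\int[gauss]_y F (set_coord i y x))%E.
have mG : measurable_fun setT G.
  apply: (measurable_fun_fubini_tonelli_F
    (fun p : 'cV[R]_n.+1 * mR => F (set_coord i p.2 p.1))) => //.
  by apply: (measurableT_comp mF); exact: measurable_set_coord.
have G0 x : (0 <= G x)%E by exact: integral_ge0.
apply: (eq_trans (integral_power_cons gauss mG G0)).
apply/esym; apply: (eq_trans (integral_power_cons gauss mF F0)).
case: (unliftP ord0 i) => [k|] iE.
  apply: eq_integral => x _.
  have mFx : measurable_fun setT (fun v : 'cV[R]_n => F (cV_cons (x, v))).
    by apply: (measurableT_comp mF); exact: measurable_consmx.
  apply/esym; apply: (eq_trans _ (IH k _ mFx (fun v => F0 _))).
  apply: eq_integral => v _; apply: eq_integral => y _; congr F.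
  apply/matrixP => j l; rewrite ord1 !mxE iE /=; case: unliftP => [j'|] -> //.
  by rewrite (inj_eq lift_inj) mxE.
pose K := (\int[gauss]_x \int[g n]_v F (cV_cons (x, v)))%E.
have [_ e1] := has_mean_cst gauss 1.
transitivity (\int[gauss]_(x in setT) (cst K x))%E.
  rewrite integral_cst// -/K; apply/esym; rewrite -[RHS]mule1; congr (_ * _)%E.
  exact: (probability_setT gauss).
apply: eq_integral => x _; rewrite /cst /K.
have mF2 : measurable_fun setT (fun p : mR * 'cV[R]_n => F (cV_cons p)).
  exact: (measurableT_comp mF (@measurable_cV_cons R n)).
apply: (eq_trans (fubini_tonelli _ mF2 (fun p => F0 _))).
apply: eq_integral => v _; apply: eq_integral => y _; congr F.
apply/matrixP => j l; rewrite ord1 !mxE iE /=; case: unliftP => [j'|] -> //.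
Qed.

End resampling.

Section directional_influence.
Context (R : realType) (n : nat).
Local Notation mR := (measurableTypeR R).
Local Notation gauss := (@std_gaussian R).
Local Notation g n := (product_power gauss n).
Implicit Types (A : set 'cV[R]_n) (M : 'M[R]_n).

Lemma convex_set_comb A (x y : 'cV[R]_n) (k : R) : convex_set A ->
  A x -> A y -> 0 <= k <= 1 -> A (k *: x + (1 - k) *: y).
Proof.
move=> cA Ax Ay /andP[k0 k1].
have := cA x y (Itv01 k0 k1) (mem_set Ax) (mem_set Ay).
by rewrite inE.
Qed.

Lemma set_coord_comb (i : 'I_n) (k y1 y2 : R) (x : 'cV[R]_n) :
  set_coord i (k * y1 + (1 - k) * y2) x =
  k *: set_coord i y1 x + (1 - k) *: set_coord i y2 x.
Proof. by apply/matrixP => j l; rewrite !mxE; case: ifP => // _; ring. Qed.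

Lemma orthogonal_imageE (M : orthogonal_group R n) A :
  orthogonal_image M A = [set z | A (M^T *m z)].
Proof.
have hM : M *m M^T = 1%:M by case: M => M /= /eqP.
apply/seteqP; split => [_ [x Ax <-]|z Az] /=.
  by rewrite mulmxA (mulmx1C hM) mul1mx.
by exists (M^T *m z) => //; rewrite mulmxA hM mul1mx.
Qed.

Lemma fiber_interval A M (i : 'I_n) (x : 'cV[R]_n) : convex_set A ->
  is_interval (fiber [set z | A (M *m z)] i x).
Proof.
move=> cA y1 y2 /= A1 A2 y /andP[y1y yy2]; rewrite /fiber/=.
have [y12|y12] := eqVneq y1 y2.
  have -> : y = y1 by apply/eqP; rewrite eq_le y1y y12 yy2.
  exact: A1.
have y12' : 0 < y2 - y1 by rewrite subr_gt0 lt_def eq_sym y12 (le_trans y1y).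
pose k := (y2 - y) / (y2 - y1).
have -> : y = k * y1 + (1 - k) * y2 by rewrite /k; field; rewrite gt_eqF.
rewrite -/(set_coord _ _ _) set_coord_comb mulmxDr -!scalemxAr.
apply: convex_set_comb => //.
apply/andP; split; first by rewrite divr_ge0 ?(ltW y12')// subr_ge0.
by rewrite ler_pdivrMr// mul1r lerD2l lerN2.
Qed.

Definition shift_diff A (v : 'cV[R]_n) : \bar R :=
  (\int[g n]_z `|\1_A (z - v)%R - \1_A (z + v)%R|%:E)%E.

Lemma shift_diff_ge0 A v : (0 <= shift_diff A v)%E.
Proof. by apply: integral_ge0 => z _; rewrite lee_fin. Qed.

Lemma measurable_shift_integrand A d (T : measurableType d) (u v : T -> 'cV[R]_n) :
  measurable A -> measurable_fun setT u -> measurable_fun setT v ->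
  measurable_fun setT (fun t => `|\1_A (u t) - \1_A (v t)|%:E : \bar R).
Proof.
move=> mA mu mv; apply/measurable_EFinP; apply: measurableT_comp => //.
by apply: measurable_funB; exact: (measurableT_comp (measurable_indic mA)).
Qed.

(** Rotating by [M] makes the shift parallel to the axis [i]; by convexity each fiber is an
    interval, to which the crossing bound applies. Integration over fibers goes through
    [le_lower_affine]. *)
Lemma shift_diff_influence A (M : orthogonal_group R n) (i : 'I_n) (d : R) :
  convex_set A -> measurable A -> 0 < d ->
  (shift_diff A (d *: (M^T *m delta_mx i 0))%R <=
   (2 * d)%:E * geometric_influence gauss i (orthogonal_image M A) +
   (8 * d ^+ 2)%:E)%E.
Proof.
move=> cA mA d0; have hM : M *m M^T = 1%:M by case: (M) => N /= /eqP.
rewrite orthogonal_imageE; set B := [set z | A (M^T *m z)].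
have mB : measurable B.
  by have := measurable_mulmxl M^T measurableT mA; rewrite setTI.
pose e : 'cV[R]_n := d *: delta_mx i 0.
pose F (z : 'cV[R]_n) : \bar R := `|\1_B (z - e) - \1_B (z + e)|%:E.
have mF : measurable_fun setT F.
  apply: measurable_shift_integrand => //.
    by apply: measurable_addmx.
  by apply: measurable_addmx.
have F0 z : (0 <= F z)%E by rewrite lee_fin.
have -> : shift_diff A (d *: (M^T *m delta_mx i 0)) = (\int[g n]_z F z)%E.
  pose v := d *: (M^T *m (delta_mx i 0 : 'cV[R]_n)).
  have mG : measurable_fun setT (fun z : 'cV[R]_n => `|\1_A (z - v) - \1_A (z + v)|%:E : \bar R).
    apply: measurable_shift_integrand => //.
      by apply: measurable_addmx.
    by apply: measurable_addmx.
  have G0 (z : 'cV[R]_n) : (0 <= (`|\1_A (z - v) - \1_A (z + v)|%:E : \bar R))%E.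
    by rewrite lee_fin.
  apply: (eq_trans (esym (gauss_orth (orth_tr hM) mG G0))).
  apply: eq_integral => z _; rewrite /F /B !indicE.
  have -> : M^T *m z - v = M^T *m (z - e) by rewrite mulmxBr -scalemxAr.
  have -> : M^T *m z + v = M^T *m (z + e) by rewrite mulmxDr -scalemxAr.
  by [].
rewrite -(integral_resample i mF F0) /geometric_influence.
have d20 : 0 < 2 * d by rewrite mulr_gt0.
have crossing x : (\int[gauss]_y F (set_coord i y x) <=
    (2 * d)%:E * lower_minkowski_content gauss (fiber B i x) + (8 * d ^+ 2)%:E)%E.
  have iJ : is_interval (fiber B i x) by exact: fiber_interval.
  apply: le_trans (interval_crossing_le iJ d0).
  rewrite le_eqVlt; apply/orP; left; apply/eqP; apply: eq_integral => y _.
  rewrite /F /fiber !indicE.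
  have -> : set_coord i y x - e = set_coord i (y - d) x.
    apply/matrixP => j l; rewrite ord1 !mxE eqxx andbT; case: ifP => _.
      by rewrite mulr1.
    by rewrite mulr0 subr0.
  have -> : set_coord i y x + e = set_coord i (y + d) x.
    apply/matrixP => j l; rewrite ord1 !mxE eqxx andbT; case: ifP => _.
      by rewrite mulr1.
    by rewrite mulr0 addr0.
  by [].
apply: le_lower_affine => //.
- by rewrite mulr_ge0// sqr_ge0.
- apply: (measurable_fun_fubini_tonelli_F (fun p : 'cV[R]_n * mR => F (set_coord i p.2 p.1))) => //.
  by apply: (measurableT_comp mF); exact: measurable_set_coord.
- by move=> x; exact: integral_ge0.
- move=> x; have iJ : is_interval (fiber B i x) by exact: fiber_interval.
  exact: minkowski_content_ge0.
Qed.

End directional_influence.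

(** * Haar integration and the length of a Gaussian vector *)

Section orthogonal_group_measurable.
Context (R : realType) (n : nat).
Local Notation On := (orthogonal_group R n).

Lemma orthogonalP (M : On) : M *m M^T = 1%:M.
Proof. by case: M => N /= /eqP. Qed.

Lemma measurable_orthogonal_mx : measurable_fun setT (fun M : On => M : 'M[R]_n).
Proof. by move=> _ B mB; exists B. Qed.

Lemma measurable_to_orthogonal d (T : measurableType d) (f : T -> On) :
  measurable_fun setT (fun t => f t : 'M[R]_n) -> measurable_fun setT f.
Proof.
move=> mf _ B [C mC <-]; rewrite !setTI.
by have := mf measurableT C mC; rewrite setTI.
Qed.

Definition orthogonal_inv (M : On) : On :=
  Orthogonal (introT eqP (orth_tr (orthogonalP M))).

Lemma orthogonal_mulVK (M N : On) : orthogonal_mul (orthogonal_inv M) (orthogonal_mul M N) = N.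
Proof. by apply: val_inj => /=; rewrite mulmxA (mulmx1C (orthogonalP M)) mul1mx. Qed.

Lemma orthogonal_mulKV (M N : On) : orthogonal_mul M (orthogonal_mul (orthogonal_inv M) N) = N.
Proof. by apply: val_inj => /=; rewrite mulmxA (orthogonalP M) mul1mx. Qed.

Lemma measurable_orthogonal_mul (M : On) : measurable_fun setT (orthogonal_mul M).
Proof.
apply: measurable_to_orthogonal => /=.
by apply: measurable_mulmx => //; exact: measurable_orthogonal_mx.
Qed.

Lemma orthogonal_mul_image (M : On) (B : set On) :
  orthogonal_mul M @` B = orthogonal_mul (orthogonal_inv M) @^-1` B.
Proof.
apply/seteqP; split => [_ [N BN <-]|N BN] /=; first by rewrite orthogonal_mulVK.
by exists (orthogonal_mul (orthogonal_inv M) N) => //; rewrite orthogonal_mulKV.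
Qed.

Lemma orthogonal_invK (M : On) : orthogonal_inv (orthogonal_inv M) = M.
Proof. by apply: val_inj => /=; rewrite trmxK. Qed.

Lemma integral_haar (pi : probability On R) (M : On) (f : On -> \bar R) : is_haar pi ->
  measurable_fun setT f -> (forall N, (0 <= f N)%E) ->
  (\int[pi]_N f (orthogonal_mul M N) = \int[pi]_N f N)%E.
Proof.
move=> hpi mf f0; apply: integral_preserving => //.
  exact: measurable_orthogonal_mul.
move=> B mB; rewrite -[in LHS](orthogonal_invK M) -orthogonal_mul_image.
exact: hpi.
Qed.

End orthogonal_group_measurable.

Section gaussian_norm.
Context (R : realType).
Local Notation mR := (measurableTypeR R).
Local Notation gauss := (@std_gaussian R).
Local Notation g n := (product_power gauss n).

(** Domination by [4 exp (x^2 / 4)], whose mean is [4 sqrt 2]. *)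
Lemma has_mean_sqr_ex : exists m : R, has_mean gauss (fun x => x ^+ 2) m.
Proof.
have s0 : 0 < Num.sqrt 2 :> R by rewrite sqrtr_gt0.
have s2 : Num.sqrt 2 ^+ 2 * (1 - 4^-1 *+ 2) = 1 :> R by rewrite sqr_sqrtr//; field.
have [ei e] := has_meanZ 4 (has_mean_expR_sqr s0 s2).
exists (fine (\int[gauss]_x (x ^+ 2)%:E)%E).
apply: has_mean_ge0; first exact: measurable_sqr.
  by move=> x; exact: sqr_ge0.
rewrite fineK// ge0_fin_numE; last by apply: integral_ge0 => x _; rewrite lee_fin sqr_ge0.
apply: (@le_lt_trans _ _ (4 * Num.sqrt 2)%:E%E); last exact: ltry.
rewrite -e; apply: le_lower_integral => x; first by rewrite lee_fin sqr_ge0.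
rewrite lee_fin; have := expR_ge1Dx (4^-1 * x ^+ 2); lra.
Qed.

Definition second_moment : R := fine (\int[gauss]_x (x ^+ 2)%:E)%E.

Lemma has_mean_sqr : has_mean gauss (fun x => x ^+ 2) second_moment.
Proof. by have [m hm] := has_mean_sqr_ex; have [_ e] := hm; rewrite /second_moment e. Qed.

Lemma second_moment_ge0 : 0 <= second_moment.
Proof. by apply: (has_mean_le (has_mean_cst gauss 0) has_mean_sqr) => x; exact: sqr_ge0. Qed.

Lemma measurable_norm_sqr n : measurable_fun setT (fun v : 'cV[R]_n => euclidean_norm v ^+ 2).
Proof.
under eq_fun do rewrite euclidean_norm_sqr.
by apply: measurable_sum => i; apply: measurable_funX; exact: measurable_mxentry.
Qed.

Lemma measurable_norm n : measurable_fun setT (fun v : 'cV[R]_n => euclidean_norm v).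
Proof.
rewrite (_ : (fun _ => _) = (fun v : 'cV[R]_n => Num.sqrt (euclidean_norm v ^+ 2))).
  apply: (@measurableT_comp _ _ _ _ _ _ (Num.sqrt : R -> R)).
    exact: measurable_sqrtr.
  exact: measurable_norm_sqr.
by apply/funext => v; rewrite sqrtr_sqr ger0_norm// euclidean_norm_ge0.
Qed.

Lemma has_mean_norm_sqr n :
  has_mean (g n) (fun v => euclidean_norm v ^+ 2) (n%:R * second_moment).
Proof.
elim: n => [|n IH].
  rewrite mul0r; have := has_mean_cst (g 0) 0; congr has_mean.
  by apply/funext => v; rewrite euclidean_norm_sqr big_ord0.
apply: has_mean_ge0; first exact: measurable_norm_sqr.
  by move=> v; exact: sqr_ge0.
have m1 : measurable_fun setT (fun v : 'cV[R]_n.+1 => (euclidean_norm v ^+ 2)%:E : \bar R).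
  by apply/measurable_EFinP; exact: measurable_norm_sqr.
have p1 (v : 'cV[R]_n.+1) : (0 <= (euclidean_norm v ^+ 2)%:E :> \bar R)%E.
  by rewrite lee_fin sqr_ge0.
apply: (eq_trans (integral_power_cons gauss m1 p1)).
have [_ <-] : has_mean gauss (fun x => x ^+ 2 + n%:R * second_moment) (n.+1%:R * second_moment).
  rewrite -natr1 mulrDl mul1r addrC; exact: (has_meanD has_mean_sqr (has_mean_cst _ _)).
apply: eq_integral => x _.
have [_ <-] := has_meanD (has_mean_cst (g n) (x ^+ 2)) IH.
apply: eq_integral => v _; congr EFin.
rewrite !euclidean_norm_sqr big_ord_recl; congr (_ + _).
  by rewrite mxE unlift_none.
by apply: eq_bigr => i _; rewrite mxE liftK.
Qed.

End gaussian_norm.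

(** * Shifts averaged over rotations *)

Section averaging.
Context (R : realType) (n : nat).
Local Notation gauss := (@std_gaussian R).
Local Notation g n := (product_power gauss n).
Local Notation On := (orthogonal_group R n).
Variables (A : set 'cV[R]_n) (pi : probability On R).
Hypothesis mA : measurable A.
Hypothesis hpi : is_haar pi.

Lemma measurable_shift_diff : measurable_fun setT (shift_diff A).
Proof.
apply: (measurable_fun_fubini_tonelli_F (fun p : 'cV[R]_n * 'cV[R]_n =>
  `|\1_A (p.2 - p.1) - \1_A (p.2 + p.1)|%:E)).
  apply: measurable_shift_integrand => //; apply: measurable_addmx => //.
  exact: measurable_oppmx.
by move=> p; rewrite lee_fin.
Qed.

Lemma shift_diff0 : shift_diff A 0 = 0%E.
Proof.
by rewrite /shift_diff integral0_eq// => z _; rewrite subr0 addr0 subrr normr0.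
Qed.

Definition haar_shift_diff (i : 'I_n) (d : R) : \bar R :=
  (\int[pi]_M shift_diff A (d *: ((M : 'M[R]_n)^T *m delta_mx i 0))%R)%E.

Let mtr d (T : measurableType d) (f : T -> On) (v : T -> 'cV[R]_n) (c : R) :
  measurable_fun setT f -> measurable_fun setT v ->
  measurable_fun setT (fun t => c *: ((f t : 'M[R]_n)^T *m v t)).
Proof.
move=> mf mv; apply: measurable_scalemx => //; apply: measurable_mulmx => //.
by apply: measurable_trmx; exact: (measurableT_comp (@measurable_orthogonal_mx R n) mf).
Qed.

(* Insert a Haar-random [M] by the invariance of the Gaussian measure, then absorb
   into [M] the reflection carrying [v] to a multiple of the i-th basis vector. *)
Lemma haar_gauss_shift_diff (i : 'I_n) (s : R) :
  (\int[g n]_v shift_diff A (s *: v)%R =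
   \int[g n]_v haar_shift_diff i (s * euclidean_norm v))%E.
Proof.
have ms : measurable_fun setT (fun v : 'cV[R]_n => shift_diff A (s *: v)).
  by apply: (measurableT_comp measurable_shift_diff); exact: measurable_scalemx.
have s0 (v : 'cV[R]_n) : (0 <= shift_diff A (s *: v)%R)%E by exact: shift_diff_ge0.
pose F (p : 'cV[R]_n * On) := shift_diff A (s *: ((p.2 : 'M[R]_n)^T *m p.1)).
have mF : measurable_fun setT F.
  by apply: (measurableT_comp measurable_shift_diff); exact: mtr.
have F0 p : (0 <= F p)%E by exact: shift_diff_ge0.
transitivity (\int[pi]_M \int[g n]_v F (v, M))%E.
  transitivity (\int[pi]_(M in setT) (cst (\int[g n]_v shift_diff A (s *: v)%R) M))%E.
    rewrite integral_cst//; apply/esym; rewrite -[RHS]mule1; congr (_ * _)%E.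
    exact: probability_setT.
  apply: eq_integral => M _; apply/esym.
  exact: (gauss_orth (orth_tr (orthogonalP M)) ms s0).
apply: (eq_trans (esym (fubini_tonelli _ mF F0))).
apply: eq_integral => v _; rewrite /F/=.
pose O : On := Orthogonal (introT eqP (householder_orth i v)).
pose f (M : On) := shift_diff A ((s * euclidean_norm v) *: ((M : 'M[R]_n)^T *m delta_mx i 0)).
have mf : measurable_fun setT f.
  by apply: (measurableT_comp measurable_shift_diff); exact: mtr.
apply: (eq_trans _ (@integral_haar R n pi O f hpi mf (fun M => shift_diff_ge0 _ _))).
apply: eq_integral => M _; rewrite /f/= -scalerA; congr (shift_diff A (_ *: _)).
rewrite scalemxAr -(householderE i v).
rewrite trmx_mul -mulmxA (mulmxA (householder i v)^T).
by rewrite (mulmx1C (householder_orth i v)) mul1mx.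
Qed.

Hypothesis cA : convex_set A.
Variable S : R.
Hypothesis hS : (\int[pi]_M \sum_(i < n)
  geometric_influence gauss i (orthogonal_image M A) = S%:E)%E.

Lemma geometric_influence_ge0 (M : On) i :
  (0 <= geometric_influence gauss i (orthogonal_image M A))%E.
Proof.
apply: integral_ge0 => x _; apply: minkowski_content_ge0.
by rewrite orthogonal_imageE; exact: fiber_interval.
Qed.

Lemma sum_haar_shift_diff (d : R) : 0 <= d ->
  (\sum_(i < n) haar_shift_diff i d <= (2 * d * S + 8 * n%:R * d ^+ 2)%:E)%E.
Proof.
(* [d] will be a multiple of the norm of a vector, possibly zero, whereas [le_lower_affine] asks for
   a positive slope. *)
rewrite le_eqVlt => /orP[/eqP <-|d0].
  rewrite big1 ?lee_fin ?expr0n ?mulr0 ?mul0r ?addr0// => i _.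
  rewrite /haar_shift_diff; apply: integral0_eq => M _.
  by rewrite scale0r shift_diff0.
have mh i : measurable_fun setT (fun M : On =>
    shift_diff A (d *: ((M : 'M[R]_n)^T *m delta_mx i 0))).
  by apply: (measurableT_comp measurable_shift_diff); exact: mtr.
rewrite /haar_shift_diff -ge0_integral_sum//; last by move=> i M _; exact: shift_diff_ge0.
have -> : (2 * d * S + 8 * n%:R * d ^+ 2)%:E = ((2 * d)%:E * S%:E + (8 * n%:R * d ^+ 2)%:E)%E.
  by rewrite EFinD EFinM.
rewrite -hS; apply: le_lower_affine.
- by rewrite mulr_gt0.
- by apply: mulr_ge0; [exact: mulr_ge0|exact: sqr_ge0].
- exact: emeasurable_sum.
- by move=> M; apply: sume_ge0 => i _; exact: shift_diff_ge0.
- by move=> M; apply: sume_ge0 => i _; exact: geometric_influence_ge0.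
move=> M.
have -> : ((8 * n%:R * d ^+ 2)%:E = \sum_(i < n) (8 * d ^+ 2)%:E)%E.
  by rewrite sumEFin sumr_const card_ord -mulr_natr; congr EFin; ring.
rewrite ge0_sume_distrr; last by move=> i _; exact: geometric_influence_ge0.
rewrite -big_split/=; apply: lee_sum => i _.
exact: shift_diff_influence.
Qed.

(** [haar_gauss_shift_diff] holds for every [i], so [n] copies of the left integral make the sum
    over all directions. That sum involves the mean norm of a Gaussian vector, which is of order
    [sqrt n]. *)
Lemma gauss_shift_diff_le (s : R) : (0 < n)%N -> 0 < s ->
  (n%:R%:E * \int[g n]_v shift_diff A (s *: v)%R <=
   (s * S * Num.sqrt n%:R * (second_moment R + 1) +
    8 * n%:R ^+ 2 * second_moment R * s ^+ 2)%:E)%E.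
Proof.
move=> n0 s0; set m2 := second_moment R.
have S0 : 0 <= S.
  rewrite -lee_fin -hS; apply: integral_ge0 => M _; apply: sume_ge0 => i _.
  exact: geometric_influence_ge0.
have N0 : 0 < n%:R :> R by rewrite ltr0n.
set r := Num.sqrt n%:R; have r0 : 0 < r by rewrite sqrtr_gt0.
have r2 : r ^+ 2 = n%:R by rewrite sqr_sqrtr// ltW.
have mH i : measurable_fun setT (fun v : 'cV[R]_n => haar_shift_diff i (s * euclidean_norm v)).
  apply: (measurable_fun_fubini_tonelli_F (fun p : 'cV[R]_n * On =>
    shift_diff A ((s * euclidean_norm p.1) *: ((p.2 : 'M[R]_n)^T *m delta_mx i 0)))).
    apply: (measurableT_comp measurable_shift_diff); apply: measurable_scalemx.
      apply: measurable_funM => //.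
      exact: (measurableT_comp (@measurable_norm R n)).
    under eq_fun do rewrite -[_ *m _]scale1r.
    exact: mtr.
  by move=> p; exact: shift_diff_ge0.
have H0 i v : (0 <= haar_shift_diff i (s * euclidean_norm v))%E.
  by apply: integral_ge0 => M _; exact: shift_diff_ge0.
have -> : (n%:R%:E * \int[g n]_v shift_diff A (s *: v)%R =
    \int[g n]_v \sum_(i < n) haar_shift_diff i (s * euclidean_norm v))%E.
  rewrite ge0_integral_sum//.
  have -> : (n%:R%:E = \sum_(i < n) (1%:E : \bar R))%E.
    by rewrite sumEFin sumr_const card_ord.
  rewrite ge0_sume_distrl; last by move=> i _; rewrite lee_fin.
  by apply: eq_bigr => i _; rewrite mul1e -haar_gauss_shift_diff.
have hm := has_meanD
  (has_meanZ (s * S) (has_meanD (has_meanZ r^-1 (has_mean_norm_sqr R n)) (has_mean_cst _ r)))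
  (has_meanZ (8 * n%:R * s ^+ 2) (has_mean_norm_sqr R n)).
have -> : s * S * r * (m2 + 1) + 8 * n%:R ^+ 2 * m2 * s ^+ 2 =
   s * S * (r^-1 * (n%:R * m2) + r) + 8 * n%:R * s ^+ 2 * (n%:R * m2).
  by rewrite -r2; field; rewrite gt_eqF.
have [_ <-] := hm; apply: le_lower_integral => v; first by apply: sume_ge0 => i _.
have e0 := euclidean_norm_ge0 v.
apply: (le_trans (sum_haar_shift_diff (mulr_ge0 (ltW s0) e0))).
rewrite lee_fin; set e := euclidean_norm v in e0 *.
(* Arithmetic-geometric mean with weight [r = sqrt n]: only the second moment of the norm is then
   required. *)
have ner : 2 * e <= r^-1 * e ^+ 2 + r.
  rewrite -(ler_pM2l r0).
  have -> : r * (r^-1 * e ^+ 2 + r) = e ^+ 2 + r * r by field; rewrite gt_eqF.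
  have : 0 <= (e - r) ^+ 2 by exact: sqr_ge0.
  have -> : (e - r) ^+ 2 = e ^+ 2 - 2 * (r * e) + r * r by ring.
  lra.
have : (s * S) * (2 * e) <= (s * S) * (r^-1 * e ^+ 2 + r).
  by rewrite ler_wpM2l// mulr_ge0// ltW.
have -> : 2 * (s * e) * S = s * S * (2 * e) by ring.
have -> : 8 * n%:R * (s * e) ^+ 2 = 8 * n%:R * s ^+ 2 * e ^+ 2 by ring.
lra.
Qed.

Lemma noise_shift_diff (a : R) : 0 < cos a ->
  ((cos a ^+ n)%:E * noise A (cos (a *+ 2)) (sin (a *+ 2)) <=
   \int[g n]_v shift_diff A (sin a *: v)%R)%E.
Proof.
move=> c0; rewrite noise_half//.
have mI : measurable_fun setT (fun p : 'cV[R]_n * 'cV[R]_n =>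
    `|\1_A (cos a *: p.2 - sin a *: p.1) - \1_A (cos a *: p.2 + sin a *: p.1)|%:E : \bar R).
  apply: measurable_shift_integrand => //; apply: measurable_addmx;
    rewrite ?(_ : measurable_fun _ _)//; try exact: measurable_scalemx.
  by apply: measurable_oppmx; exact: measurable_scalemx.
have I0 (p : 'cV[R]_n * 'cV[R]_n) : (0 <=
    `|\1_A (cos a *: p.2 - sin a *: p.1) - \1_A (cos a *: p.2 + sin a *: p.1)|%:E :> \bar R)%E.
  by rewrite lee_fin.
have cn0 : 0 <= cos a ^+ n by rewrite exprn_ge0// ltW.
rewrite -ge0_integralZl//; last 2 first.
- exact: (measurable_fun_fubini_tonelli_F _ mI I0).
- by move=> v _; apply: integral_ge0 => u _; rewrite lee_fin.
apply: le_lower_integral => v.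
  by rewrite mule_ge0 ?lee_fin//; apply: integral_ge0 => u _; rewrite lee_fin.
have mf : measurable_fun setT (fun z : 'cV[R]_n =>
    `|\1_A (z - sin a *: v) - \1_A (z + sin a *: v)|%:E : \bar R).
  by apply: measurable_shift_integrand => //; apply: measurable_addmx.
apply: (gauss_contract c0 (cos_le1 a) mf) => z; by rewrite lee_fin.
Qed.

End averaging.

(** * Comparison of the two bounds on the noise *)

Section elementary_bounds.
Context (R : realType).

Lemma sin_le_id (x : R) : 0 <= x -> sin x <= x.
Proof.
rewrite le_eqVlt => /orP[/eqP <-|x0]; first by rewrite sin0.
have [z _] := @MVT R sin cos 0 x x0 (fun y _ => is_derive_sin y)
  (continuous_subspaceT (@continuous_sin R)).
rewrite sin0 !subr0 => ->.
by apply: ler_piMl; [exact: ltW|exact: cos_le1].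
Qed.

Lemma cos_ge_sqr (x : R) : 0 <= x -> x <= pi -> 1 - x ^+ 2 / 2 <= cos x.
Proof.
move=> x0 xpi; have -> : cos x = 1 - 2 * sin (x / 2) ^+ 2.
  rewrite sin2cos2 {1}(_ : x = (x / 2) *+ 2); last by field.
  by rewrite cos_mulr2n; ring.
have s0 : 0 <= sin (x / 2) by apply: sin_ge0_pi; lra.
have s1 : sin (x / 2) <= x / 2 by apply: sin_le_id; lra.
nra.
Qed.

Lemma bernoulli_ineq (x : R) n : 0 <= x -> x <= 1 -> 1 - n%:R * x <= (1 - x) ^+ n.
Proof.
move=> x0 x1; elim: n => [|n IH]; first by rewrite mul0r subr0 expr0.
rewrite exprS -natr1; have n0 : 0 <= n%:R :> R by exact: ler0n.
apply: (@le_trans _ _ ((1 - x) * (1 - n%:R * x))); last by rewrite ler_wpM2l// subr_ge0.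
nra.
Qed.

(** [t (1 - t) = u (1 - u)] is at most [u], and [u <= 1 - u] makes the logarithm of [1 - u] no
    larger in size than that of [u]. The factor 2 turns 45 into the final 90. *)
Lemma entropy_bound_min (t : R) : 0 < t -> 0 < 1 - t ->
  let u := Num.min t (1 - t) in
  [/\ 0 < u, u <= 2^-1 &
   t * (1 - t) * Num.sqrt (- ln (t * (1 - t))) <= u * (2 * Num.sqrt (- ln u))].
Proof.
move=> tp tp' u; have u0 : 0 < u by rewrite lt_min tp tp'.
have u12 : u <= 2^-1 by rewrite ge_min; apply/orP; case: (leP t 2^-1); [left|right]; lra.
have ttu : t * (1 - t) = u * (1 - u) by rewrite /u; case: leP => _ //; ring.
split => //; set L := - ln u.
have sL : Num.sqrt (- ln (t * (1 - t))) <= 2 * Num.sqrt L.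
  have -> : 2 * Num.sqrt L = Num.sqrt (4 * L).
    by rewrite sqrtrM// (_ : 4 = 2 ^+ 2) ?sqrtr_sqr ?ger0_norm//; ring.
  rewrite ler_wsqrtr// ttu lnM ?posrE//; last by lra.
  have : ln u <= ln (1 - u) by rewrite ler_ln ?posrE//; lra.
  have : ln u <= 0 by rewrite ln_le0//; lra.
  rewrite /L; lra.
apply: ler_pM => //; first by rewrite mulr_ge0// ltW.
by rewrite ttu; apply: ler_piMr; [exact: ltW|lra].
Qed.

End elementary_bounds.

Section main_bound.
Context (R : realType) (n : nat).
Local Notation gauss := (@std_gaussian R).
Local Notation g n := (product_power gauss n).
Local Notation On := (orthogonal_group R n).
Variables (A : set 'cV[R]_n) (pi : probability On R).
Hypothesis mA : measurable A.
Hypothesis hpi : is_haar pi.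
Hypothesis cA : convex_set A.
Hypothesis n0 : (0 < n)%N.
Local Notation m2 := (second_moment R).
Local Notation total_influence M :=
  (\sum_(i < n) geometric_influence gauss i (orthogonal_image M A))%E.

(** The leading 2 pays for the contraction: Bernoulli's inequality and [a <= 1 / (2 n)] give
    [cos a ^ n >= 1/2]. *)
Lemma noise_step (S a : R) : (\int[pi]_M total_influence M = S%:E)%E ->
  0 < a -> a <= (2 * n%:R)^-1 ->
  n%:R * fine (noise A (cos (a *+ 2)) (sin (a *+ 2))) <=
  2 * (a * S * Num.sqrt n%:R * (m2 + 1) + 8 * n%:R ^+ 2 * m2 * a ^+ 2).
Proof.
move=> hS a0 an.
have N1 : 1 <= n%:R :> R by rewrite ler1n.
have an1 : a * n%:R <= 1 / 2.
  have : a * (2 * n%:R) <= 1 by rewrite -ler_pdivlMr ?div1r// mulr_gt0// (lt_le_trans ltr01).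
  lra.
have a12 : a <= 1 / 2 by nra.
have api : a <= trigo.pi by have := pi_ge2 R; lra.
have c1 := cos_ge_sqr (ltW a0) api.
have c0 : 0 < cos a by apply: lt_le_trans c1; nra.
have s0 : 0 < sin a by apply: sin_gt0_pi; rewrite a0/=; have := pi_ge2 R; lra.
have sa : sin a <= a by apply: sin_le_id; exact: ltW.
have cn : 1 / 2 <= cos a ^+ n.
  have x0 : 0 <= a ^+ 2 / 2 by rewrite divr_ge0// sqr_ge0.
  have x1 : a ^+ 2 / 2 <= 1 by nra.
  apply: (@le_trans _ _ ((1 - a ^+ 2 / 2) ^+ n)); last first.
    by rewrite lerXn2r// ?nnegrE ?subr_ge0// ltW.
  apply: le_trans (bernoulli_ineq n x0 x1); nra.
set N := noise A _ _.
have Nfin : N = (fine N)%:E by rewrite /N noiseE// cos2Dsin2.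
have N0 : 0 <= fine N.
  by rewrite fine_ge0//; apply: integral_ge0 => x _; apply: integral_ge0 => y _; rewrite lee_fin.
have S0 : 0 <= S.
  rewrite -lee_fin -hS; apply: integral_ge0 => M _; apply: sume_ge0 => i _.
  exact: geometric_influence_ge0.
have := noise_shift_diff mA c0; rewrite -/N Nfin -EFinM => h1.
have h2 : ((n%:R * (cos a ^+ n * fine N))%:E <=
   (sin a * S * Num.sqrt n%:R * (m2 + 1) + 8 * n%:R ^+ 2 * m2 * sin a ^+ 2)%:E)%E.
  apply: le_trans (gauss_shift_diff_le mA hpi cA hS n0 s0).
  by rewrite EFinM; apply: lee_wpmul2l => //; rewrite lee_fin.
move: h2; rewrite lee_fin => h2.
have m20 := second_moment_ge0 R.
have r0 : 0 <= Num.sqrt n%:R :> R by exact: sqrtr_ge0.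
have e1 : n%:R * (1 / 2 * fine N) <= n%:R * (cos a ^+ n * fine N).
  by rewrite ler_wpM2l// ler_wpM2r.
have e2 : sin a * S * Num.sqrt n%:R * (m2 + 1) <= a * S * Num.sqrt n%:R * (m2 + 1).
  apply: ler_wpM2r; first by rewrite addr_ge0.
  by apply: ler_wpM2r => //; exact: ler_wpM2r.
have e3 : 8 * n%:R ^+ 2 * m2 * sin a ^+ 2 <= 8 * n%:R ^+ 2 * m2 * a ^+ 2.
  apply: ler_wpM2l; first by rewrite !mulr_ge0// sqr_ge0.
  by rewrite lerXn2r// nnegrE ltW.
lra.
Qed.

(** Cut [th] into [k] steps of angle [2 a = th / k]. The linear terms add up to a quantity
    independent of [k], the quadratic ones to [C / k], which tends to 0. *)
Lemma noise_le (S th : R) : (\int[pi]_M total_influence M = S%:E)%E -> 0 < th ->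
  Num.sqrt n%:R * fine (noise A (cos th) (sin th)) <= th * S * (m2 + 1).
Proof.
move=> hS th0; set N := fine _.
have N1 : 1 <= n%:R :> R by rewrite ler1n.
have m20 := second_moment_ge0 R.
set r := Num.sqrt n%:R; have r0 : 0 < r by rewrite sqrtr_gt0 (lt_le_trans ltr01).
have r2 : r ^+ 2 = n%:R by rewrite sqr_sqrtr// (le_trans ler01).
set C := 4 * n%:R ^+ 2 * m2 * th ^+ 2.
have C0 : 0 <= C by rewrite !mulr_ge0// ltW.
have step (k : nat) : th * n%:R <= k%:R -> (0 < k)%N ->
    n%:R * N <= th * S * r * (m2 + 1) + C / k%:R.
  move=> kn k0; have K0 : 0 < k%:R :> R by rewrite ltr0n.
  pose a := th / (2 * k%:R).
  have a0 : 0 < a by rewrite divr_gt0// mulr_gt0.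
  have an : a <= (2 * n%:R)^-1.
    rewrite /a ler_pdivrMr ?mulr_gt0// mulrC ler_pdivlMr ?mulr_gt0// ?(lt_le_trans ltr01)//.
    lra.
  have := noise_step hS a0 an; set Nk := fine _ => hk.
  have NNk : N <= k%:R * Nk.
    have := noise_mul mA (a *+ 2) k.
    have -> : k%:R * (a *+ 2) = th by rewrite /a; field; rewrite gt_eqF.
    rewrite -lee_fin /N noiseE ?cos2Dsin2// => h; apply: (le_trans h).
    by rewrite EFinM /Nk noiseE ?cos2Dsin2.
  have n00 : 0 <= n%:R :> R by rewrite ler0n.
  have h1 : n%:R * N <= k%:R * (n%:R * Nk) by rewrite mulrCA ler_wpM2l.
  have h2 : k%:R * (n%:R * Nk) <= k%:R * (2 * (a * S * r * (m2 + 1) + 8 * n%:R ^+ 2 * m2 * a ^+ 2)).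
    by rewrite ler_wpM2l// ltW.
  apply: (le_trans h1); apply: (le_trans h2).
  rewrite le_eqVlt; apply/orP; left; apply/eqP; rewrite /C /a; field; rewrite gt_eqF//.
have lim : n%:R * N <= th * S * r * (m2 + 1).
  apply/ler_addgt0Pr => e e0.
  have B0 : 0 <= th * n%:R + C / e.
    by apply: addr_ge0; [apply: mulr_ge0 => //; exact: ltW|apply: divr_ge0 => //; exact: ltW].
  (* At least [th * n], so that the steps are short enough for [noise_step], and at least [C / e],
     so that the error is at most [e]. *)
  set k := (Num.bound (th * n%:R + C / e)).+1.
  have kb : th * n%:R + C / e <= k%:R.
    by apply: ltW; apply: (lt_trans (archi_boundP B0)); rewrite ltr_nat.
  have Ce : 0 <= C / e by rewrite divr_ge0// ltW.
  have tn0 : 0 <= th * n%:R by apply: mulr_ge0 => //; exact: ltW.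
  have kth : th * n%:R <= k%:R by lra.
  apply: (le_trans (step k kth isT)); rewrite lerD2l ler_pdivrMr ?ltr0n//.
  by rewrite mulrC -ler_pdivrMr//; lra.
rewrite -(ler_pM2l r0).
have -> : r * (r * N) = n%:R * N by rewrite -r2; ring.
by have -> : r * (th * S * (m2 + 1)) = th * S * r * (m2 + 1) by ring.
Qed.

Lemma noise_setC (c s : R) : noise (~` A) c s = noise A c s.
Proof.
apply: eq_integral => x _; apply: eq_integral => y _; congr EFin.
by rewrite !indicE !in_setC; case: (x \in A); case: (_ \in A); rewrite /= ?subrr// distrC.
Qed.

Lemma haar_total_influence_ge (t : R) : g n A = t%:E ->
  (((90 * (m2 + 1))^-1 * (t * (1 - t) * Num.sqrt (- ln (t * (1 - t)))) *
     Num.sqrt n%:R)%:E <= \int[pi]_M total_influence M)%E.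
Proof.
move=> gA.
have I0 : (0 <= \int[pi]_M total_influence M)%E.
  apply: integral_ge0 => M _; apply: sume_ge0 => i _.
  exact: geometric_influence_ge0.
have /andP[t0 t1] : 0 <= t <= 1 by have := fine_power_bounds mA; rewrite gA.
have [tt0|tt0] := leP (t * (1 - t)) 0.
  apply: le_trans I0; rewrite lee_fin.
  have -> : t * (1 - t) = 0 by apply/eqP; rewrite eq_le tt0 mulr_ge0// subr_ge0.
  by rewrite !(mul0r, mulr0).
have tp : 0 < t by rewrite lt_def t0 andbT; apply: contraTneq tt0 => ->; rewrite mul0r ltxx.
have tp' : 0 < 1 - t.
  by rewrite lt_def subr_ge0 t1 andbT; apply: contraTneq tt0 => ->; rewrite mulr0 ltxx.
case SE : (\int[pi]_M total_influence M)%E I0 => [S| |//] I0; last exact: leey.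
clear I0.
have D0 : 0 < m2 + 1 by rewrite ltr_wpDl// second_moment_ge0.
(* The lower bound wants measure at most 1/2, so [A] may be exchanged for its complement, which has
   the same noise. The complement need not be convex, but the upper bound is still taken for [A]. *)
have [B [mB BA B12]] : exists B : set 'cV[R]_n, [/\ measurable B,
    forall c s, noise B c s = noise A c s &
    fine (g n B) = Num.min t (1 - t)].
  have [h|h] := leP t (1 - t).
    by exists A; split => //; rewrite gA.
  exists (~` A); split; [exact: measurableC|exact: noise_setC|].
  by rewrite probability_setC// gA.
have [] := entropy_bound_min tp tp'; set u := Num.min t (1 - t) in B12 * => u0 u12 uu.
have := @noise_lower R n B mB; rewrite B12 => /(_ u0 u12)[th th0].
rewrite BA noiseE//; last exact: cos2Dsin2.
rewrite -(noiseE mA (cos2Dsin2 th)); rewrite noiseE ?cos2Dsin2// lee_fin => low.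
have := noise_le SE th0; rewrite noiseE ?cos2Dsin2//=.
set N := 2 * _ in low * => up.
set r := Num.sqrt n%:R in up *; have r0 : 0 <= r by exact: sqrtr_ge0.
set L := - ln u in low uu.
have key : r * (45^-1 * u * Num.sqrt L) <= S * (m2 + 1).
  rewrite -(ler_pM2l th0).
  have -> : th * (S * (m2 + 1)) = th * S * (m2 + 1) by ring.
  apply: le_trans up.
  have -> : th * (r * (45^-1 * u * Num.sqrt L)) = r * (45^-1 * th * u * Num.sqrt L) by ring.
  by rewrite ler_wpM2l.
rewrite lee_fin.
have -> : S = (m2 + 1)^-1 * (S * (m2 + 1)) by rewrite mulrC mulfK// gt_eqF.
rewrite invfM -!mulrA [leLHS]mulrCA ler_wpM2l ?invr_ge0 ?(ltW D0)//.
apply: le_trans key.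
have : (t * (1 - t) * Num.sqrt (- ln (t * (1 - t)))) * r <= u * (2 * Num.sqrt L) * r.
  by rewrite ler_wpM2r.
have -> : r * (45^-1 * u * Num.sqrt L) = 90^-1 * (u * (2 * Num.sqrt L) * r) by field.
by rewrite !mulrA => h; rewrite -!mulrA ler_wpM2l// !mulrA.
Qed.

End main_bound.

(** * Existence of a Haar probability *)

Section haar_existence.
Context (R : realType).
Local Notation mR := (measurableTypeR R).
Local Notation gauss := (@std_gaussian R).
Local Notation g n := (product_power gauss n).
Local Notation On n := (orthogonal_group R n).

Lemma measurable_inv : measurable_fun setT (fun x : R => x^-1).
Proof.
rewrite -(setUv [set 0 : R]); apply/measurable_funU => //.
  exact: measurableC.
split; first exact: measurable_fun_set1.
apply: open_continuous_measurable_fun; first by rewrite openC; exact: closed_eq.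
by move=> y /set_mem /= y0; apply: inv_continuous; exact/eqP.
Qed.

Lemma measurable_householder n (i : 'I_n) :
  measurable_fun setT (fun v : 'cV[R]_n => householder i v).
Proof.
have mw : measurable_fun setT (fun v : 'cV[R]_n => v - euclidean_norm v *: delta_mx i 0).
  apply: measurable_addmx => //; apply: measurable_oppmx.
  by apply: measurable_scalemx => //; exact: measurable_norm.
apply: measurable_addmx => //; apply: measurable_oppmx; apply: measurable_scalemx.
  apply: measurable_funM => //.
  apply: (measurableT_comp measurable_inv).
  exact: (measurableT_comp (@measurable_norm_sqr R n) mw).
by apply: measurable_mulmx => //; exact: measurable_trmx.
Qed.

Lemma measurable_diag1 n : measurable_fun setT (@diag1 R n).
Proof.
apply: measurable_fun_mx => i j.
rewrite (_ : (fun _ => _) = (fun A : 'M[R]_n =>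
  match unlift ord0 i, unlift ord0 j with
  | Some k, Some l => A k l | None, None => 1 | _, _ => 0 end)); last first.
  apply/funext => A; rewrite /diag1 !mxE; case: unliftP => [k|] ->; case: unliftP => [l|] ->.
  - case: splitP => [[a la] /= e|a /= [e]]; first by move: la; rewrite -e.
    rewrite mxE; case: splitP => [[b lb] /= f|b /= [f]]; first by move: lb; rewrite -f.
    by congr (A _ _); exact: val_inj.
  - case: splitP => [[a la] /= e|a /= [e]]; first by move: la; rewrite -e.
    by rewrite mxE; case: splitP => [b _|//]; rewrite mxE.
  - case: splitP => [a _|//].
    rewrite mxE; case: splitP => [[b lb] /= f|b /= [f]]; first by move: lb; rewrite -f.
    by rewrite mxE.
  - by case: splitP => [a _|//]; rewrite mxE; case: splitP => [b _|//]; rewrite !ord1 mxE.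
case: (unlift ord0 i) => [k|]; case: (unlift ord0 j) => [l|] //.
exact: measurable_entry.
Qed.

Lemma power_hyperplane0 n : g n.+1 [set v : 'cV[R]_n.+1 | v 0 0 = 0] = 0%E.
Proof.
pose B (i : 'I_n.+1) : set mR := if i == 0 then [set 0] else setT.
have mB i : measurable (B i) by rewrite /B; case: ifP => _.
have -> : [set v : 'cV[R]_n.+1 | v 0 0 = 0] = [set v | forall i, B i (v i 0)].
  apply/seteqP; split => v /=; first by move=> v0 i; rewrite /B; case: eqP => [->|].
  by move=> /(_ 0); rewrite /B eqxx.
rewrite product_power_box// big_ord_recl.
have -> : gauss (B 0) = 0%E; last by rewrite mul0e.
by rewrite /B eqxx; exact: integral_set1.
Qed.

Lemma ae_power_neq0 n : {ae g n.+1, forall v : 'cV[R]_n.+1, v != 0}.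
Proof.
exists [set v : 'cV[R]_n.+1 | v 0 0 = 0]; split.
- have := @measurable_mxentry R _ 'cV[R]_n.+1 n.+1 1 id 0 0 (@measurable_id _ _ _).
  by move=> /(_ measurableT [set 0] (measurable_set1 _)); rewrite setTI.
- exact: power_hyperplane0.
- by move=> v /= /negP; rewrite negbK => /eqP ->; rewrite mxE.
Qed.

Lemma euclidean_norm_orth n (A : 'M[R]_n) (v : 'cV[R]_n) : A *m A^T = 1%:M ->
  euclidean_norm (A *m v) = euclidean_norm v.
Proof.
move=> hA; apply/eqP; rewrite -(@eqrXn2 _ 2)// ?euclidean_norm_ge0//; apply/eqP.
have := trmx_mulmx_norm (A *m v).
rewrite trmx_mul mulmxA -(mulmxA v^T) (mulmx1C hA) mulmx1 trmx_mulmx_norm.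
by move=> /matrixP/(_ 0 0); rewrite !mxE eqxx !mulr1n.
Qed.

(* A Haar-random matrix: its first column is a Gaussian direction and the rest is a
   Haar-random matrix of size [n], recursively. *)
Definition householder_frame n (p : 'cV[R]_n.+1 * On n) : On n.+1 :=
  Orthogonal (introT eqP (orth_mul (householder_orth 0 p.1) (diag1_orth (orthogonalP p.2)))).

Lemma measurable_householder_frame n : measurable_fun setT (@householder_frame n).
Proof.
apply: measurable_to_orthogonal => /=; apply: measurable_mulmx.
  exact: (measurableT_comp (@measurable_householder n.+1 0)).
apply: (measurableT_comp (@measurable_diag1 n)).
exact: (measurableT_comp (@measurable_orthogonal_mx R n)).
Qed.

HB.instance Definition _ n :=
  isMeasurableFun.Build _ _ _ _ (@householder_frame n) (@measurable_householder_frame n).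

(** The reflections of [v] and of [M v] send the first basis vector to the directions of these
    vectors. Hence the reflection of [v], then [M], then the reflection of [M v] fixes it, and is a
    block [N] that does not depend on [K]. *)
Lemma householder_frame_mul n (M : On n.+1) (v : 'cV[R]_n.+1) : v != 0 ->
  exists N : On n, forall K : On n,
    orthogonal_mul M (householder_frame (v, K)) =
    householder_frame ((M : 'M[R]_n.+1) *m v, orthogonal_mul N K).
Proof.
move=> v0; set w := (M : 'M[R]_n.+1) *m v.
have r0 : euclidean_norm v != 0 by rewrite euclidean_norm_eq0.
have hM := orthogonalP M.
have hv := householder_orth 0 v; have hw := householder_orth 0 w.
pose C := (householder 0 w)^T *m (M *m householder 0 v).
have hC : C *m C^T = 1%:M by apply: orth_mul; [exact: orth_tr|exact: orth_mul].
have ev : householder 0 v *m delta_mx 0 0 = (euclidean_norm v)^-1 *: v.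
  apply: (scalerI r0); rewrite scalerA divff// scale1r scalemxAr -householderE.
  by rewrite mulmxA -{2}(householder_tr 0 v) hv mul1mx.
have Ce : C *m delta_mx 0 0 = delta_mx 0 0 :> 'cV[R]_n.+1.
  rewrite /C -!mulmxA ev -!scalemxAr -/w householder_tr householderE.
  by rewrite euclidean_norm_orth// scalerA mulVf// scale1r.
have [N hN CN] := orth_fix_diag1 hC Ce.
exists (Orthogonal (introT eqP hN)) => K; apply: val_inj => /=.
rewrite -diag1_mul -CN /C !mulmxA hw mul1mx.
by rewrite -!mulmxA.
Qed.

(** A left translation moves the Gaussian direction by an orthogonal matrix and multiplies the
    smaller frame by some [N]; the first change is absorbed by Gaussian invariance, the second by
    the induction hypothesis. *)
Lemma haar_exists n : exists pi : probability (On n) R, is_haar pi.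
Proof.
elim: n => [|n [P hP]].
  exists (\d_(@orthogonal1 R 0)) => M B mB; congr (\d_ _ _).
  have all1 (N : On 0) : N = @orthogonal1 R 0 by apply: val_inj; rewrite /= flatmx0 [RHS]flatmx0.
  apply/seteqP; split => [_ [N BN <-]|N BN]; first by rewrite (all1 (orthogonal_mul _ _)) -(all1 N).
  by exists N => //; rewrite (all1 N) (all1 (orthogonal_mul _ _)).
pose Q : probability (On n.+1) R := distribution (g n.+1 \x P)%E (@householder_frame n).
have QE (f : On n.+1 -> \bar R) : measurable_fun setT f -> (forall M, (0 <= f M)%E) ->
    (\int[Q]_M f M = \int[g n.+1]_v \int[P]_N f (householder_frame (v, N)))%E.
  move=> mf f0; rewrite /Q ge0_integral_pushforward//.
  have mf' := measurableT_comp mf (@measurable_householder_frame n).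
  by rewrite preimage_setT (fubini_tonelli1 _ mf') // => p; exact: f0.
exists Q => M B mB.
have mMB : measurable (orthogonal_mul M @` B).
  rewrite orthogonal_mul_image -[_ @^-1` _]setTI.
  exact: measurable_orthogonal_mul.
rewrite -(integral_indicT Q mB) -(integral_indicT Q mMB).
pose f (N : On n.+1) : \bar R := (\1_B N)%:E.
have mf : measurable_fun setT f by apply/measurable_EFinP; exact: measurable_indic.
have f0 N : (0 <= f N)%E by rewrite lee_fin.
pose M' := orthogonal_inv M.
have mfM : measurable_fun setT (fun N => f (orthogonal_mul M' N)).
  exact: (measurableT_comp mf (@measurable_orthogonal_mul R n.+1 M')).
transitivity (\int[Q]_N f (orthogonal_mul M' N))%E.
  apply: eq_integral => N _; rewrite /f !indicE; congr (_%:R)%:E.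
  by congr nat_of_bool; rewrite orthogonal_mul_image; apply/idP/idP; rewrite !inE.
apply: (eq_trans (QE _ mfM (fun N => f0 _))); apply/esym; apply: (eq_trans (QE _ mf f0)).
pose K (v : 'cV[R]_n.+1) := (\int[P]_N f (householder_frame (v, N)))%E.
have mK : measurable_fun setT K.
  apply: (measurable_fun_fubini_tonelli_F (fun p => f (@householder_frame n p))) => //.
  exact: (measurableT_comp mf (@measurable_householder_frame n)).
have K0 v : (0 <= K v)%E by exact: integral_ge0.
apply: (eq_trans (esym (gauss_orth (orthogonalP M') mK K0))).
apply: ge0_ae_eq_integral => //.
- exact: (measurableT_comp mK (measurable_mulmxl _)).
- apply: (measurable_fun_fubini_tonelli_F
    (fun p => f (orthogonal_mul M' (@householder_frame n p)))) => //.
  exact: (measurableT_comp mfM (@measurable_householder_frame n)).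
- by move=> v _; exact: integral_ge0.
(* The zero vector has no direction, so equivariance of the frame holds only almost everywhere. *)
apply: filterS (ae_power_neq0 n) => v v0 _.
have [N hN] := householder_frame_mul M' v0.
pose h (L : On n) := f (householder_frame ((M' : 'M[R]_n.+1) *m v, L)).
have mh : measurable_fun setT h.
  apply: (measurableT_comp mf); apply: (measurableT_comp (@measurable_householder_frame n)).
  exact: measurable_fun_pair.
apply: (eq_trans (esym (@integral_haar R n P N h hP mh (fun L => f0 _)))).
by apply: eq_integral => L _; rewrite hN.
Qed.

End haar_existence.

(** * From the averaged bound to a single rotation *)

Theorem theorem1p9 (R : realType) :
  exists2 c : R, 0 < c &
    forall (n : nat) (A : set 'cV[R]_n) (t : R), (0 < n)%N ->
      convex_set A -> calJ A -> product_power std_gaussian n A = t%:E ->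
      let bound := c * (t * (1 - t) * Num.sqrt (- ln (t * (1 - t)))) *
                   Num.sqrt n%:R in
      (forall pi : probability (orthogonal_group R n) R, is_haar pi ->
         (bound%:E <= \int[pi]_M
            \sum_(i < n)
              geometric_influence std_gaussian i (orthogonal_image M A))%E) /\
      (exists g : orthogonal_group R n,
         (bound%:E <= \sum_(i < n)
            geometric_influence std_gaussian i (orthogonal_image g A))%E).
Proof.
have D0 : 0 < second_moment R + 1 by rewrite ltr_wpDl// second_moment_ge0.
pose c1 : R := (90 * (second_moment R + 1))^-1.
have c10 : 0 < c1 by rewrite invr_gt0 mulr_gt0.
(* Integrating strict pointwise inequalities yields only a weak one; half of the averaged constant
   leaves the strict gap that produces a single rotation. *)
exists (c1 / 2); first by rewrite divr_gt0.
move=> n A t n0 cA [mA _] gA.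
set h := t * (1 - t) * Num.sqrt _; set r := Num.sqrt n%:R; cbv zeta.
have /andP[t0 t1] : 0 <= t <= 1 by have := fine_power_bounds mA; rewrite gA.
have h0 : 0 <= h by rewrite !mulr_ge0 ?sqrtr_ge0// subr_ge0.
have r0 : 0 < r by rewrite sqrtr_gt0 ltr0n.
have half : c1 / 2 * h * r = c1 * h * r / 2 by ring.
have b0 : 0 <= c1 * h * r.
  by apply: mulr_ge0; [apply: mulr_ge0 => //|]; exact: ltW.
split=> [pi hpi|].
  apply: le_trans (haar_total_influence_ge mA hpi cA n0 gA).
  by rewrite lee_fin half -/c1 -/h -/r ler_pdivrMr// ler_peMr// ler1n.
have [pi hpi] := haar_exists R n.
have := haar_total_influence_ge mA hpi cA n0 gA; rewrite -/c1 -/h -/r => le_int.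
(* When the bound is zero, halving gives no gap, but then the identity works since influences are
   nonnegative. *)
have [b1|b1] := eqVneq (c1 * h * r) 0.
  exists (@orthogonal1 R n); rewrite half b1 mul0r.
  by apply: sume_ge0 => i _; exact: geometric_influence_ge0.
apply: contrapT => /forallNP small.
have : (\int[pi]_M \sum_(i < n)
    geometric_influence std_gaussian i (orthogonal_image M A) <= (c1 * h * r / 2)%:E)%E.
  have [_ <-] := has_mean_cst pi (c1 * h * r / 2).
  apply: le_lower_integral => M.
    by apply: sume_ge0 => i _; exact: geometric_influence_ge0.
  by have /negP := small M; rewrite half -ltNge => /ltW.
move=> /(le_trans le_int); rewrite lee_fin.
have : 0 < c1 * h * r by rewrite lt_def b1.
lra.
Qed.
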